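(* Let $q$ be an odd prime power. For each $K$-orbit $o$ of lines of $\mathrm{PG}(5,q)$, the numbers of lines of $o$ contained in a fixed hyperplane belonging to $\mathcal H_1$, $\mathcal H_{2,r}$, $\mathcal H_{2,i}$, $\mathcal H_3$ respectively are: - $o_5$: $\frac12q(q+1)$; $2q^2+q$; $0$; $\frac12q(q+1)$. - $o_6$: $(q+1)^2$; $3q+1$; $q+1$; $q+1$. - $o_{8,1}$: $q^3(q+1)$; $\frac12q^2(2q^2+3q-1)$; $\frac12q^2(q+1)$; $\frac12q^2(q+1)^2$. - $o_{8,2}$: $0$; $\frac{q^2(q-1)(2q^2+3q+1)}{2(q+1)}$; $\frac12q^2(q+1)$; $\frac12q^2(q^2-1)$. - $o_9$: $q(q^2-1)$; $2q(q^2-1)$; $0$; $q^2(q+1)$. - $o_{10}$: $\frac12q(q-1)$; $q(q-1)$; $q^2$; $\frac12q(q-1)$. - $o_{12,1}$: $q+2$; $\frac{2q^2+q-1}{q(q+1)}$; $\frac{2q^2-q-1}{q(q-1)}$; $1$. - $o_{13,1}$: $\frac32q^3(q^2-1)$; $\frac12q^2(q-1)(q^2+3q-2)$; $\frac12q^2(q+1)(q^2+q-2)$; $\frac12q^2(q+1)(q^2-1)$. - $o_{13,2}$: $\frac12q^3(q^2-1)$; $\frac12q^3(q-1)(q+3)$; $\frac12q^3(q+1)^2$; $\frac12q^2(q+1)(q^2-1)$. - $o_{14,1}$: $\frac16q^3(q-1)(q^2-1)$; $\frac1{24}q^2(q-1)^2(q^2+4q-3)$; $\frac1{24}q^2(q^2-1)(q^2+2q-3)$;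 $\frac1{24}q^2(q^2-1)(q^2-2)$. - $o_{14,2}$: $0$; $\frac18q^2(q-1)^2(q^2+4q+1)$; $\frac18q^2(q^2-1)(q^2+2q+1)$; $\frac18q^2(q^2-1)(q^2-2)$. - $o_{15,1}$: $\frac12q^3(q-1)(q^2-1)$; $\frac14q^2(q-1)^2(q^2+2q-1)$; $\frac14q^2(q^2-1)^2$; $\frac14q^4(q^2-1)$. - $o_{15,2}$: $0$; $\frac14q^2(q-1)^2(q^2+2q+1)$; $\frac14q^2(q^4-1)$; $\frac14q^4(q^2-1)$. - $o_{16,1}$: $2q^2(q^2-1)$; $q(q-1)(q^2+2q-1)$; $q(q+1)(q^2-1)$; $q^3(q+1)$. - $o_{17}$: $\frac13q^3(q-1)(q^2-1)$; $\frac13q^3(q-1)(q^2-1)$; $\frac13q^3(q-1)(q^2-1)$; $\frac13q^2(q^4-1)$.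
   Context: A point $(y_0,\dots,y_5)$ of $\mathrm{PG}(5,q)$ is identified with the nonzero symmetric matrix $\begin{bmatrix} y_0&y_1&y_2\\ y_1&y_3&y_4\\ y_2&y_4&y_5\end{bmatrix}$ up to scalar. $K\cong\mathrm{PGL}(3,q)$ acts by $M\mapsto AMA^T$, $A\in\mathrm{GL}(3,q)$. Hyperplanes correspond to conics of $\mathrm{PG}(2,q)$ (nonzero quadratic forms up to scalar): $\sum_{0\le i\le j\le2}a_{ij}X_iX_j$ corresponds to $a_{00}Y_0+a_{01}Y_1+a_{02}Y_2+a_{11}Y_3+a_{12}Y_4+a_{22}Y_5=0$. $\mathcal H_1,\mathcal H_{2,r},\mathcal H_{2,i},\mathcal H_3$ are the $K$-orbits of hyperplanes corresponding respectively to double lines, pairs of distinct real lines (over $\mathbb F_q$), pairs of conjugate imaginary lines (over $\mathbb F_{q^2}$), and non-singular conics. For $q$ odd there are 15 $K$-orbits of lines (a known classification), with representatives as follows, where $(x,y)$ ranges over $\mathrm{PG}(1,q)$ and the symmetric matrix is listed by its rows: $o_5$: $[x,0,0;\,0,y,0;\,0,0,0]$. $o_6$: $[x,y,0;\,y,0,0;\,0,0,0]$. $o_{8,1}$: $[x,0,0;\,0,y,0;\,0,0,-y]$. $o_{8,2}$: $[x,0,0;\,0,y,0;\,0,0,-\delta y]$. $o_9$: $[x,0,y;\,0,y,0;\,y,0,0]$. $o_{10}$: $[v_0x,y,0;\,y,x+uy,0;\,0,0,0]$. $o_{12,1}$: $[0,x,0;\,x,0,y;\,0,y,0]$. $o_{13,1}$: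 $[0,x,0;\,x,y,0;\,0,0,-y]$. $o_{13,2}$: $[0,x,0;\,x,y,0;\,0,0,-\delta y]$. $o_{14,1}$: $[x,0,0;\,0,-(x+y),0;\,0,0,y]$. $o_{14,2}$: $[x,0,0;\,0,-\delta(x+y),0;\,0,0,y]$. $o_{15,1}$: $[v_1y,x,0;\,x,ux+y,0;\,0,0,x]$. $o_{15,2}$: $[v_2y,x,0;\,x,ux+y,0;\,0,0,x]$. $o_{16,1}$: $[0,0,x;\,0,x,y;\,x,y,0]$. $o_{17}$: $[\alpha^{-1}x,y,0;\,y,\beta y-\gamma x,x;\,0,x,y]$. Here $u,v_0,v_1,v_2,\alpha,\beta,\gamma,\delta\in\mathbb F_q$ satisfy: $v_i\ne0$ and $v_i\lambda^2+uv_i\lambda-1\neq0$ for all $\lambda\in\mathbb F_q$ ($i=0,1,2$); $\lambda^3+\gamma\lambda^2-\beta\lambda+\alpha\ne0$ for all $\lambda\in\mathbb F_q$; $-v_1$ is a square, $-v_2$ is a non-square and $\delta$ is a non-square in $\mathbb F_q$.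
   Formalization: In the row o_{12,1} all four printed numbers are multiplied by q^2 (e.g. q^2(q+2) for H_1 and q^2 for H_3), because the printed entries cannot be counts: for q=3 the entry for H_{2,r} is 5/3. *)

(* Defs.v *)
From mathcomp Require Import all_boot all_order all_algebra.
From mathcomp Require Export mpoly.

Set Implicit Arguments.
Unset Strict Implicit.
Unset Printing Implicit Defensive.

Import GRing.Theory.
Local Open Scope ring_scope.

(** A subspace of PG(5,q) is represented by the underlying linear subspace of
    the space of symmetric 3 x 3 matrices over F, as the finite set of its
    vectors (so the zero matrix belongs to every subspace). *)

Section Geometry.
Variable F : finFieldType.
Implicit Types (L : {set 'M[F]_3}) (p : {mpoly F[3]}).

Definition mx_of_rows (rows : seq (seq F)) : 'M[F]_3 :=
  \matrix_(i < 3, j < 3) nth 0 (nth [::] rows i) j.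

(** The line { M(x,y) | (x,y) in PG(1,q) }, for M linear in (x,y). *)
Definition line_of (M : F -> F -> 'M[F]_3) : {set 'M[F]_3} :=
  [set M xy.1 xy.2 | xy : F * F].

(** Scalar matrices act trivially on subspaces, so the orbits of
    K = PGL(3,q) on lines are those of GL(3,q). *)
Definition K_act (A : 'M[F]_3) L : {set 'M[F]_3} :=
  [set A *m M *m A^T | M in L].

Definition K_orbit L : {set {set 'M[F]_3}} :=
  [set K_act A L | A in unitmx].

(** [p@_(U_(i) + U_(j))] is the coefficient a_ij of X_i X_j in the quadratic
    form p, and the coordinate Y attached to a_ij is the entry M i j. *)
Definition hyperplane p : {set 'M[F]_3} :=
  [set M : 'M[F]_3 | (M^T == M) &&
     (\sum_(i < 3) \sum_(j < 3 | (i <= j)%N) p@_(U_(i) + U_(j)) * M i j == 0)].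

End Geometry.

Section Conics.

Definition linear_form (R : nzRingType) (l : {mpoly R[3]}) : Prop :=
  l != 0 /\ l \is 1.-homog.

Definition distinct_lines (R : nzRingType) (l m : {mpoly R[3]}) : Prop :=
  forall k : R, m != k *: l.

Variable F : finFieldType.
Implicit Types p : {mpoly F[3]}.

Definition is_conic p : Prop := p != 0 /\ p \is 2.-homog.

Definition is_double_line p : Prop :=
  exists (c : F) (l : {mpoly F[3]}),
    [/\ c != 0, linear_form l & p = c *: (l * l)].

Definition is_real_line_pair p : Prop :=
  exists (c : F) (l m : {mpoly F[3]}),
    [/\ c != 0, linear_form l, linear_form m, distinct_lines l m
      & p = c *: (l * m)].

(** E is the quadratic extension of F and the conjugate of a line is obtained
    by applying x |-> x^q to its coefficients. *)
Definition is_imaginary_line_pair p : Prop :=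
  exists (E : finFieldType) (iota : {rmorphism F -> E})
         (c : F) (l : {mpoly E[3]}),
    let l' := map_mpoly (fun x : E => x ^+ #|F|) l in
    [/\ #|E| = (#|F| ^ 2)%N, c != 0, linear_form l, distinct_lines l l'
      & map_mpoly iota p = iota c *: (l * l')].

Definition singular_point (E : fieldType) (f : {mpoly E[3]}) (v : 'I_3 -> E)
  : Prop :=
  [/\ exists i, v i != 0, f.@[v] = 0 & forall i : 'I_3, (f^`M(i)).@[v] = 0].

(** No singular points, also over extension fields. *)
Definition is_nonsingular_conic p : Prop :=
  is_conic p /\
  forall (E : fieldType) (iota : {rmorphism F -> E}) (v : 'I_3 -> E),
    ~ singular_point (map_mpoly iota p) v.

End Conics.

(** The four K-orbits of hyperplanes, named after the types of conics. *)
Variant hyperplane_orbit := H1 | H2r | H2i | H3.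

Definition in_hyperplane_orbit (F : finFieldType) (h : hyperplane_orbit)
    (p : {mpoly F[3]}) : Prop :=
  match h with
  | H1 => is_double_line p
  | H2r => is_real_line_pair p
  | H2i => is_imaginary_line_pair p
  | H3 => is_nonsingular_conic p
  end.

Variant line_orbit :=
  | o5 | o6 | o8_1 | o8_2 | o9 | o10 | o12_1 | o13_1 | o13_2
  | o14_1 | o14_2 | o15_1 | o15_2 | o16_1 | o17.

Section Representatives.
Variable F : finFieldType.

Definition square (x : F) : bool := [exists s : F, x == s ^+ 2].

Definition quadratic_condition (u v : F) : Prop :=
  v != 0 /\ forall t : F, v * t ^+ 2 + u * v * t - 1 != 0.

Definition cubic_condition (alpha beta gamma : F) : Prop :=
  forall t : F, t ^+ 3 + gamma * t ^+ 2 - beta * t + alpha != 0.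

(** [representative o M]: the line { M(x,y) } is a representative of the
    orbit o, for some admissible value of the parameters it involves. The
    parameter u is not shared between o10, o15_1 and o15_2: for q = 3 no single
    u is compatible with both a v1 and a v2. *)
Variant representative : line_orbit -> (F -> F -> 'M[F]_3) -> Prop :=
  | rep_o5 :
      representative o5 (fun x y => mx_of_rows
        [:: [:: x; 0; 0]; [:: 0; y; 0]; [:: 0; 0; 0]])
  | rep_o6 :
      representative o6 (fun x y => mx_of_rows
        [:: [:: x; y; 0]; [:: y; 0; 0]; [:: 0; 0; 0]])
  | rep_o8_1 :
      representative o8_1 (fun x y => mx_of_rows
        [:: [:: x; 0; 0]; [:: 0; y; 0]; [:: 0; 0; - y]])
  | rep_o8_2 (delta : F) of ~~ square delta :
      representative o8_2 (fun x y => mx_of_rows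
        [:: [:: x; 0; 0]; [:: 0; y; 0]; [:: 0; 0; - (delta * y)]])
  | rep_o9 :
      representative o9 (fun x y => mx_of_rows
        [:: [:: x; 0; y]; [:: 0; y; 0]; [:: y; 0; 0]])
  | rep_o10 (u v0 : F) of quadratic_condition u v0 :
      representative o10 (fun x y => mx_of_rows
        [:: [:: v0 * x; y; 0]; [:: y; x + u * y; 0]; [:: 0; 0; 0]])
  | rep_o12_1 :
      representative o12_1 (fun x y => mx_of_rows
        [:: [:: 0; x; 0]; [:: x; 0; y]; [:: 0; y; 0]])
  | rep_o13_1 :
      representative o13_1 (fun x y => mx_of_rows
        [:: [:: 0; x; 0]; [:: x; y; 0]; [:: 0; 0; - y]])
  | rep_o13_2 (delta : F) of ~~ square delta :
      representative o13_2 (fun x y => mx_of_rows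
        [:: [:: 0; x; 0]; [:: x; y; 0]; [:: 0; 0; - (delta * y)]])
  | rep_o14_1 :
      representative o14_1 (fun x y => mx_of_rows
        [:: [:: x; 0; 0]; [:: 0; - (x + y); 0]; [:: 0; 0; y]])
  | rep_o14_2 (delta : F) of ~~ square delta :
      representative o14_2 (fun x y => mx_of_rows
        [:: [:: x; 0; 0]; [:: 0; - (delta * (x + y)); 0]; [:: 0; 0; y]])
  | rep_o15_1 (u v1 : F) of quadratic_condition u v1 & square (- v1) :
      representative o15_1 (fun x y => mx_of_rows
        [:: [:: v1 * y; x; 0]; [:: x; u * x + y; 0]; [:: 0; 0; x]])
  | rep_o15_2 (u v2 : F) of quadratic_condition u v2 & ~~ square (- v2) :
      representative o15_2 (fun x y => mx_of_rows
        [:: [:: v2 * y; x; 0]; [:: x; u * x + y; 0]; [:: 0; 0; x]])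
  | rep_o16_1 :
      representative o16_1 (fun x y => mx_of_rows
        [:: [:: 0; 0; x]; [:: 0; x; y]; [:: x; y; 0]])
  | rep_o17 (alpha beta gamma : F) of cubic_condition alpha beta gamma :
      representative o17 (fun x y => mx_of_rows
        [:: [:: alpha^-1 * x; y; 0]; [:: y; beta * y - gamma * x; x];
            [:: 0; x; y]]).

End Representatives.

(** Number of lines of o in a hyperplane of h. In the row o12_1 the factor
    q^2 is missing from the published table, whose entries for that row are
    not integers (e.g. 5/3 in the column H2r for q = 3). *)
Definition line_count (o : line_orbit) (h : hyperplane_orbit) (q : rat) : rat :=
  match o, h with
  | o5, H1 => 1 / 2 * q * (q + 1)
  | o5, H2r => 2 * q ^+ 2 + q
  | o5, H2i => 0
  | o5, H3 => 1 / 2 * q * (q + 1)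
  | o6, H1 => (q + 1) ^+ 2
  | o6, H2r => 3 * q + 1
  | o6, H2i => q + 1
  | o6, H3 => q + 1
  | o8_1, H1 => q ^+ 3 * (q + 1)
  | o8_1, H2r => 1 / 2 * q ^+ 2 * (2 * q ^+ 2 + 3 * q - 1)
  | o8_1, H2i => 1 / 2 * q ^+ 2 * (q + 1)
  | o8_1, H3 => 1 / 2 * q ^+ 2 * (q + 1) ^+ 2
  | o8_2, H1 => 0
  | o8_2, H2r =>
      (q ^+ 2 * (q - 1) * (2 * q ^+ 2 + 3 * q + 1)) / (2 * (q + 1))
  | o8_2, H2i => 1 / 2 * q ^+ 2 * (q + 1)
  | o8_2, H3 => 1 / 2 * q ^+ 2 * (q ^+ 2 - 1)
  | o9, H1 => q * (q ^+ 2 - 1)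
  | o9, H2r => 2 * q * (q ^+ 2 - 1)
  | o9, H2i => 0
  | o9, H3 => q ^+ 2 * (q + 1)
  | o10, H1 => 1 / 2 * q * (q - 1)
  | o10, H2r => q * (q - 1)
  | o10, H2i => q ^+ 2
  | o10, H3 => 1 / 2 * q * (q - 1)
  | o12_1, H1 => q ^+ 2 * (q + 2)
  | o12_1, H2r => q ^+ 2 * ((2 * q ^+ 2 + q - 1) / (q * (q + 1)))
  | o12_1, H2i => q ^+ 2 * ((2 * q ^+ 2 - q - 1) / (q * (q - 1)))
  | o12_1, H3 => q ^+ 2 * 1
  | o13_1, H1 => 3 / 2 * q ^+ 3 * (q ^+ 2 - 1)
  | o13_1, H2r => 1 / 2 * q ^+ 2 * (q - 1) * (q ^+ 2 + 3 * q - 2)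
  | o13_1, H2i => 1 / 2 * q ^+ 2 * (q + 1) * (q ^+ 2 + q - 2)
  | o13_1, H3 => 1 / 2 * q ^+ 2 * (q + 1) * (q ^+ 2 - 1)
  | o13_2, H1 => 1 / 2 * q ^+ 3 * (q ^+ 2 - 1)
  | o13_2, H2r => 1 / 2 * q ^+ 3 * (q - 1) * (q + 3)
  | o13_2, H2i => 1 / 2 * q ^+ 3 * (q + 1) ^+ 2
  | o13_2, H3 => 1 / 2 * q ^+ 2 * (q + 1) * (q ^+ 2 - 1)
  | o14_1, H1 => 1 / 6 * q ^+ 3 * (q - 1) * (q ^+ 2 - 1)
  | o14_1, H2r =>
      1 / 24 * q ^+ 2 * (q - 1) ^+ 2 * (q ^+ 2 + 4 * q - 3)
  | o14_1, H2i =>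
      1 / 24 * q ^+ 2 * (q ^+ 2 - 1) * (q ^+ 2 + 2 * q - 3)
  | o14_1, H3 => 1 / 24 * q ^+ 2 * (q ^+ 2 - 1) * (q ^+ 2 - 2)
  | o14_2, H1 => 0
  | o14_2, H2r =>
      1 / 8 * q ^+ 2 * (q - 1) ^+ 2 * (q ^+ 2 + 4 * q + 1)
  | o14_2, H2i =>
      1 / 8 * q ^+ 2 * (q ^+ 2 - 1) * (q ^+ 2 + 2 * q + 1)
  | o14_2, H3 => 1 / 8 * q ^+ 2 * (q ^+ 2 - 1) * (q ^+ 2 - 2)
  | o15_1, H1 => 1 / 2 * q ^+ 3 * (q - 1) * (q ^+ 2 - 1)
  | o15_1, H2r =>
      1 / 4 * q ^+ 2 * (q - 1) ^+ 2 * (q ^+ 2 + 2 * q - 1)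
  | o15_1, H2i => 1 / 4 * q ^+ 2 * (q ^+ 2 - 1) ^+ 2
  | o15_1, H3 => 1 / 4 * q ^+ 4 * (q ^+ 2 - 1)
  | o15_2, H1 => 0
  | o15_2, H2r =>
      1 / 4 * q ^+ 2 * (q - 1) ^+ 2 * (q ^+ 2 + 2 * q + 1)
  | o15_2, H2i => 1 / 4 * q ^+ 2 * (q ^+ 4 - 1)
  | o15_2, H3 => 1 / 4 * q ^+ 4 * (q ^+ 2 - 1)
  | o16_1, H1 => 2 * q ^+ 2 * (q ^+ 2 - 1)
  | o16_1, H2r => q * (q - 1) * (q ^+ 2 + 2 * q - 1)
  | o16_1, H2i => q * (q + 1) * (q ^+ 2 - 1)
  | o16_1, H3 => q ^+ 3 * (q + 1)
  | o17, H1 => 1 / 3 * q ^+ 3 * (q - 1) * (q ^+ 2 - 1)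
  | o17, H2r => 1 / 3 * q ^+ 3 * (q - 1) * (q ^+ 2 - 1)
  | o17, H2i => 1 / 3 * q ^+ 3 * (q - 1) * (q ^+ 2 - 1)
  | o17, H3 => 1 / 3 * q ^+ 2 * (q ^+ 4 - 1)
  end.

(* Main.v *)
(**
Let the hyperplane be { N | tr (P N) = 0 } with P a symmetric matrix, the Gram
matrix of the conic, and let L be a line with points M_0, ..., M_q. By
orbit-stabilizer, the number of lines of the orbit of L in the hyperplane is the
number of A in GL(3,q) with tr (P A M_i A^T) = 0 for all i, divided by the order
of the stabilizer of L in GL(3,q). As i varies, the q + 1 sets
{ A | tr (P A M_i A^T) = 0 } cover every A once, except those mapping L into the
hyperplane, which they cover q + 1 times; hence
  |GL(3,q)| + q #{ A | A L A^T in the hyperplane } =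
    sum_i #{ A | tr (P A M_i A^T) = 0 }.
Each term on the right depends only on the types (double line, pair of real or
of imaginary lines, smooth conic) of the quadratic forms P and M_i, since for q
odd the type determines the form up to congruence and scaling. It remains to
compute the sixteen incidence numbers of the types, the types of the points of
each representative, and the stabilizer of each representative.

For o17 the space F^3 is identified with the cubic field K = F(z), where z is a
root of the irreducible cubic. The stabilizer then consists of the Galois group
of order 3 extended by the nonzero scalars.
*)

Require Import Defs.
From mathcomp Require Import all_boot all_order all_algebra.
From mathcomp Require Import fingroup perm cyclic pgroup abelian finalg finfield fieldext.
From mathcomp Require Import ring.

Set Implicit Arguments.
Unset Strict Implicit.
Unset Printing Implicit Defensive.

Import GRing.Theory FinRing.Theory.
Local Open Scope ring_scope.

(** Asking that two spanning points of L enter the hyperplane imposes two quadratic conditions on A,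
    whose common solutions depend on the relative position of the two points; passing to the pencil
    leaves single conditions, which see only types. Working in GL(3,q) rather than PGL(3,q) is
    harmless, since the q - 1 scalars multiply both the number of matrices and the order of the
    stabilizer. One nonsquare d serves as reference for all pairs of imaginary lines, because the
    nonsquares form a single class modulo squares. Once the distribution of types and the stabilizer
    order of a line are known, its four table entries become identities between rational functions
    of q. Most stabilizers come from solving the quadratic equations in the nine entries of A, and
    singular points of the line supply the first vanishing entries. The lines of o17 have no
    singular point, so nothing starts the elimination there. The cubic field replaces it: in a
    suitable basis the two forms spanning the line are coordinates of the product in K, and the
    equations say that certain products of rows lie in F z. *)

(** Lets [ring] derive one equation from another: after [apply: (lin_eq E)] it remains to see that
    the two differences of sides agree. *)
Lemma lin_eq (V : zmodType) (a b n n' : V) : a = b -> n - n' = a - b -> n = n'.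
Proof. by move=> -> /eqP; rewrite subrr subr_eq0 => /eqP. Qed.

(** * Matrices of order three *)

Section Matrix3.
Variable R : comNzRingType.
Implicit Types (A : 'M[R]_3).

(** Same body as [mx_of_rows], so that the representatives convert to it. *)
Definition mx3 (a b c d e f g h i : R) : 'M[R]_3 :=
  \matrix_(k < 3, l < 3)
    nth 0 (nth [::] [:: [:: a; b; c]; [:: d; e; f]; [:: g; h; i]] k) l.

Lemma ord3P (P : 'I_3 -> Prop) : P 0 -> P 1 -> P 2 -> forall i, P i.
Proof.
move=> P0 P1 P2 [[|[|[|//]]] lti]; [move: P0|move: P1|move: P2];
  by congr P; apply: val_inj.
Qed.

Lemma sum3 (M : nmodType) (f : 'I_3 -> M) : \sum_i f i = f 0 + f 1 + f 2.
Proof.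
rewrite !big_ord_recl big_ord0 addr0 addrA.
by congr (_ + f _ + f _); apply: val_inj.
Qed.

Lemma mx3_eta A : A = mx3 (A 0 0) (A 0 1) (A 0 2) (A 1 0) (A 1 1) (A 1 2)
                          (A 2 0) (A 2 1) (A 2 2).
Proof.
by apply/matrixP; do 2!(apply: ord3P); rewrite !mxE.
Qed.

Lemma mx3_inj a b c d e f g h i a' b' c' d' e' f' g' h' i' :
  mx3 a b c d e f g h i = mx3 a' b' c' d' e' f' g' h' i' ->
  [/\ a = a', b = b' & c = c'] /\ [/\ d = d', e = e' & f = f'] /\
  [/\ g = g', h = h' & i = i'].
Proof.
move/matrixP => E; split; [|split]; split;
  [have := E 0 0|have := E 0 1|have := E 0 2|have := E 1 0|have := E 1 1
  |have := E 1 2|have := E 2 0|have := E 2 1|have := E 2 2]; by rewrite !mxE.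
Qed.

Lemma mulmx3 a b c d e f g h i a' b' c' d' e' f' g' h' i' :
  mx3 a b c d e f g h i *m mx3 a' b' c' d' e' f' g' h' i' =
  mx3 (a * a' + b * d' + c * g') (a * b' + b * e' + c * h')
      (a * c' + b * f' + c * i')
      (d * a' + e * d' + f * g') (d * b' + e * e' + f * h')
      (d * c' + e * f' + f * i')
      (g * a' + h * d' + i * g') (g * b' + h * e' + i * h')
      (g * c' + h * f' + i * i').
Proof. by apply/matrixP; do 2!(apply: ord3P); rewrite !mxE !sum3 !mxE. Qed.

Lemma trmx3 a b c d e f g h i :
  (mx3 a b c d e f g h i)^T = mx3 a d g b e h c f i.
Proof. by apply/matrixP; do 2!(apply: ord3P); rewrite !mxE. Qed.

Lemma scalemx3 k a b c d e f g h i : k *: mx3 a b c d e f g h i =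
  mx3 (k * a) (k * b) (k * c) (k * d) (k * e) (k * f) (k * g) (k * h) (k * i).
Proof. by apply/matrixP; do 2!(apply: ord3P); rewrite !mxE. Qed.

Lemma addmx3 a b c d e f g h i a' b' c' d' e' f' g' h' i' :
  mx3 a b c d e f g h i + mx3 a' b' c' d' e' f' g' h' i' =
  mx3 (a + a') (b + b') (c + c') (d + d') (e + e') (f + f')
      (g + g') (h + h') (i + i').
Proof. by apply/matrixP; do 2!(apply: ord3P); rewrite !mxE. Qed.

Lemma det_mx3 a b c d e f g h i : \det (mx3 a b c d e f g h i) =
  a * (e * i - f * h) - b * (d * i - f * g) + c * (d * h - e * g).
Proof.
have E2 (B : 'M[R]_2) : \det B = B 0 0 * B 1 1 - B 0 1 * B 1 0.
  rewrite (expand_det_row _ 0) !big_ord_recl big_ord0 /cofactor !det_mx11 !mxE.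
  have -> : lift (0 : 'I_2) (0 : 'I_1) = 1 by apply: val_inj.
  have -> : lift (1 : 'I_2) (0 : 'I_1) = 0 by apply: val_inj.
  have -> : (-1 : R) ^+ ((0%R : 'I_2) + (0%R : 'I_2))%N = 1 by [].
  have -> : (-1 : R) ^+ ((0%R : 'I_2) + (1%R : 'I_2))%N = -1 by [].
  by rewrite mul1r mulN1r mulrN addr0.
have l00 : lift (0 : 'I_3) (0 : 'I_2) = 1 by apply: val_inj.
have l01 : lift (0 : 'I_3) (1 : 'I_2) = 2 by apply: val_inj.
have l10 : lift (1 : 'I_3) (0 : 'I_2) = 0 by apply: val_inj.
have l11 : lift (1 : 'I_3) (1 : 'I_2) = 2 by apply: val_inj.
have l20 : lift (2 : 'I_3) (0 : 'I_2) = 0 by apply: val_inj.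
have l21 : lift (2 : 'I_3) (1 : 'I_2) = 1 by apply: val_inj.
rewrite (expand_det_row _ 0) sum3 /cofactor !E2.
have -> : (-1 : R) ^+ ((0%R : 'I_3) + (0%R : 'I_3))%N = 1 by [].
have -> : (-1 : R) ^+ ((0%R : 'I_3) + (1%R : 'I_3))%N = -1 by [].
have -> : (-1 : R) ^+ ((0%R : 'I_3) + (2%R : 'I_3))%N = 1 by rewrite /= expr2 mulrNN mulr1.
rewrite !mxE ?l00 ?l01 ?l10 ?l11 ?l20 ?l21.
by rewrite !mul1r mulN1r mulrN.
Qed.

Lemma mxtrace3 a b c d e f g h i : \tr (mx3 a b c d e f g h i) = a + e + i.
Proof. by rewrite /mxtrace sum3 !mxE. Qed.

End Matrix3.

(** * Squares in a finite field of odd order *)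

Section Squares.
Variable F : finFieldType.
Hypothesis q_odd : odd #|F|.

(** The additive order of 1 divides q, so q = 0 in F; if also 2 = 0, an odd q would equal 1. *)
Lemma two_neq0 : 2 != 0 :> F.
Proof.
apply/eqP => E2; have E0 : #|F|%:R = 0 :> F.
  by have := @expg_cardG F [set: F]%G 1%R (in_setT _); rewrite cardsT zmodXgE.
have := odd_double_half #|F|; rewrite q_odd -mul2n => E.
by move/eqP: E0; rewrite -E natrD natrM E2 mul0r addr0 oner_eq0.
Qed.

Lemma squareP (x : F) : reflect (exists s, x = s ^+ 2) (square x).
Proof.
by apply: (iffP existsP) => -[s]; [move/eqP|] => Es; exists s; [|apply/eqP].
Qed.

Lemma square0 : square (0 : F).
Proof. by apply/squareP; exists 0; rewrite expr0n. Qed.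

Lemma sqr_square (x : F) : square (x ^+ 2).
Proof. by apply/squareP; exists x. Qed.

Lemma nonsquare_neq0 (x : F) : ~~ square x -> x != 0.
Proof. by apply: contraNneq => ->; apply: square0. Qed.

Lemma square_mulr (s x : F) : s != 0 -> square (s ^+ 2 * x) = square x.
Proof.
move=> s0; apply/squareP/squareP => -[r Er]; last first.
  by exists (s * r); rewrite Er exprMn.
exists (r / s); apply: (mulfI (expf_neq0 2 s0)).
by rewrite Er exprMn exprVn mulrC mulfVK // expf_neq0.
Qed.

Lemma card_neq0 : #|[set x : F | x != 0]| = #|F|.-1.
Proof. by rewrite cardsE (cardC1 0). Qed.

Lemma card_sqrt (s : F) : s != 0 -> square s ->
  #|[set x : F | x ^+ 2 == s]| = 2%N.
Proof.
move=> s0 /squareP[r Er]; have r0 : r != 0.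
  by apply: contraNneq s0 => r0; rewrite Er r0 expr0n.
have -> : [set x | x ^+ 2 == s] = [set r; - r].
  by apply/setP => x; rewrite !inE Er eqf_sqr.
rewrite cards2 (_ : (r != - r) = true) //.
by rewrite -subr_eq0 opprK -mulr2n -mulr_natl mulf_neq0 // two_neq0.
Qed.

Definition nzsquares := [set x : F | (x != 0) && square x].

(** Squaring is two-to-one on the nonzero elements. *)
Lemma card_nzsquares : (#|nzsquares| * 2)%N = #|F|.-1.
Proof.
rewrite -card_neq0 -sum1_card -[RHS]sum1_card.
rewrite [RHS](partition_big (fun x : F => x ^+ 2) (mem nzsquares)); last first.
  by move=> x; rewrite inE => x0; rewrite /= inE expf_neq0 ?sqr_square.
rewrite big_distrl; apply: eq_bigr => s; rewrite inE => /andP[s0 sq] /=.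
rewrite [LHS](_ : _ = 2%N) // sum1dep_card; rewrite -[LHS](card_sqrt s0 sq); apply: eq_card => x.
rewrite !inE andb_idl // => /eqP Ex.
by apply: contraNneq s0 => x0; rewrite -Ex x0 expr0n.
Qed.

Lemma card_nonsquares : #|[set x : F | ~~ square x]| = #|nzsquares|.
Proof.
have: (#|nzsquares| + #|[set x : F | ~~ square x]| = #|F|.-1)%N.
  rewrite -card_neq0 -cardsUI.
  have -> : nzsquares :&: [set x | ~~ square x] = set0.
    by apply/setP => x; rewrite !inE; case: (square x); rewrite ?andbF.
  rewrite cards0 addn0; apply: eq_card => x; rewrite !inE.
  by case: (eqVneq x 0) => [->|_] /=; rewrite ?square0 ?orbN.
by rewrite -card_nzsquares muln2 -addnn => /addnI.
Qed.

(** Multiplication by a maps the nonzero squares injectively into the nonsquares, and both sets have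
    (q - 1)/2 elements, so b is reached. *)
Lemma nonsquare_mulP (a b : F) : ~~ square a -> ~~ square b ->
  exists s, s != 0 /\ b = a * s ^+ 2.
Proof.
move=> na nb; have a0 := nonsquare_neq0 na.
have E : *%R a @: nzsquares = [set x | ~~ square x].
  apply/eqP; rewrite eqEcard card_nonsquares card_imset ?leqnn ?andbT;
    last exact: mulfI.
  apply/subsetP => _ /imsetP[x /[!inE] /andP[x0 /squareP[s Es]] ->].
  rewrite Es mulrC square_mulr //.
  by apply: contraNneq x0 => s0; rewrite Es s0 expr0n.
have: b \in [set x | ~~ square x] by rewrite inE.
rewrite -E => /imsetP[x /[!inE] /andP[x0 /squareP[s Es]] ->].
exists s; rewrite Es; split=> //.
by apply: contraNneq x0 => s0; rewrite Es s0 expr0n.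
Qed.

Lemma exists_nonsquare : exists d : F, ~~ square d.
Proof.
have: (0 < #|[set x : F | ~~ square x]|)%N.
  have: (0 < #|F|.-1)%N by have := finNzRing_gt1 F; case: #|F| => [|[|n]].
  by rewrite -card_nzsquares card_nonsquares muln_gt0 andbT.
by rewrite card_gt0 => /set0Pn[d /[!inE]]; exists d.
Qed.

Lemma square_mul_nonsquare (a b : F) :
  ~~ square a -> ~~ square b -> square (a * b).
Proof.
move=> na nb; have [s [_ ->]] := nonsquare_mulP na nb.
by rewrite mulrA -expr2 -exprMn sqr_square.
Qed.

(** Pigeonhole: a x^2 and c - b y^2 each take (q + 1)/2 values, so they share one. *)
Lemma binary_form_universal (a b c : F) : a != 0 -> b != 0 ->
  exists x y, a * x ^+ 2 + b * y ^+ 2 = c.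
Proof.
move=> a0 b0; set S := [set x ^+ 2 | x : F].
have cS : (#|S| * 2)%N = #|F|.+1.
  have -> : S = 0 |: nzsquares.
    apply/setP => x; rewrite !inE; apply/imsetP/orP => [[y _ ->]|].
      by rewrite sqr_square andbT; case: (y ^+ 2 == 0); [left | right].
    case=> [/eqP->|/andP[_ /squareP[s ->]]]; last by exists s.
    by exists 0; rewrite ?expr0n.
  rewrite cardsU1 !inE eqxx add1n mulSn card_nzsquares.
  by have := finNzRing_gt1 F; case: #|F|.
have inj1 : injective ( *%R a) by apply: mulfI.
pose g x := c - b * x.
have inj2 : injective g by move=> x y /addrI /oppr_inj /(mulfI b0).
have: (0 < #|( *%R a @: S) :&: (g @: S)|)%N.
  rewrite lt0n; apply/negP => /eqP I0.
  have := cardsUI ( *%R a @: S) (g @: S).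
  rewrite I0 addn0 (card_imset _ inj1) (card_imset _ inj2) addnn -muln2 cS => E.
  by have := max_card [in *%R a @: S :|: g @: S]; rewrite E ltnn.
rewrite card_gt0 => /set0Pn[z /setIP[/imsetP[_ /imsetP[x _ ->] ->]]].
move=> /imsetP[_ /imsetP[y _ ->] E]; exists x, y; rewrite E /g; ring.
Qed.

Lemma norm_eq0 (d x y : F) : ~~ square d ->
  (x ^+ 2 - d * y ^+ 2 == 0) = (x == 0) && (y == 0).
Proof.
move=> nd; apply/eqP/andP => [E|[/eqP-> /eqP->]]; last by ring.
have [y0|y0] := eqVneq y 0.
  by move/eqP: E; rewrite y0 expr0n mulr0 subr0 expf_eq0.
case/negP: nd; apply/squareP; exists (x / y).
apply: (mulIf (expf_neq0 2 y0)); rewrite exprMn exprVn mulfVK ?expf_neq0 //.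
by apply/eqP; rewrite eq_sym -subr_eq0 E.
Qed.

(** Fibres of the norm of F(sqrt d): the zero fibre is a point and the q - 1 others have equal size,
    which is therefore (q^2 - 1)/(q - 1). *)
Lemma card_norm (d c : F) : ~~ square d -> c != 0 ->
  #|[set t : F * F | t.1 ^+ 2 - d * t.2 ^+ 2 == c]| = #|F|.+1.
Proof.
move=> nd; have d0 := nonsquare_neq0 nd.
pose N (t : F * F) := t.1 ^+ 2 - d * t.2 ^+ 2.
pose S c := [set t | N t == c]; rewrite -/(S c).
have cS c1 : c1 != 0 -> #|S c1| = #|S 1|.
  move=> c10; have Nd0 : - d != 0 by rewrite oppr_eq0.
  have [x [y Exy]] := binary_form_universal c1 (oner_neq0 F) Nd0.
  have {}Exy : x ^+ 2 - d * y ^+ 2 = c1 by rewrite -Exy; ring.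
  (* Multiplication by x + y sqrt d, an element of norm c1, and by its inverse. *)
  pose f (t : F * F) := (x * t.1 + d * y * t.2, x * t.2 + y * t.1).
  pose g (t : F * F) := ((x * t.1 - d * y * t.2) / c1, (x * t.2 - y * t.1) / c1).
  have fK : cancel f g.
    by case=> u w; rewrite /f /g /=; congr pair; rewrite -Exy; field; rewrite Exy.
  have gK : cancel g f.
    by case=> u w; rewrite /f /g /=; congr pair; rewrite -Exy; field; rewrite Exy.
  rewrite -[RHS](card_imset _ (can_inj fK)); apply: eq_card => t.
  rewrite inE; apply/eqP/imsetP => [Et|[u /[!inE] /eqP Eu ->]].
    exists (g t); rewrite ?gK // inE; apply/eqP.
    have : N (f (g t)) = c1 * N (g t).
      by rewrite /N /f /= -Exy; ring.
    by rewrite gK Et -[LHS]mulr1 => /(mulfI c10) <-.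
  have -> : N (f u) = c1 * N u by rewrite /N /f /= -Exy; ring.
  by rewrite Eu mulr1.
move=> c0; rewrite (cS c c0).
have S0 : #|S 0| = 1%N.
  rewrite -(cards1 ((0, 0) : F * F)); apply: eq_card => -[u w].
  by rewrite !inE /N norm_eq0.
have: (\sum_(c : F) #|S c| = #|F| * #|F|)%N.
  rewrite -card_prod -sum1_card (partition_big N xpredT) //.
  by apply: eq_bigr => k _; rewrite sum1dep_card.
rewrite (bigD1 0) //= S0 (eq_bigr (fun=> #|S 1|)) => [|k k0]; last exact: cS.
rewrite sum_nat_const (_ : #|(fun i : F => i != 0)| = #|F|.-1); last first.
  by rewrite (cardC1 0).
have := finNzRing_gt1 F; case: #|F| => [|[|n]] // _ /=.
rewrite (_ : (n.+2 * n.+2 = 1 + n.+1 * n.+3)%N); last by ring.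
by move/addnI/eqP; rewrite eqn_pmul2l // => /eqP.
Qed.

End Squares.

(** * Counting vectors *)

(** Each fibre injects into every other one, so all have the same size. *)
Lemma card_fiber (T U : finType) (f : T -> U) :
  (forall u u', exists g : T -> T,
     injective g /\ forall x, f x = u -> f (g x) = u') ->
  forall u, (#|[set x | f x == u]| * #|U|)%N = #|T|.
Proof.
move=> trans u.
have le u1 u2 : (#|[set x | f x == u1]| <= #|[set x | f x == u2]|)%N.
  have [g [g_inj fg]] := trans u1 u2.
  rewrite -(card_imset _ g_inj); apply/subset_leq_card/subsetP.
  by move=> _ /imsetP[x /[!inE] /eqP fx ->]; rewrite (fg _ fx).
rewrite -[#|T|]sum1_card (partition_big f xpredT) //=.
rewrite (eq_bigr (fun=> #|[set x | f x == u]|)) => [|v _].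
  by rewrite sum_nat_const mulnC.
by rewrite sum1dep_card; apply/eqP; rewrite eqn_leq !le.
Qed.

Section Vectors.
Variable F : finFieldType.
Local Notation V := (F * F * F)%type.
Local Notation q := (#|F|%:R : rat).
Implicit Types (a b c n m : V).

Definition dot a b : F := a.1.1 * b.1.1 + a.1.2 * b.1.2 + a.2 * b.2.

Definition cross a b : V :=
  (a.1.2 * b.2 - a.2 * b.1.2, a.2 * b.1.1 - a.1.1 * b.2,
   a.1.1 * b.1.2 - a.1.2 * b.1.1).

Definition vadd a b : V := (a.1.1 + b.1.1, a.1.2 + b.1.2, a.2 + b.2).
Definition vscale (k : F) a : V := (k * a.1.1, k * a.1.2, k * a.2).
Local Notation v0 := ((0, 0, 0) : V).

Definition mxv a b c : 'M[F]_3 :=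
  mx3 a.1.1 a.1.2 a.2 b.1.1 b.1.2 b.2 c.1.1 c.1.2 c.2.

Lemma det_mxv a b c : \det (mxv a b c) = dot (cross a b) c.
Proof. by rewrite det_mx3 /dot /cross /=; ring. Qed.

Lemma vneq0 n : n != v0 -> exists u, dot n u = 1.
Proof.
case: n => [[x y] z] n0.
have [x0|x0] := eqVneq x 0; last by exists (x^-1, 0, 0); rewrite /dot /=; field.
have [y0|y0] := eqVneq y 0; last by exists (0, y^-1, 0); rewrite /dot /=; field.
exists (0, 0, z^-1); rewrite /dot /=; field.
by apply: contraNneq n0 => z0; rewrite x0 y0 z0.
Qed.

(** Translation along w with n.w = 1 moves any level set of [dot n] into any other. *)
Lemma card_dot n (t : F) : n != v0 ->
  #|[set u : V | dot n u == t]|%:R = q ^+ 2.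
Proof.
move=> n0; have [w nw] := vneq0 n0.
have E : (#|[set u | dot n u == t]| * #|F|)%N = (#|F| * #|F| * #|F|)%N.
  rewrite -!card_prod; apply: card_fiber => u u'.
  exists (vadd (vscale (u' - u) w)); split.
    by move=> [[? ?] ?] [[? ?] ?] [] /addrI-> /addrI-> /addrI->.
  move=> x <-; have -> : dot n (vadd (vscale (u' - dot n x) w) x) =
    dot n x + (u' - dot n x) * dot n w by rewrite /dot /vadd /vscale /=; ring.
  by rewrite nw; ring.
have q0 : q != 0 by rewrite Num.Theory.pnatr_eq0 -lt0n; apply/card_gt0P; exists 0.
apply: (mulIf q0); rewrite -natrM E !natrM; ring.
Qed.

(** If w has (n x m).w = 1, then m x w and w x n are dual to n and m, and translations along them
    move any pair of values to any other. *)
Lemma card_dot2 n m (s t : F) : cross n m != v0 ->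
  #|[set u : V | (dot n u == s) && (dot m u == t)]|%:R = q.
Proof.
move=> nm; have [w kw] := vneq0 nm.
have E : (#|[set u | (dot n u, dot m u) == (s, t)]| * #|{: F * F}|)%N =
         (#|F| * #|F| * #|F|)%N.
  rewrite -!card_prod; apply: (card_fiber (f := fun u => (dot n u, dot m u))).
  move=> u u'.
  exists (vadd (vadd (vscale (u'.1 - u.1) (cross m w))
                     (vscale (u'.2 - u.2) (cross w n)))); split.
    by move=> [[? ?] ?] [[? ?] ?] [] /addrI-> /addrI-> /addrI->.
  case: u u' => [u1 u2] [u1' u2'] x [<- <-] /=; congr pair.
    transitivity (dot n x + (u1' - dot n x) * dot (cross n m) w).
      by rewrite /dot /vadd /vscale /cross /=; ring.
    by rewrite kw; ring.
  transitivity (dot m x + (u2' - dot m x) * dot (cross n m) w).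
    by rewrite /dot /vadd /vscale /cross /=; ring.
  by rewrite kw; ring.
have q0 : q != 0 by rewrite Num.Theory.pnatr_eq0 -lt0n; apply/card_gt0P; exists 0.
apply: (mulIf (mulf_neq0 q0 q0)); rewrite mulrA -natrM.
have := congr1 (fun k : nat => k%:R : rat) E; rewrite card_prod !natrM !mulrA => <-.
by do 2!congr (_ * _); congr (_%:R); apply: eq_card => u; rewrite !inE.
Qed.

Lemma cross_vscale k a : cross a (vscale k a) = v0.
Proof. by rewrite /cross /vscale /=; congr (_, _, _); ring. Qed.

Lemma parallelP a b : a != v0 -> (cross a b == v0) -> exists k, b = vscale k a.
Proof.
move=> a0 /eqP ab; have [w aw] := vneq0 a0; exists (dot b w).
case: a a0 aw ab => [[a1 a2] a3] _; case: b => [[b1 b2] b3]; case: w => [[x y] z].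
rewrite /cross /dot /vscale /= => E [/eqP + /eqP + /eqP].
rewrite !subr_eq0 => /eqP e1 /eqP e2 /eqP e3; congr (_, _, _).
- have -> : (b1 * x + b2 * y + b3 * z) * a1 =
    b1 * a1 * x + (a1 * b2) * y + (a1 * b3) * z by ring.
  by rewrite e3 -e2 -[LHS]mulr1 -E; ring.
- have -> : (b1 * x + b2 * y + b3 * z) * a2 =
    (a2 * b1) * x + a2 * b2 * y + (a2 * b3) * z by ring.
  by rewrite -e3 e1 -[LHS]mulr1 -E; ring.
have -> : (b1 * x + b2 * y + b3 * z) * a3 =
    (a3 * b1) * x + (a3 * b2) * y + a3 * b3 * z by ring.
by rewrite e2 -e1 -[LHS]mulr1 -E; ring.
Qed.

Lemma vscale_inj a : a != v0 -> injective (fun k => vscale k a).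
Proof.
move=> /vneq0[w aw] k l /(congr1 (fun u => dot u w)).
have E i : dot (vscale i a) w = i * dot a w by rewrite /dot /vscale /=; ring.
by rewrite !E aw !mulr1.
Qed.

Lemma parallelE a : a != v0 -> [set b | cross a b == v0] = [set vscale k a | k : F].
Proof.
move=> a0; apply/setP => b; rewrite inE; apply/idP/imsetP => [/(parallelP a0)|].
  by case=> k ->; exists k.
by case=> k _ ->; rewrite cross_vscale.
Qed.

Lemma card_parallel a : a != v0 -> #|[set b | cross a b == v0]| = #|F|.
Proof.
by move=> a0; rewrite parallelE // card_imset //; apply: vscale_inj.
Qed.

Lemma card_parallel_dot n a : a != v0 ->
  #|[set b | (cross a b == v0) && (dot n b == 0)]| =
    if dot n a == 0 then #|F| else 1%N.
Proof.
move=> a0; have E k : dot n (vscale k a) = k * dot n a.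
  by rewrite /dot /vscale /=; ring.
case: eqVneq => [na|na].
  rewrite -(card_parallel a0); apply: eq_card => b; rewrite !inE andb_idr //.
  by move/(parallelP a0) => [k ->]; rewrite E na mulr0.
rewrite -(cards1 v0); apply: eq_card => b; rewrite !inE.
apply/andP/eqP => [[/(parallelP a0)[k ->]]|->].
  by rewrite E mulf_eq0 (negPf na) orbF => /eqP->; rewrite /vscale !mul0r.
by rewrite /cross /dot /= !mulr0 !subr0 !addr0.
Qed.

Lemma cross0v b : cross v0 b = v0.
Proof. by rewrite /cross /=; congr (_, _, _); ring. Qed.

Lemma natr_cardsC (T : finType) (P : pred T) :
  #|[set x | ~~ P x]|%:R = #|T|%:R - #|[set x | P x]|%:R :> rat.
Proof.
rewrite -(cardsC [set x | P x]) natrD addrAC subrr add0r; congr (_%:R).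
by apply: eq_card => x; rewrite !inE.
Qed.

Lemma natr_cardsD (T : finType) (P Q : pred T) :
  #|[set x | ~~ Q x && P x]|%:R =
  #|[set x | P x]|%:R - #|[set x | Q x && P x]|%:R :> rat.
Proof.
rewrite -(cardsID [set x | Q x] [set x | P x]) natrD.
have -> : #|[set x | P x] :&: [set x | Q x]| = #|[set x | Q x && P x]|.
  by apply: eq_card => x; rewrite !inE andbC.
rewrite addrAC subrr add0r; congr (_%:R).
by apply: eq_card => x; rewrite !inE andbC.
Qed.

Lemma card_V : #|{: V}|%:R = q ^+ 3.
Proof. by rewrite !card_prod !natrM; ring. Qed.

(** The indicator factor makes the formula hold for a = 0 too, so that it can be summed over all a;
    the same device is used in the counts below. *)
Lemma card_indep2 a :
  #|[set b | cross a b != v0]|%:R = (a != v0)%:R * (q ^+ 3 - q) :> rat.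
Proof.
have [->|a0] := eqVneq a v0.
  rewrite mul0r (_ : [set b | _] = set0) ?cards0 //.
  by apply/setP => b; rewrite !inE cross0v eqxx.
by rewrite natr_cardsC card_V card_parallel // mul1r.
Qed.

Lemma card_indep3 a b : #|[set c | dot (cross a b) c != 0]|%:R =
  (cross a b != v0)%:R * (q ^+ 3 - q ^+ 2) :> rat.
Proof.
have [->|ab] := eqVneq (cross a b) v0.
  rewrite mul0r (_ : [set c | _] = set0) ?cards0 //.
  by apply/setP => c; rewrite !inE /dot /= !mul0r !addr0 eqxx.
by rewrite natr_cardsC card_V card_dot // mul1r.
Qed.

(** Matrices are enumerated by their rows; invertibility is the nonvanishing of the triple
    product. *)
Lemma card_unitmx3 (P : pred 'M[F]_3) :
  #|[set A in unitmx | P A]| = (\sum_(a : V) \sum_(b : V)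
    #|[set c : V | (dot (cross a b) c != 0%R) && P (mxv a b c)]|)%N.
Proof.
pose f (t : V * V * V) := mxv t.1.1 t.1.2 t.2.
pose g (A : 'M[F]_3) : V * V * V :=
  ((A 0 0, A 0 1, A 0 2), (A 1 0, A 1 1, A 1 2), (A 2 0, A 2 1, A 2 2)).
have gK : cancel g f by move=> A; rewrite [RHS]mx3_eta.
have fK : cancel f g.
  by case=> [[[[? ?] ?] [[? ?] ?]] [[? ?] ?]]; rewrite /g /f !mxE.
have -> : [set A in unitmx | P A] = f @: [set t | f t \in unitmx & P (f t)].
  apply/setP => A; rewrite !inE; apply/idP/imsetP => [PA|[t + ->]].
    by exists (g A); rewrite ?inE gK.
  by rewrite inE.
rewrite (card_imset _ (can_inj fK)) -sum1_card pair_big /=.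
rewrite (partition_big (fun t : V * V * V => t.1) xpredT) //=.
apply: eq_bigr => -[a b] _; rewrite sum1dep_card /=.
rewrite -(card_imset _ (can_inj fK)).
have i_inj : injective (fun c : V => mxv a b c).
  by move=> x y /(can_inj fK (x1 := (a, b, x)) (x2 := (a, b, y)))[].
rewrite -[RHS](card_imset _ i_inj); apply: eq_card => A.
apply/imsetP/imsetP => [[[[a' b'] c] /[!inE] /= /andP[/andP[u p] /eqP[Ea Eb]] ->]|].
  exists c; rewrite ?inE -?det_mxv.
    by move: u p; rewrite /f /= Ea Eb unitmxE unitfE => -> ->.
  by rewrite /f /= Ea Eb.
case=> c /[!inE] /andP[u p] ->; exists (a, b, c) => //.
by rewrite !inE /f /= unitmxE unitfE det_mxv u p eqxx.
Qed.

End Vectors.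

(** * Incidence numbers of the four types *)

Section Incidence.
Variables (F : finFieldType) (d : F).
Hypotheses (q_odd : odd #|F|) (nd : ~~ square d).
Local Notation V := (F * F * F)%type.
Local Notation q := (#|F|%:R : rat).
Local Notation v0 := ((0, 0, 0) : V).
Implicit Types (a b c n m : V) (h k : hyperplane_orbit).

(* Gram matrices, up to congruence and scaling, of a double line, a pair of real
   lines, a pair of imaginary lines (as d is a non-square) and a smooth conic. *)
Definition normal_form h : 'M[F]_3 :=
  match h with
  | H1 => mx3 1 0 0 0 0 0 0 0 0
  | H2r => mx3 0 1 0 1 0 0 0 0 0
  | H2i => mx3 1 0 0 0 (- d) 0 0 0 0
  | H3 => mx3 0 0 1 0 1 0 1 0 0
  end.

(** The Gram matrix [normal_form k] applied to a, that is, half the gradient of the quadratic form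
    at a. *)
Definition grad k a : V :=
  match k with
  | H1 => (a.1.1, 0, 0)
  | H2r => (a.1.2, a.1.1, 0)
  | H2i => (a.1.1, - d * a.1.2, 0)
  | H3 => (a.2, a.1.2, a.1.1)
  end.

Definition polar k a b := dot (grad k a) b.

Definition incident h k : {set 'M[F]_3} :=
  [set A in unitmx | \tr (normal_form h *m (A *m normal_form k *m A^T)) == 0].

(** The entries of A N A^T are the values of the polar form of N on pairs of rows of A, and
    [normal_form h] selects some of them. Hence the condition concerns one row for H1, two for the
    line pairs and all three for H3. *)
Lemma trace_normal_form h k a b c :
  \tr (normal_form h *m (mxv a b c *m normal_form k *m (mxv a b c)^T)) =
  match h with
  | H1 => polar k a a
  | H2r => 2 * polar k a b
  | H2i => polar k a a - d * polar k b b
  | H3 => 2 * polar k a c + polar k b b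
  end.
Proof.
rewrite /mxv; case: h; case: k;
  by rewrite /= trmx3 !mulmx3 mxtrace3 /polar /dot /=; ring.
Qed.

Lemma mxtrace_cycle (P M A : 'M[F]_3) :
  \tr (P *m (A *m M *m A^T)) = \tr (M *m (A^T *m P *m A)).
Proof. by rewrite mxtrace_mulC -!mulmxA mxtrace_mulC !mulmxA. Qed.

(** Transposing A exchanges the two forms, by cyclicity of the trace. *)
Lemma card_incident_sym h k : #|incident h k| = #|incident k h|.
Proof.
rewrite -(card_imset _ (@trmx_inj F 3 3)); apply: eq_card => A.
rewrite !inE; apply/imsetP/andP => [[B /[!inE] /andP[uB tB] ->]|[uA tA]].
  by rewrite unitmx_tr uB trmxK -mxtrace_cycle.
by exists A^T; rewrite ?trmxK // inE unitmx_tr uA trmxK -mxtrace_cycle.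
Qed.

Lemma card_neq_v0 (P : pred V) : P v0 ->
  #|[set a | (a != v0) && P a]|%:R = #|[set a | P a]|%:R - 1 :> rat.
Proof.
move=> P0; rewrite (cardsD1 v0 [set a | P a]) inE P0 natrD addrAC subrr add0r.
by congr (_%:R); apply: eq_card => a; rewrite !inE.
Qed.

Definition isotropic k := [set a | (a != v0) && (polar k a a == 0)].

Lemma card_isotropic k : #|isotropic k|%:R =
  match k with
  | H1 => q ^+ 2 - 1
  | H2r => 2 * q ^+ 2 - q - 1
  | H2i => q - 1
  | H3 => q ^+ 2 - 1
  end.
Proof.
have two0 := two_neq0 q_odd.
have e1 : ((1, 0, 0) : V) != v0 by apply/eqP => -[/eqP]; rewrite oner_eq0.
have e2 : ((0, 1, 0) : V) != v0 by apply/eqP => -[/eqP]; rewrite oner_eq0.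
have e12 : cross ((1, 0, 0) : V) (0, 1, 0) != v0.
  by apply/eqP => -[_ _ /=] /eqP; rewrite mulr1 mulr0 subr0 oner_eq0.
rewrite card_neq_v0; last by case: k; rewrite /polar /dot /= ?mulr0 ?addr0.
case: k; rewrite /polar /dot /=.
- rewrite -(card_dot 0 e1); congr (_%:R - 1); apply: eq_card => a.
  by rewrite !inE /dot /= !mul0r !addr0 mul1r mulf_eq0 orbb.
- have -> : [set a : V | a.1.2 * a.1.1 + a.1.1 * a.1.2 + 0 * a.2 == 0] =
      [set a | dot (1, 0, 0) a == 0] :|: [set a | dot (0, 1, 0) a == 0].
    apply/setP => a; rewrite !inE /dot /= !mul0r !mul1r !addr0 add0r.
    by rewrite [a.1.2 * _]mulrC -mulr2n -mulr_natl !mulf_eq0 (negPf two0).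
  have /(congr1 (fun i : nat => i%:R : rat)) :=
    cardsUI [set a : V | dot (1, 0, 0) a == 0] [set a | dot (0, 1, 0) a == 0].
  rewrite !natrD !card_dot //.
  have -> : [set a : V | dot (1, 0, 0) a == 0] :&: [set a | dot (0, 1, 0) a == 0]
    = [set a | (dot (1, 0, 0) a == 0) && (dot (0, 1, 0) a == 0)].
    by apply/setP => a; rewrite !inE.
  by rewrite card_dot2 // => /(canRL (addrK _))->; ring.
- rewrite -[in RHS](card_dot2 0 0 e12); congr (_%:R - 1); apply: eq_card => a.
  rewrite !inE /dot /= !mul0r !mul1r !addr0 add0r -(norm_eq0 a.1.1 a.1.2 nd).
  by congr (_ == 0); ring.
(* On 2 x z + y^2 = 0, a vector with x != 0 is determined by (x, y) and is parametrised by f; x = 0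
   forces y = 0 and leaves z free, which is Y. *)
pose f (t : F * F) : V := (t.1, t.2, - (t.2 ^+ 2 / (2 * t.1))).
pose X := setX [set x : F | x != 0] [set: F].
pose Y := [set a : V | (dot (1, 0, 0) a == 0) && (dot (0, 1, 0) a == 0)].
have -> : [set a : V | a.2 * a.1.1 + a.1.2 * a.1.2 + a.1.1 * a.2 == 0] =
    f @: X :|: Y.
  apply/setP => -[[x y] z]; rewrite !inE /dot /= !mul0r !mul1r !addr0 add0r.
  apply/idP/orP => [/eqP E|[/imsetP[[u v] /[!inE] /= /andP[u0 _] [-> -> ->]]|]].
  - have [x0|x0] := eqVneq x 0.
      right; move: E; rewrite x0 mulr0 mul0r add0r addr0 => /eqP.
      by rewrite mulf_eq0 orbb.
    left; apply/imsetP; exists (x, y); rewrite ?inE ?x0 //=.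
    rewrite /f /=; congr (_, _, _); apply: (mulfI (mulf_neq0 two0 x0)).
    transitivity (- y ^+ 2); last by field; rewrite two0 x0.
    by apply/eqP; rewrite -subr_eq0 opprK -E; apply/eqP; ring.
  - by apply/eqP; field; rewrite u0.
  by case/andP=> /eqP-> /eqP->; rewrite !mul0r mulr0 !addr0.
rewrite cardsU (_ : f @: X :&: Y = set0) ?cards0 ?subn0; last first.
  apply/setP => a; rewrite !inE; apply/negP => /andP[/imsetP[[x y]]].
  rewrite !inE /= => /andP[x0 _] -> /andP[+ _].
  by rewrite /dot /= !mul0r !addr0 mul1r (negPf x0).
rewrite natrD card_dot2 // card_imset; last by move=> [? ?] [? ?] [-> ->].
rewrite cardsX cardsT card_neq0 natrM.
have := finNzRing_gt1 F; case: #|F| => [//|p _] /=; rewrite -[p.+1]addn1 natrD.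
ring.
Qed.

Lemma natr_cardE (T : finType) (P : pred T) :
  \sum_(a : T) (P a)%:R = #|[set a | P a]|%:R :> rat.
Proof. by rewrite -natr_sum -sum1dep_card [in RHS]big_mkcond. Qed.

Lemma sum_indicator (T : finType) (P : pred T) (x : rat) :
  \sum_(a : T) (P a)%:R * x = #|[set a | P a]|%:R * x.
Proof. by rewrite -big_distrl /= natr_cardE. Qed.

Lemma natr_card (T : finType) (A : {set T}) :
  #|A|%:R = \sum_a (a \in A)%:R :> rat.
Proof.
by rewrite -sum1_card natr_sum big_mkcond; apply: eq_bigr => a _; case: ifP.
Qed.

(** From the plane (or whole space, if n = 0) of vectors orthogonal to n, the multiples of a lying
    in it are removed: q of them if a is orthogonal to n, otherwise only 0. *)
Lemma card_indep_dot n a :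
  #|[set b | (cross a b != v0) && (dot n b == 0)]|%:R =
  (a != v0)%:R * (if n == v0 then q ^+ 3 - q
                  else if dot n a == 0 then q ^+ 2 - q else q ^+ 2 - 1).
Proof.
have [->|a0] := eqVneq a v0.
  rewrite mul0r (_ : [set b | _] = set0) ?cards0 //.
  by apply/setP => b; rewrite !inE cross0v eqxx.
rewrite natr_cardsD card_parallel_dot // mul1r.
have [->|n0] := eqVneq n v0; last by rewrite card_dot //; case: eqP.
have D0 b : dot v0 b = 0 by rewrite /dot /=; ring.
rewrite D0 eqxx (_ : [set b | _] = setT) ?cardsT ?card_V //.
by apply/setP => b; rewrite !inE D0 eqxx.
Qed.

Local Notation c2 := (q ^+ 3 - q).
Local Notation c3 := (q ^+ 3 - q ^+ 2).

Lemma card_incident_sum h k : #|incident h k|%:R =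
  \sum_(a : V) \sum_(b : V) #|[set c : V | (dot (cross a b) c != 0) &&
    (\tr (normal_form h *m (mxv a b c *m normal_form k *m (mxv a b c)^T)) == 0)
    ]|%:R :> rat.
Proof.
rewrite card_unitmx3 natr_sum; apply: eq_bigr => a _.
by rewrite natr_sum.
Qed.

Lemma card_indep3_cond (P : bool) a b :
  #|[set c | (dot (cross a b) c != 0) && P]|%:R =
  (P && (cross a b != v0))%:R * c3.
Proof.
case: P; rewrite /= ?mul0r -?card_indep3.
  by congr (_%:R); apply: eq_card => c; rewrite !inE andbT.
by rewrite (_ : [set c | _] = set0) ?cards0 //; apply/setP => c; rewrite !inE andbF.
Qed.

(** The first row must be isotropic; the other two complete it to a basis freely. *)
Lemma card_incident1 k : #|incident H1 k|%:R = #|isotropic k|%:R * (c2 * c3).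
Proof.
rewrite card_incident_sum -sum_indicator; apply: eq_bigr => a _.
under eq_bigr => b _ do under eq_finset do rewrite trace_normal_form.
under eq_bigr => b _ do rewrite card_indep3_cond.
rewrite sum_indicator mulrA; congr (_ * _).
have [iso|iso] := eqVneq (polar k a a) 0; first by rewrite andbT card_indep2.
rewrite andbF mul0r (_ : [set b | _] = set0) ?cards0 //.
Qed.

Definition radical k := [set a | (a != v0) && (grad k a == v0)].

(** The second row b must be orthogonal to [grad k a]. This is no condition for a in the radical;
    otherwise it defines a plane, which contains a exactly when a is isotropic. The third row is
    free, whence the factor c3. *)
Lemma card_incident2r k : #|incident H2r k|%:R =
  (#|radical k|%:R * c2 +
   (#|isotropic k|%:R - #|radical k|%:R) * (q ^+ 2 - q) +
   (q ^+ 3 - 1 - #|isotropic k|%:R) * (q ^+ 2 - 1)) * c3.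
Proof.
have two0 := two_neq0 q_odd.
have nz : #|[set a : V | a != v0]|%:R = q ^+ 3 - 1 :> rat.
  by rewrite natr_cardsC card_V (_ : [set a | a == v0] = [set v0]) ?cards1 //;
     apply/setP => a; rewrite !inE.
rewrite card_incident_sum.
under eq_bigr => a _.
  under eq_bigr => b _ do under eq_finset do rewrite trace_normal_form.
  under eq_bigr => b _.
    rewrite card_indep3_cond mulf_eq0 (negPf two0) andbC.
    over.
  rewrite sum_indicator card_indep_dot.
  over.
rewrite -big_distrl /=; congr (_ * c3).
(* The case distinction on a, written as a linear combination of indicators so that each can be
   summed separately. *)
transitivity (\sum_(a : V) ((a \in radical k)%:R * c2 +
  ((a \in isotropic k)%:R - (a \in radical k)%:R) * (q ^+ 2 - q) +
   ((a != v0)%:R - (a \in isotropic k)%:R) * (q ^+ 2 - 1))).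
  apply: eq_bigr => a _; rewrite !inE -/(polar k a a).
  have [->|a0] := eqVneq a v0; first by rewrite /=; ring.
  have [ga|ga] := eqVneq (grad k a) v0; last by case: eqP => _ /=; ring.
  have -> : polar k a a == 0 by rewrite /polar ga /dot /= !mul0r !addr0.
  by rewrite /=; ring.
rewrite !big_split /= -!big_distrl /= !sumrB -nz !natr_card.
by congr (_ * _ + (_ - _) * _ + (_ - _) * _);
  apply: eq_bigr => a _; rewrite !inE.
Qed.

Lemma card_radical k :
  #|radical k|%:R = match k with
                    | H1 => q ^+ 2 - 1 | H3 => 0 | _ => q - 1 end :> rat.
Proof.
have e1 : ((1, 0, 0) : V) != v0 by apply/eqP => -[/eqP]; rewrite oner_eq0.
have e12 : cross ((1, 0, 0) : V) (0, 1, 0) != v0.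
  by apply/eqP => -[_ _ /=] /eqP; rewrite mulr1 mulr0 subr0 oner_eq0.
have d0 := nonsquare_neq0 nd.
have E12 : #|[set a : V | (a.1.1 == 0) && (a.1.2 == 0)]|%:R = q :> rat.
  rewrite -[RHS](card_dot2 0 0 e12); congr (_%:R); apply: eq_card => a.
  by rewrite !inE /dot /= !mul0r !mul1r !addr0 add0r.
case: k => //; rewrite /radical.
- rewrite card_neq_v0 //= -(card_dot 0 e1); congr (_%:R - 1); apply: eq_card => a.
  by rewrite !inE /dot /= !xpair_eqE eqxx !andbT mul1r !mul0r !addr0.
- rewrite card_neq_v0 //= -E12; congr (_%:R - 1); apply: eq_card => a.
  by rewrite !inE !xpair_eqE eqxx andbT andbC.
- rewrite card_neq_v0 /= ?mulr0 // -E12; congr (_%:R - 1); apply: eq_card => a.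
  by rewrite !inE !xpair_eqE eqxx andbT mulf_eq0 oppr_eq0 (negPf d0).
rewrite (_ : [set a | _] = set0) ?cards0 //; apply/setP => -[[x y] z].
rewrite !inE /= !xpair_eqE; apply/negP => /andP[+ /andP[/andP[/eqP z0 /eqP y0] /eqP x0]].
by rewrite x0 y0 z0 !eqxx.
Qed.

(** If n is not a multiple of m = a x b, the affine plane 2 n.c + s = 0 meets the span of a and b in
    a line, leaving q^2 - q vectors c. If n is a nonzero multiple of m, that plane is parallel to
    the span: it coincides with it for s = 0 and avoids it otherwise. *)
Lemma card_indep3_affine a b n (s : F) : cross a b != v0 ->
  #|[set c | (dot (cross a b) c != 0) && (2 * dot n c + s == 0)]|%:R =
  (if (dot n a == 0) && (dot n b == 0)
   then if n == v0 then (s == 0)%:R * c3 else (s != 0)%:R * q ^+ 2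
   else q ^+ 2 - q) :> rat.
Proof.
have two0 := two_neq0 q_odd.
set m := cross a b => m0.
have D2 c : (2 * dot n c + s == 0) = (dot n c == - s / 2).
  apply/eqP/eqP => [/eqP|->]; last by field.
  by rewrite addr_eq0 => /eqP <-; rewrite mulrAC divff // mul1r.
have D0 c : dot v0 c = 0 by rewrite /dot /=; ring.
under eq_finset do rewrite D2.
case: ifPn => [/andP[/eqP na /eqP nb]|nab]; last first.
  have nm : cross m n != v0.
    apply: contra nab => /eqP mn0.
    (* Triple product identity, using that m is orthogonal to a and b: if m x n = 0, then n is
       orthogonal to both. *)
    have Ea : vscale (dot n a) m = cross a (cross m n).
      by rewrite /m /vscale /cross /dot /=; congr (_, _, _); ring.
    have Eb : vscale (dot n b) m = cross b (cross m n).
      by rewrite /m /vscale /cross /dot /=; congr (_, _, _); ring.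
    have [w mw] := vneq0 m0.
    have W t : dot (vscale t m) w = t by rewrite -[RHS]mulr1 -mw /dot /=; ring.
    rewrite -(W (dot n a)) -(W (dot n b)) Ea Eb mn0.
    have C0 u : cross u v0 = v0 by rewrite /cross /=; congr (_, _, _); ring.
    by rewrite !C0 !D0 eqxx.
  have n0 : n != v0 by apply: contraNneq nab => ->; rewrite !D0 eqxx.
  rewrite (natr_cardsD (fun c => dot n c == - s / 2) (fun c => dot m c == 0)).
  by rewrite card_dot // card_dot2.
have [n0|n0] := eqVneq n v0.
  rewrite n0; have -> : (s == 0) = (0 == - s / 2).
    by rewrite [RHS]eq_sym mulf_eq0 oppr_eq0 invr_eq0 (negPf two0) orbF.
  under eq_finset do rewrite D0.
  by rewrite card_indep3_cond m0 andbT.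
have : cross m n == v0.
  apply/eqP; transitivity (vadd (vscale (dot n a) b) (vscale (- dot n b) a)).
    by rewrite /m /vadd /vscale /cross /dot /=; congr (_, _, _); ring.
  by rewrite na nb /vadd /vscale /=; congr (_, _, _); ring.
move=> /(parallelP m0)[k Ek]; have k0 : k != 0.
  by apply: contraNneq n0 => k0; rewrite Ek k0 /vscale !mul0r.
have Dn c : dot n c = k * dot m c by rewrite Ek /dot /vscale /=; ring.
have [s0|s0] := eqVneq s 0.
  rewrite mul0r (_ : [set c | _] = set0) ?cards0 //; apply/setP => c.
  rewrite !inE Dn s0 oppr0 mul0r mulf_eq0 (negPf k0) /=.
  by case: (dot m c == 0).
rewrite mul1r -(card_dot (- s / 2) n0); congr (_%:R); apply: eq_card => c.
rewrite !inE andb_idl // Dn => /eqP E; apply: contraNneq s0 => E0.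
move: E; rewrite E0 mulr0 => /esym/eqP.
by rewrite mulf_eq0 oppr_eq0 invr_eq0 (negPf two0) orbF.
Qed.

(** A smooth conic contains no line: the square of each coordinate of a x b is a combination of the
    three polar values. *)
Lemma polar3_witt_index a b : polar H3 a a = 0 -> polar H3 a b = 0 ->
  polar H3 b b = 0 -> cross a b = v0.
Proof.
have two0 := two_neq0 q_odd.
case: a b => [[a1 a2] a3] [[b1 b2] b3]; rewrite /polar /dot /cross /=.
move=> Ea Eab Eb; congr (_, _, _); apply/eqP; rewrite -sqrf_eq0; apply/eqP.
- transitivity ((a3 * a1 + a2 * a2 + a1 * a3) * b3 ^+ 2
    - 2 * a3 * b3 * (a3 * b1 + a2 * b2 + a1 * b3) +
    (b3 * b1 + b2 * b2 + b1 * b3) * a3 ^+ 2); first by ring.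
  by rewrite Ea Eab Eb; ring.
- transitivity ((a3 * b1 + a2 * b2 + a1 * b3) * (a3 * b1 + a1 * b3 - a2 * b2)
   + b2 ^+ 2 * (a3 * a1 + a2 * a2 + a1 * a3)
   - 2 * a1 * a3 * (b3 * b1 + b2 * b2 + b1 * b3)); first by ring.
  by rewrite Ea Eab Eb; ring.
transitivity ((a3 * a1 + a2 * a2 + a1 * a3) * b1 ^+ 2
    - 2 * a1 * b1 * (a3 * b1 + a2 * b2 + a1 * b3) +
    (b3 * b1 + b2 * b2 + b1 * b3) * a1 ^+ 2); first by ring.
by rewrite Ea Eab Eb; ring.
Qed.

Lemma card_nonzero_vectors : #|[set a : V | a != v0]|%:R = q ^+ 3 - 1 :> rat.
Proof.
by rewrite natr_cardsC card_V (_ : [set a | a == v0] = [set v0]) ?cards1 //;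
   apply/setP => a; rewrite !inE.
Qed.

(** For independent a, b there are q^2 - q third rows, and q more when a is isotropic and orthogonal
    to b. In that case b is not isotropic, by [polar3_witt_index], so the affine plane misses the
    span of a and b entirely. *)
Lemma card_incident33 : #|incident H3 H3|%:R =
  (q ^+ 2 - q) * (q ^+ 3 - 1) * c2 + q * (q ^+ 2 - 1) * (q ^+ 2 - q).
Proof.
rewrite card_incident_sum.
transitivity (\sum_(a : V) \sum_(b : V) (((cross a b != v0)%:R * (q ^+ 2 - q)) +
   ((cross a b != v0) && (dot (grad H3 a) b == 0))%:R *
     ((polar H3 a a == 0)%:R * q))).
  apply: eq_bigr => a _; apply: eq_bigr => b _.
  under eq_finset do rewrite trace_normal_form.
  have [ab|ab] := eqVneq (cross a b) v0.
    by rewrite -[LHS]/_ ab (_ : [set c | _] = set0) ?cards0 ?mul0r ?addr0 //;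
       apply/setP => c; rewrite !inE /dot /= !mul0r !addr0 eqxx.
  rewrite card_indep3_affine // -/(polar H3 a a).
  have g0 : grad H3 a != v0.
    apply: contra_neq ab => -[a3 a2 a1].
    by rewrite -(cross0v b); congr cross; case: a a1 a2 a3 => [[? ?] ?] /= -> -> ->.
  rewrite (negPf g0) -/(polar H3 a b) /=.
  have [paa|paa] := eqVneq (polar H3 a a) 0; last by rewrite /=; ring.
  have [pab|pab] := eqVneq (polar H3 a b) 0; last by rewrite /=; ring.
  have -> : polar H3 b b != 0.
    by apply: contra_neq ab => pbb; apply: polar3_witt_index.
  by rewrite /=; ring.
under eq_bigr => a _.
  rewrite big_split /= !sum_indicator card_indep2 card_indep_dot.
  over.
transitivity (\sum_(a : V) ((a != v0)%:R * (c2 * (q ^+ 2 - q)) +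
                            (a \in isotropic H3)%:R * ((q ^+ 2 - q) * q))).
  apply: eq_bigr => a _; rewrite inE.
  have [->|a0] := eqVneq a v0; first by rewrite /=; ring.
  have g0 : grad H3 a != v0.
    apply: contra_neq a0 => -[a3 a2 a1].
    by case: a a1 a2 a3 => [[? ?] ?] /= -> -> ->.
  by rewrite (negPf g0) -/(polar H3 a a); case: eqP => _ /=; ring.
rewrite big_split /= -!big_distrl /= -natr_card card_isotropic natr_cardE.
by rewrite card_nonzero_vectors; ring.
Qed.

(** The norm form is anisotropic, so all isotropic vectors of a pair of imaginary lines lie in its
    radical. *)
Lemma polar2i_eq0 a : (polar H2i a a == 0) = (grad H2i a == v0).
Proof.
rewrite /polar /dot /= !xpair_eqE eqxx andbT mulf_eq0 oppr_eq0.
rewrite (negPf (nonsquare_neq0 nd)) -(norm_eq0 a.1.1 a.1.2 nd).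
by congr (_ == 0); ring.
Qed.

(** If a is not in the radical, it is not isotropic and there are q^2 - q third rows. If a is in the
    radical, the condition puts b there too; the radical has dimension one, so a and b are
    dependent. *)
Lemma card_incident32i : #|incident H3 H2i|%:R = c2 * c2 * (q ^+ 2 - q).
Proof.
rewrite card_incident_sum.
have gE a : (grad H2i a == v0) = (a.1.1 == 0) && (a.1.2 == 0).
  by rewrite /= !xpair_eqE eqxx andbT mulf_eq0 oppr_eq0 (negPf (nonsquare_neq0 nd)).
transitivity (\sum_(a : V) \sum_(b : V) (cross a b != v0)%:R *
   ((q ^+ 2 - q) * (grad H2i a != v0)%:R)).
  apply: eq_bigr => a _; apply: eq_bigr => b _.
  under eq_finset do rewrite trace_normal_form.
  have [ab|ab] := eqVneq (cross a b) v0.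
    by rewrite -[LHS]/_ ab (_ : [set c | _] = set0) ?cards0 ?mul0r ?addr0 //;
       apply/setP => c; rewrite !inE /dot /= !mul0r !addr0 eqxx.
  rewrite card_indep3_affine // -/(polar H2i a a) polar2i_eq0.
  case: (eqVneq (grad H2i a) v0) => [ga|_] /=; last by ring.
  have -> : polar H2i b b == 0 = false; last first.
    by rewrite -/(polar H2i a b) /polar ga /dot /= !mul0r !addr0 eqxx /=; ring.
  apply: contra_neqF ab; rewrite polar2i_eq0 gE => /andP[/eqP b1 /eqP b2].
  move/eqP: ga; rewrite gE => /andP[/eqP a1 /eqP a2].
  by rewrite /cross a1 a2 b1 b2; congr (_, _, _); ring.
under eq_bigr => a _ do rewrite sum_indicator card_indep2.
transitivity (\sum_(a : V) ((a != v0)%:R - (a \in radical H2i)%:R) *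
   (c2 * (q ^+ 2 - q))).
  apply: eq_bigr => a _; rewrite !inE.
  have [->|a0] := eqVneq a v0; first by rewrite /=; ring.
  by case: eqP => _ /=; ring.
rewrite -big_distrl /= sumrB -natr_card card_radical.
by rewrite natr_cardE card_nonzero_vectors; ring.
Qed.

(** The condition is N(a) = d N(b). If N(a) = 0, both rows lie in the radical and are dependent.
    Otherwise b has q + 1 choices for its first two coordinates and q for the last; independence is
    automatic, as b = k a would make d the square of 1/k. *)
Lemma card_incident2i : #|incident H2i H2i|%:R =
  q ^+ 2 * (q ^+ 2 - 1) * (q + 1) * c3.
Proof.
rewrite card_incident_sum.
under eq_bigr => a _ do under eq_bigr => b _ do
  under eq_finset do rewrite trace_normal_form.
under eq_bigr => a _ do under eq_bigr => b _ do rewrite card_indep3_cond.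
under eq_bigr => a _ do rewrite sum_indicator.
rewrite -big_distrl; congr (_ * c3).
pose N (x y : F) := x ^+ 2 - d * y ^+ 2.
have pE a : polar H2i a a = N a.1.1 a.1.2.
  by rewrite /polar /dot /N /=; ring.
have NZ t x y : N (t * x) (t * y) = t ^+ 2 * N x y by rewrite /N; ring.
have d0 := nonsquare_neq0 nd.
transitivity (\sum_(a : V) ((a != v0)%:R - (a \in radical H2i)%:R) *
   ((q + 1) * q)); last first.
  rewrite -big_distrl /= sumrB -natr_card card_radical.
  by rewrite natr_cardE card_nonzero_vectors; ring.
apply: eq_bigr => a _; rewrite inE -polar2i_eq0.
have [Na|Na] := eqVneq (polar H2i a a) 0.
  rewrite andbT subrr mul0r (_ : [set b | _] = set0) ?cards0 //.
  apply/setP => b; rewrite !inE Na add0r oppr_eq0 mulf_eq0 (negPf d0) /=.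
  apply/negP => /andP[/eqP Nb]; apply/negP; rewrite negbK.
  move: Na Nb; rewrite !pE => /eqP + /eqP.
  rewrite !norm_eq0 // => /andP[/eqP a1 /eqP a2] /andP[/eqP b1 /eqP b2].
  by rewrite /cross a1 a2 b1 b2; apply/eqP; congr (_, _, _); ring.
have a0 : a != v0.
  by apply: contraNneq Na => ->; rewrite pE /N /=; apply/eqP; ring.
rewrite a0 andbF subr0 mul1r.
pose S := setX [set t : F * F | t.1 ^+ 2 - d * t.2 ^+ 2 == polar H2i a a / d]
               [set: F].
have -> : (q + 1) * q = #|S|%:R.
  by rewrite cardsX card_norm ?mulf_neq0 ?invr_eq0 // cardsT natrM -addn1 natrD.
congr (_%:R); apply: eq_card => b; rewrite !inE andbT -/(N _ _) [polar _ b b]pE.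
rewrite subr_eq0; apply/andP/eqP => [[/eqP-> _]|Eb].
  by rewrite mulrC mulKf.
rewrite Eb mulrC mulfVK // eqxx; split=> //.
apply/negP => /(parallelP a0)[k Ek]; case/negP: nd; apply/squareP.
move: Eb; rewrite Ek /= NZ -pE => E.
have k0 : k != 0.
  apply: contraNneq Na => k0; move: E; rewrite k0 expr0n mul0r.
  by move=> /esym/eqP; rewrite mulf_eq0 invr_eq0 (negPf d0) orbF.
exists k^-1; apply: (mulIf Na); rewrite exprVn.
apply: (mulfI (expf_neq0 2 k0)); rewrite mulVKf ?expf_neq0 // mulrCA E.
by rewrite mulrC mulfVK.
Qed.

End Incidence.

(** * Symmetric matrices up to congruence and scaling *)

(** Gauss elimination by congruences: move a nonzero entry to the top left corner, clear its row and
    column, and recurse on the Schur complement. *)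
Lemma sym_diagonalizable (F : fieldType) n (P : 'M[F]_n) :
  2 != 0 :> F -> P^T = P ->
  exists2 W, W \in unitmx & is_diag_mx (W *m P *m W^T).
Proof.
move=> two0; elim: n P => [|n IHn] P Psym.
  by exists 1%:M; rewrite ?unitmx1 //; apply/is_diag_mxP => -[].
suff [W uW W00] : exists2 W, W \in unitmx &
    (W *m P *m W^T) 0 0 != 0 \/ W *m P *m W^T = 0.
  case: W00 => [W00|W00]; last by exists W; rewrite // W00 mx0_is_diag.
  have [Q QE] : exists Q : 'M_(1 + n), Q = W *m P *m W^T by exists (W *m P *m W^T).
  have Qsym : Q^T = Q by rewrite QE !trmx_mul trmxK Psym mulmxA.
  rewrite -QE in W00; pose a := Q 0 0; pose b : 'M_(n, 1) := dlsubmx Q.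
  have ulE : ulsubmx Q = a%:M.
    apply/matrixP => i j; rewrite !ord1 !mxE eqxx mulr1n.
    by congr (fun_of_matrix Q _ _); apply: val_inj.
  have urE : ursubmx Q = b^T by rewrite /b -{1}Qsym trmx_dlsub.
  (* Clears the first row and column; the block left over is the Schur complement of a. *)
  pose W1 : 'M_(1 + n) := block_mx 1%:M 0 (- a^-1 *: b) 1%:M.
  have E1 : (- a^-1 *: b) *m a%:M + b = 0.
    by rewrite mul_mx_scalar scalerA mulrN divff // scaleN1r addNr.
  have E2 : a%:M *m (- a^-1 *: b)^T + b^T = 0.
    by rewrite -[a%:M]tr_scalar_mx -trmx_mul -linearD E1 linear0.
  have EQ : W1 *m Q *m W1^T =
      block_mx a%:M 0 0 (drsubmx Q - a^-1 *: (b *m b^T)).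
    rewrite -{1}[Q]submxK ulE urE -/b tr_block_mx !mulmx_block.
    rewrite !trmx1 !trmx0 !mul1mx !mul0mx !mulmx1 !mulmx0 !addr0 E1 E2.
    by rewrite mul0mx add0r -scalemxAl scaleNr addrC.
  pose C := drsubmx Q - a^-1 *: (b *m b^T).
  have Csym : C^T = C.
    by rewrite /C linearB linearZ /= trmx_mul trmxK trmx_drsub Qsym.
  have [W2 uW2 dW2] := IHn C Csym.
  exists (block_mx 1%:M 0 0 W2 *m W1 *m W : 'M_(1 + n)).
    have ub (X : 'M_(n, 1)) (A : 'M_n) : A \in unitmx ->
        (block_mx 1%:M 0 X A : 'M[F]_(1 + n)) \in unitmx.
      by rewrite !unitmxE det_lblock det1 mul1r.
    rewrite !unitmx_mul uW andbT; apply/andP; split; apply: ub => //.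
    exact: unitmx1.
  have -> : block_mx 1%:M 0 0 W2 *m W1 *m W *m P *m
            (block_mx 1%:M 0 0 W2 *m W1 *m W)^T =
            block_mx 1%:M 0 0 W2 *m (W1 *m Q *m W1^T) *m (block_mx 1%:M 0 0 W2)^T.
    by rewrite QE !trmx_mul !mulmxA.
  rewrite EQ -/C tr_block_mx !mulmx_block.
  rewrite !trmx1 !trmx0 !mul1mx !mul0mx !mulmx1 !mulmx0 !addr0 !add0r mul0mx.
  have dB : is_diag_mx (block_mx a%:M 0 0 (W2 *m C *m W2^T) : 'M_(1 + n)).
    by rewrite is_diag_block_mx // !eqxx dW2 scalar_mx_is_diag.
  exact: dB.
have diag_step (Q : 'M[F]_n.+1) i : Q i i != 0 ->
    exists2 W, W \in unitmx & (W *m Q *m W^T) 0 0 != 0.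
  move=> Qii; exists (perm_mx (tperm 0 i)); first exact: unitmx_perm.
  rewrite -row_permE tr_perm_mx -col_permE !mxE.
  by rewrite !tpermL.
have [/existsP[i Pii]|noi] := boolP [exists i, P i i != 0].
  by have [W uW WP] := diag_step _ _ Pii; exists W => //; left.
have P_diag i : P i i = 0.
  by apply/eqP; move: noi; rewrite negb_exists => /forallP /(_ i); rewrite negbK.
have [/existsP[i /existsP[j Pij]]|no] := boolP [exists i, exists j, P i j != 0].
  have ij : i != j by apply: contraNneq Pij => ->; rewrite P_diag.
  (* Adding row and column j to row and column i produces 2 P_ij on the diagonal, since P_ii = P_jj
     = 0. *)
  pose W0 : 'M[F]_n.+1 := 1%:M + delta_mx i j.
  have uW0 : W0 \in unitmx.
    have : W0 *m (1%:M - delta_mx i j) = 1%:M.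
      rewrite mulmxDl mul1mx mulmxBr mulmx1 mul_delta_mx_0 1?eq_sym //.
      by rewrite subr0 subrK.
    by case/mulmx1_unit.
  have : (W0 *m P *m W0^T) i i != 0.
    rewrite /W0 linearD /= trmx1 trmx_delta mulmxDl mul1mx mulmxDr mulmx1.
    have dl (A : 'M[F]_n.+1) l : (delta_mx i j *m A) i l = A j l.
      rewrite mxE (bigD1 j) //= mxE !eqxx mul1r big1 ?addr0 // => k kj.
      by rewrite mxE (negPf kj) andbF mul0r.
    have dr (A : 'M[F]_n.+1) l : (A *m delta_mx j i) l i = A l j.
      rewrite mxE (bigD1 j) //= mxE !eqxx mulr1 big1 ?addr0 // => k kj.
      by rewrite mxE (negPf kj) mulr0.
    have mD (A B : 'M[F]_n.+1) k l : (A + B) k l = A k l + B k l by rewrite mxE.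
    rewrite mD mD dr mD !dl.
    have -> : P j i = P i j by rewrite -{1}Psym mxE.
    by rewrite !P_diag add0r addr0 -mulr2n -mulr_natl mulf_neq0.
  move=> /diag_step[W uW WP]; exists (W *m W0); rewrite ?unitmx_mul ?uW //.
  by left; move: WP; rewrite trmx_mul !mulmxA.
exists 1%:M; rewrite ?unitmx1 //; right; rewrite mul1mx trmx1 mulmx1.
apply/matrixP => i j; rewrite mxE; apply/eqP; move: no.
by rewrite negb_exists => /forallP /(_ i); rewrite negb_exists => /forallP /(_ j);
   rewrite negbK.
Qed.

Section Types.
Variables (F : finFieldType) (d : F).
Hypotheses (q_odd : odd #|F|) (nd : ~~ square d).
Implicit Types (h k : hyperplane_orbit) (A B M P W : 'M[F]_3).

Definition has_type h M := exists c B,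
  [/\ c != 0, B \in unitmx & M = c *: (B *m normal_form d h *m B^T)].

Lemma has_type_congr h M W c : W \in unitmx -> c != 0 ->
  W *m M *m W^T = c *: normal_form d h -> has_type h M.
Proof.
move=> uW c0 E; exists c, (invmx W); rewrite unitmx_inv; split=> //.
rewrite scalemxAl scalemxAr -E trmx_inv !mulmxA mulVmx // mul1mx.
by rewrite -mulmxA mulmxV ?unitmx_tr // mulmx1.
Qed.

Lemma has_type_conj h M W : W \in unitmx -> has_type h (W *m M *m W^T) ->
  has_type h M.
Proof.
move=> uW [c [B [c0 uB E]]].
apply: (@has_type_congr _ _ (invmx B *m W) c); rewrite ?unitmx_mul ?unitmx_inv ?uB //.
rewrite trmx_mul trmx_inv; transitivity (invmx B *m (W *m M *m W^T) *m invmx B^T).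
  by rewrite !mulmxA.
rewrite E -scalemxAr -scalemxAl !mulmxA mulVmx // mul1mx.
by rewrite -mulmxA mulmxV ?unitmx_tr // mulmx1.
Qed.

Lemma mx3_unit (a b c e f g h i j : F) :
  a * (f * j - g * i) - b * (e * j - g * h) + c * (e * i - f * h) != 0 ->
  mx3 a b c e f g h i j \in unitmx.
Proof. by move=> D; rewrite unitmxE det_mx3 unitfE. Qed.

Lemma type_rank1 (a b c : F) : a != 0 -> b ^+ 2 - a * c = 0 ->
  has_type H1 (mx3 a b 0 b c 0 0 0 0).
Proof.
(* The row (-b, a) spans the kernel of the singular 2 x 2 block. *)
move=> a0 D0; apply: (@has_type_congr _ _ (mx3 1 0 0 (- b) a 0 0 0 1) a) => //.
  by apply: mx3_unit; rewrite !(mul0r, mulr0, subr0, addr0, mul1r, mulr1).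
rewrite trmx3 !mulmx3 /= scalemx3; congr mx3; try ring.
transitivity (- a * (b ^+ 2 - a * c)); first by ring.
by rewrite D0; ring.
Qed.

(** When the discriminant is a nonzero square, the two isotropic directions are defined over F and
    serve as new basis vectors. *)
Lemma type_split (a b c : F) : b ^+ 2 - a * c != 0 -> square (b ^+ 2 - a * c) ->
  has_type H2r (mx3 a b 0 b c 0 0 0 0).
Proof.
have two0 := two_neq0 q_odd.
move=> D0 /squareP[s Es]; have s0 : s != 0.
  by apply: contraNneq D0 => s0; rewrite Es s0 expr0n.
have [a0|a0] := eqVneq a 0.
  have b0 : b != 0.
    by apply: contraNneq D0 => b0; rewrite a0 b0 expr0n mul0r subr0.
  apply: (@has_type_congr _ _ (mx3 1 0 0 c (-2 * b) 0 0 0 1) (-2 * b ^+ 2)).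
  - apply: mx3_unit; rewrite (_ : _ + _ = - (2 * b)); last by ring.
    by rewrite oppr_eq0 mulf_neq0.
  - by rewrite mulNr oppr_eq0 mulf_neq0 // expf_neq0.
  by rewrite a0 trmx3 !mulmx3 /= scalemx3; congr mx3; ring.
apply: (@has_type_congr _ _ (mx3 (- b + s) a 0 (- b - s) a 0 0 0 1) (-2 * a * s ^+ 2)).
- apply: mx3_unit; rewrite (_ : _ + _ = 2 * (s * a)); last by ring.
  by rewrite !mulf_neq0.
- by rewrite !mulNr oppr_eq0 !mulf_neq0 // expf_neq0.
rewrite trmx3 !mulmx3 /= scalemx3; congr mx3; try ring;
  [ transitivity (a * (s ^+ 2 - (b ^+ 2 - a * c)))
  | transitivity (- a * (s ^+ 2 + (b ^+ 2 - a * c)))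
  | transitivity (- a * (s ^+ 2 + (b ^+ 2 - a * c)))
  | transitivity (a * (s ^+ 2 - (b ^+ 2 - a * c))) ];
  by [ring | rewrite Es; ring].
Qed.

(** The vector (-b, a) is orthogonal to (1, 0) and has value - a (b^2 - a c) = - a d s^2; dividing
    it by s gives a times the normal form. *)
Lemma type_nonsplit (a b c : F) : ~~ square (b ^+ 2 - a * c) ->
  has_type H2i (mx3 a b 0 b c 0 0 0 0).
Proof.
move=> nD; have [s [s0 Es]] := nonsquare_mulP q_odd nd nD.
have a0 : a != 0.
  by apply: contraNneq nD => ->; rewrite mul0r subr0 sqr_square.
apply: (@has_type_congr _ _ (mx3 1 0 0 (- b / s) (a / s) 0 0 0 1) a) => //.
  apply: mx3_unit; rewrite (_ : _ + _ = a / s); last by ring.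
  by rewrite mulf_neq0 ?invr_eq0.
rewrite trmx3 !mulmx3 /= scalemx3; congr mx3; try by field.
transitivity (- a * (b ^+ 2 - a * c) / s ^+ 2); first by field.
by rewrite Es; field.
Qed.

(** After diagonalization to (a, b, c), a solution of a x^2 + b y^2 = - c yields the isotropic
    vectors (x, y, 1) and (-x, -y, 1), both orthogonal to (- b y, a x, 0), whose value is - a b
    c. *)
Lemma type_nonsingular M : M^T = M -> \det M != 0 -> has_type H3 M.
Proof.
have two0 := two_neq0 q_odd.
move=> Msym detM; have [W uW dW] := sym_diagonalizable two0 Msym.
apply: (has_type_conj uW); set Q := W *m M *m W^T.
have : \det Q != 0.
  rewrite !det_mulmx det_tr !mulf_neq0 //; by rewrite -unitfE -unitmxE.
have [a [b [c ->]]] : exists a b c, Q = mx3 a 0 0 0 b 0 0 0 c.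
  exists (Q 0 0), (Q 1 1), (Q 2 2); rewrite [LHS]mx3_eta.
  by move/is_diag_mxP: dW => dW; congr mx3; apply: dW.
rewrite det_mx3 => D0; have abc0 : a * b * c != 0.
  by apply: contraNneq D0 => E0; apply/eqP; rewrite -[RHS]E0; ring.
move: abc0; rewrite !mulf_eq0 !negb_or => /andP[/andP[a0 b0] c0].
have [x [y xy]] := binary_form_universal q_odd (- c) a0 b0.
(* Scales the second isotropic row so that its product with the first is also - a b c. *)
pose t := - a * b / 2.
apply: (@has_type_congr _ _
  (mx3 x y 1 (- b * y) (a * x) 0 (t * - x) (t * - y) t) (- a * b * c)).
- apply: mx3_unit.
  rewrite (_ : _ + _ = 2 * t * (a * x ^+ 2 + b * y ^+ 2)); last by ring.
  by rewrite xy /t !mulf_neq0 ?invr_eq0 ?oppr_eq0.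
- by rewrite !mulf_neq0 ?oppr_eq0.
rewrite trmx3 !mulmx3 /= scalemx3 /t; congr mx3; try ring.
- transitivity ((a * x ^+ 2 + b * y ^+ 2) + c); first by ring.
  by rewrite xy; ring.
- transitivity (- t * ((a * x ^+ 2 + b * y ^+ 2) - c)); first by rewrite /t; ring.
  by rewrite xy /t; field.
- transitivity (a * b * (a * x ^+ 2 + b * y ^+ 2)); first by ring.
  by rewrite xy; ring.
- transitivity (- t * ((a * x ^+ 2 + b * y ^+ 2) - c)); first by rewrite /t; ring.
  by rewrite xy /t; field.
- transitivity (t ^+ 2 * ((a * x ^+ 2 + b * y ^+ 2) + c)); first by rewrite /t; ring.
  by rewrite xy; ring.
Qed.

(** The substitution A -> C^T A B turns the pair P, M into the normal forms; the scalars do not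
    affect the vanishing of the trace. *)
Lemma card_type h k P M : has_type h P -> has_type k M ->
  #|[set A in unitmx | \tr (P *m (A *m M *m A^T)) == 0]| = #|incident d h k|.
Proof.
move=> [c [C [c0 uC ->]]] [e [B [e0 uB ->]]].
pose f A := C^T *m A *m B.
have f_inj : injective f.
  move=> A A' /(congr1 (fun X => invmx C^T *m X *m invmx B)).
  by rewrite /f !mulmxA !mulVmx ?unitmx_tr // !mul1mx -!mulmxA !mulmxV // !mulmx1.
have tE A : \tr (c *: (C *m normal_form d h *m C^T) *m
     (A *m (e *: (B *m normal_form d k *m B^T)) *m A^T)) =
     c * e * \tr (normal_form d h *m (f A *m normal_form d k *m (f A)^T)).
  rewrite -!(scalemxAl, scalemxAr) !mxtraceZ mulrA; congr (_ * _).
  rewrite -!mulmxA mxtrace_mulC /f !trmx_mul trmxK.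
  by rewrite !mulmxA.
rewrite -(card_imset _ f_inj); apply: eq_card => X; rewrite !inE.
apply/imsetP/andP => [[A /[!inE] /andP[uA tA] ->]|[uX tX]].
  rewrite !unitmx_mul unitmx_tr uC uA uB; split=> //.
  by move: tA; rewrite tE !mulf_eq0 (negPf c0) (negPf e0).
have EX : f (invmx C^T *m X *m invmx B) = X.
  by rewrite /f !mulmxA mulmxV ?unitmx_tr // mul1mx -mulmxA mulVmx // mulmx1.
exists (invmx C^T *m X *m invmx B) => //.
rewrite inE !unitmx_mul !unitmx_inv unitmx_tr uC uX uB /= tE EX.
by rewrite (eqP tX) mulr0.
Qed.

End Types.

(** * The group order and the incidence numbers as functions of q *)

Definition gl3_order (q : rat) := (q ^+ 3 - 1) * (q ^+ 3 - q) * (q ^+ 3 - q ^+ 2).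

Definition incidence_number (h k : hyperplane_orbit) (q : rat) : rat :=
  let c2 := q ^+ 3 - q in let c3 := q ^+ 3 - q ^+ 2 in
  match h, k with
  | H1, H2r | H2r, H1 => (2 * q ^+ 2 - q - 1) * (c2 * c3)
  | H1, H2i | H2i, H1 => (q - 1) * (c2 * c3)
  | H1, _ | _, H1 => (q ^+ 2 - 1) * (c2 * c3)
  | H2r, H2r => ((q - 1) * c2 + (2 * q ^+ 2 - 2 * q) * (q ^+ 2 - q) +
                 (q ^+ 3 - 2 * q ^+ 2 + q) * (q ^+ 2 - 1)) * c3
  | H2r, H2i | H2i, H2r => ((q - 1) * c2 + c2 * (q ^+ 2 - 1)) * c3
  | H2r, H3 | H3, H2r => ((q ^+ 2 - 1) * (q ^+ 2 - q) +
                          (q ^+ 3 - q ^+ 2) * (q ^+ 2 - 1)) * c3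
  | H2i, H2i => q ^+ 2 * (q ^+ 2 - 1) * (q + 1) * c3
  | H2i, H3 | H3, H2i => c2 * c2 * (q ^+ 2 - q)
  | H3, H3 => (q ^+ 2 - q) * (q ^+ 3 - 1) * c2 + q * (q ^+ 2 - 1) * (q ^+ 2 - q)
  end.

(** * Counting through the pencil of a line *)

Section Counting.
Variable F : finFieldType.
Hypothesis q_odd : odd #|F|.
Local Notation q := (#|F|%:R : rat).

Lemma card_incident (d : F) h k : ~~ square d ->
  #|incident d h k|%:R = incidence_number h k q.
Proof.
move=> nd; have sym i j : #|incident d i j|%:R = #|incident d j i|%:R :> rat.
  by rewrite card_incident_sym.
have e1 i : #|incident d H1 i|%:R = incidence_number H1 i q.
  rewrite card_incident1 card_isotropic //.
  by case: i; rewrite /incidence_number; ring.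
have e2 i : #|incident d H2r i|%:R = incidence_number H2r i q.
  rewrite card_incident2r // card_radical // card_isotropic //.
  by case: i; rewrite /incidence_number; ring.
have e3 := card_incident32i q_odd nd.
case: h; [exact: e1|exact: e2|case: k|case: k].
- by rewrite sym e1.
- by rewrite sym e2.
- exact: card_incident2i.
- by rewrite sym e3.
- by rewrite sym e1.
- by rewrite sym e2.
- exact: e3.
- exact: card_incident33.
Qed.

Lemma card_unitmx_3 : #|[set A : 'M[F]_3 in unitmx]|%:R = gl3_order q.
Proof.
have -> : [set A : 'M[F]_3 in unitmx] = [set A in unitmx | true].
  by apply/setP => A; rewrite !inE andbT.
rewrite (card_unitmx3 predT) natr_sum.
transitivity (\sum_(a : F * F * F) (a != (0, 0, 0))%:R *
   ((q ^+ 3 - q) * (q ^+ 3 - q ^+ 2)) : rat).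
  apply: eq_bigr => a _; rewrite natr_sum mulrA -card_indep2 -sum_indicator.
  by apply: eq_bigr => b _; rewrite (card_indep3_cond true).
by rewrite sum_indicator card_nonzero_vectors /gl3_order; ring.
Qed.

(* A common zero of f and g lies on all the q + 1 forms g, f + t g of the pencil,
   any other x on exactly one. *)
Lemma pencil_card (T : finType) (f g : T -> F) (S : {set T}) :
  (#|S| + #|F| * #|[set x in S | (f x == 0%R) && (g x == 0%R)]|)%N =
  (#|[set x in S | g x == 0%R]| +
     \sum_(t : F) #|[set x in S | (f x + t * g x)%R == 0%R]|)%N.
Proof.
have card (P : pred T) : #|[set x in S | P x]| = (\sum_(x in S) P x)%N.
  rewrite -sum1dep_card big_mkcondr; apply: eq_bigr => x _.
  by case: (P x).
rewrite !card -[#|S|]sum1_card big_distrr -big_split /=.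
under [X in (_ = _ + X)%N]eq_bigr => t _ do rewrite card.
rewrite exchange_big -big_split /=; apply: eq_bigr => x _.
have [g0|g0] := eqVneq (g x) 0.
  rewrite andbT g0; under eq_bigr => t _ do rewrite mulr0 addr0.
  by rewrite sum_nat_const mulnC.
rewrite andbF muln0 addn0 (bigD1 (- f x / g x)) //= mulfVK // subrr eqxx.
rewrite big1 // => t tne; apply/eqP; rewrite eqb0.
apply: contraNneq tne => E; apply/eqP/(mulIf g0); rewrite mulfVK //.
by apply/eqP; rewrite -addr_eq0 addrC E.
Qed.

Lemma K_actM (A B : 'M[F]_3) L : K_act (A *m B) L = K_act A (K_act B L).
Proof.
rewrite /K_act -imset_comp; apply: eq_imset => M /=.
by rewrite trmx_mul !mulmxA.
Qed.

Lemma K_act1 (L : {set 'M[F]_3}) : K_act 1%:M L = L.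
Proof.
rewrite /K_act -[RHS]imset_id; apply: eq_imset => M /=.
by rewrite trmx1 mul1mx mulmx1.
Qed.

(** Orbit-stabilizer: the matrices sending L to a given line of the orbit form a left coset of the
    stabilizer. *)
Lemma card_K_orbit_sub (L H : {set 'M[F]_3}) :
  (#|[set L' in K_orbit L | L' \subset H]| * #|[set A in unitmx | K_act A L == L]|)%N
  = #|[set A in unitmx | K_act A L \subset H]|.
Proof.
rewrite -[RHS]sum1_card.
rewrite (partition_big (fun A => K_act A L) [in [set L' in K_orbit L | L' \subset H]]); last first.
  by move=> A /[!inE] /andP[uA ->]; rewrite andbT; apply: imset_f.
rewrite /= -sum_nat_const; apply: eq_bigr => L' /[!inE] /andP[/imsetP[A0 uA0 EL] LH].
rewrite sum1dep_card -(card_imset _ (can_inj (mulKmx uA0))).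
apply: eq_card => A; rewrite !inE; apply/imsetP/idP => [[B /[!inE]]|].
  move=> /andP[uB /eqP BL] ->; rewrite unitmx_mul uA0 uB /=.
  by rewrite K_actM BL -EL LH eqxx.
move=> /andP[/andP[uA _] /eqP AL]; exists (invmx A0 *m A); rewrite ?mulKVmx //.
rewrite inE unitmx_mul unitmx_inv uA0 uA /=.
by rewrite K_actM AL EL -K_actM mulVmx // K_act1.
Qed.

(** The points of the line are (0, 1), of type [tau_inf], and (1, t), of type [tau t]; [pencil_card]
    is applied to the trace conditions of M(1,0) and M(0,1). *)
Lemma card_orbit_in_hyperplane (M : F -> F -> 'M[F]_3) (P : 'M[F]_3) p h
    (tau : F -> hyperplane_orbit) tau_inf (d : F) :
  ~~ square d ->
  (forall x y, M x y = x *: M 1 0 + y *: M 0 1) ->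
  (forall x y, (M x y)^T = M x y) ->
  (forall N, N^T = N -> (N \in hyperplane p) = (\tr (P *m N) == 0)) ->
  has_type d h P -> has_type d tau_inf (M 0 1) ->
  (forall t, has_type d (tau t) (M 1 t)) ->
  #|[set L in K_orbit (line_of M) | L \subset hyperplane p]|%:R *
    #|[set A in unitmx | K_act A (line_of M) == line_of M]|%:R * q =
  incidence_number h tau_inf q + \sum_(t : F) incidence_number h (tau t) q
    - gl3_order q.
Proof.
move=> nd Mlin Msym HP tP tinf tt.
pose f (N A : 'M[F]_3) := \tr (P *m (A *m N *m A^T)).
have := pencil_card (f (M 1 0)) (f (M 0 1)) [set A in unitmx].
move/(congr1 (fun n : nat => n%:R : rat)); rewrite !natrD natr_sum natrM.
rewrite card_unitmx_3 => E.
rewrite -natrM card_K_orbit_sub.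
have -> : [set A in unitmx | K_act A (line_of M) \subset hyperplane p] =
    [set x in [set A in unitmx] | f (M 1 0) x == 0 & f (M 0 1) x == 0].
  apply/setP => A; rewrite !inE; case: (A \in unitmx) => //=.
  have fin N : N^T = N -> (A *m N *m A^T \in hyperplane p) = (f N A == 0).
    by move=> Ns; rewrite HP // !trmx_mul trmxK Ns mulmxA.
  apply/subsetP/andP => [sub|[f1 f2]].
    by rewrite -!fin //; split; apply: sub; apply: imset_f;
       [apply: (imset_f _ (x := (1, 0)))|apply: (imset_f _ (x := (0, 1)))].
  move=> _ /imsetP[_ /imsetP[[x y] _ ->] ->]; rewrite fin //.
  move: f1 f2; rewrite /f => /eqP f1 /eqP f2.
  rewrite Mlin mulmxDr mulmxDl mulmxDr linearD -!(scalemxAl, scalemxAr) /=.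
  by rewrite !mxtraceZ f1 f2 !mulr0 addr0.
rewrite mulrC; move: E => /(canRL (addKr _)) ->; rewrite addrC; congr (_ - _).
have fM t A : f (M 1 0) A + t * f (M 0 1) A = f (M 1 t) A.
  rewrite /f [in RHS]Mlin scale1r mulmxDr mulmxDl mulmxDr linearD.
  by rewrite -!(scalemxAl, scalemxAr) /= mxtraceZ.
congr (_ + _).
  rewrite -(card_incident _ _ nd) -(card_type tP tinf); congr (_%:R).
  by apply: eq_card => A; rewrite !inE.
apply: eq_bigr => t _.
rewrite -(card_incident _ _ nd) -(card_type tP (tt t)); congr (_%:R).
by apply: eq_card => A; rewrite !inE fM.
Qed.

End Counting.

(** * Gram matrices of conics *)

Section Forms.
Variable R : comNzRingType.
Implicit Types (l m : {mpoly R[3]}).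

Lemma linear_expand l : (forall u, mdeg u != 1%N -> l@_u = 0) ->
  l = \sum_i l@_U_(i) *: 'X_i.
Proof.
move=> l1; apply/mpolyP => u; rewrite raddf_sum /=.
under eq_bigr => i _ do rewrite mcoeffZ mcoeffX.
have [/mdeg1P[j /eqP->]|u1] := boolP (mdeg u == 1%N).
  rewrite (bigD1 j) //= eqxx mulr1 big1 ?addr0 // => i ij.
  by rewrite eq_mnm1 ?(negPf ij) ?mulr0.
rewrite l1 // big1 // => i _.
have [Eu|_] := eqVneq U_(i)%MM u; last by rewrite mulr0.
by rewrite -Eu mdeg1 in u1.
Qed.

Lemma mnm1D_eq (a b i j : 'I_3) : (U_(a) + U_(b) == U_(i) + U_(j))%MM =
  ((a == i) && (b == j)) || ((a == j) && (b == i)).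
Proof.
have cancel (x y z : 'I_3) : (U_(x) + U_(y) == U_(x) + U_(z))%MM = (y == z).
  by rewrite eqm_add2l eq_mnm1.
apply/idP/idP => [E|/orP[] /andP[/eqP-> /eqP->]] //; last first.
  by rewrite addmC.
have [ai|ai] := eqVneq a i; first by move: E; rewrite ai cancel => ->.
have [aj|aj] := eqVneq a j.
  by move: E; rewrite aj [(U_(i) + _)%MM]addmC cancel => ->; rewrite orbT.
move/eqP/mnmP: E => /(_ a).
by rewrite !mnmDE !mnm1E eqxx [i == a]eq_sym (negPf ai) [j == a]eq_sym (negPf aj).
Qed.

(** The indicator prevents the single term of a square monomial from being counted twice. *)
Lemma mcoeff_linear_mul l m i j :
  (forall u, mdeg u != 1%N -> l@_u = 0) ->
  (forall u, mdeg u != 1%N -> m@_u = 0) ->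
  (l * m)@_(U_(i) + U_(j)) = l@_U_(i) * m@_U_(j) +
    (i != j)%:R * (l@_U_(j) * m@_U_(i)).
Proof.
move=> /linear_expand El /linear_expand Em.
rewrite {1}El {1}Em mulr_suml raddf_sum /=.
transitivity (\sum_a \sum_b l@_U_(a) * m@_U_(b) *
  (((a == i) && (b == j)) || ((a == j) && (b == i)))%:R).
  apply: eq_bigr => a _; rewrite mulr_sumr raddf_sum /=; apply: eq_bigr => b _.
  rewrite -scalerAl -scalerAr scalerA mcoeffZ -mpolyXD mcoeffX.
  by rewrite mnm1D_eq.
rewrite (bigD1 i) //= (bigD1 j) //= !eqxx mulr1.
have [<-|ij] := eqVneq i j.
  rewrite !big1 ?mul0r ?addr0 //= => [a ai|b bi].
    by rewrite big1 // => b _; rewrite (negPf ai) mulr0.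
  by rewrite (negPf bi) mulr0.
rewrite big1 ?addr0 => [|b bj]; last by rewrite (negPf bj) mulr0.
rewrite (bigD1 j) 1?eq_sym //= (bigD1 i) //= !eqxx orbT mulr1 mul1r.
rewrite big1 ?addr0 => [|b bi]; last first.
  by rewrite (negPf ij) (negPf bi) mulr0.
rewrite big1 ?addr0 // => a /andP[ai aj]; rewrite big1 // => b _.
by rewrite (negPf ai) (negPf aj) mulr0.
Qed.

Lemma linear_form_coeff l : linear_form l ->
  (forall u, mdeg u != 1%N -> l@_u = 0) /\ exists i, l@_U_(i) != 0.
Proof.
move=> [l0 hl]; have l1 u : mdeg u != 1%N -> l@_u = 0.
  by move=> u1; apply: (dhomog_nemf_coeff hl).
split=> //; apply/existsP; apply: contraNT l0; rewrite negb_exists => /forallP E.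
rewrite (linear_expand l1) big1 // => i _.
by move: (E i); rewrite negbK => /eqP->; rewrite scale0r.
Qed.

Lemma mdeg2P (u : 'X_{1..3}) : mdeg u = 2%N -> exists i j, u = (U_(i) + U_(j))%MM.
Proof.
move=> u2; have: u != 0%MM by rewrite -mdeg_eq0 u2.
case/boolP: [exists i, u i != 0%N] => [/existsP[i ui] _|]; last first.
  rewrite negb_exists => /forallP E /eqP[]; apply/mnmP => i.
  by rewrite mnm0E; apply/eqP; move: (E i); rewrite negbK.
have iu : (U_(i) <= u)%MM by rewrite lep1mP.
have Eu := submK iu; have := congr1 (@mdeg _) Eu.
rewrite mdegD mdeg1 u2 addn1 => -[/eqP /mdeg1P[j /eqP Ej]].
by exists i, j; rewrite addmC -Ej.
Qed.

End Forms.

(** Stated for plain functions because [is_imaginary_line_pair] conjugates coefficients by a power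
    map that is not packaged as a morphism. *)
Lemma mcoeff_map_mpoly0 (R S : nzRingType) (f : R -> S) (p : {mpoly R[3]}) u :
  f 0 = 0 -> (map_mpoly f p)@_u = f p@_u.
Proof.
move=> f0; rewrite /map_mpoly /mmap raddf_sum /=.
under eq_bigr => v _ do rewrite mmap1_id mcoeffCM mcoeffX.
have [up|up] := boolP (u \in msupp p).
  rewrite (bigD1_seq u) ?msupp_uniq //= eqxx mulr1 big1 ?addr0 // => v vu.
  by rewrite (negPf vu) mulr0.
rewrite (memN_msupp_eq0 up) f0 big_seq big1 // => v vp.
by case: eqP vp => [->|_]; rewrite ?(negPf up) ?mulr0.
Qed.

Section Frobenius.
Variables (F : finFieldType) (K : fieldType) (iota : {rmorphism F -> K}).

(** The order of F is a power of its characteristic, which K shares through [iota]. *)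
Lemma frobeniusD (x y : K) : (x + y) ^+ #|F| = x ^+ #|F| + y ^+ #|F|.
Proof.
have [p pr_p pF] := finPcharP F; apply: exprDn_pchar.
have := abelem_pgroup (fin_ring_pchar_abelem pF); rewrite /pgroup cardsT.
by apply: sub_in_pnat => r _ /eqP->; apply: (rmorph_pchar iota).
Qed.

(** The polynomial X^q - X has at most q roots, and the image of F already provides q of them. *)
Lemma frobenius_fixed (x : K) : x ^+ #|F| = x -> exists a, x = iota a.
Proof.
move=> Ex; have [/mapP[a _ Ea]|xF] := boolP (x \in map iota (enum F)).
  by exists a.
have Xq : size ('X^#|F| - 'X : {poly K}) = #|F|.+1.
  by rewrite size_polyDl size_polyXn // size_polyN size_polyX ltnS finNzRing_gt1.
have p0 : 'X^#|F| - 'X != 0 :> {poly K} by rewrite -size_poly_eq0 Xq.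
have /(max_poly_roots p0) : all (root ('X^#|F| - 'X)) (x :: map iota (enum F)).
  rewrite /= rootE !hornerE Ex subrr eqxx /=; apply/allP => _ /mapP[a _ ->].
  by rewrite rootE !hornerE -rmorphXn expf_card subrr.
rewrite /= xF map_inj_uniq ?enum_uniq; last exact: fmorph_inj.
by move=> /(_ isT); rewrite Xq size_map -cardE ltnn.
Qed.

End Frobenius.

Section Gram.
Variable F : finFieldType.
Hypothesis q_odd : odd #|F|.
Implicit Types (p : {mpoly F[3]}) (d : F).
Local Notation v0 := ((0, 0, 0) : F * F * F).

(** Each off-diagonal position occurs twice in the trace against a symmetric matrix; the halves make
    that trace the equation of the hyperplane of p. *)
Definition gram p : 'M[F]_3 :=
  \matrix_(i, j) (if i == j then p@_(U_(i) + U_(j)) else p@_(U_(i) + U_(j)) / 2).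

Lemma gram_sym p : (gram p)^T = gram p.
Proof. by apply/matrixP => i j; rewrite !mxE eq_sym addmC. Qed.

Lemma mem_hyperplane p (N : 'M[F]_3) : N^T = N ->
  (N \in hyperplane p) = (\tr (gram p *m N) == 0).
Proof.
have two0 := two_neq0 q_odd.
move=> Ns; rewrite inE Ns eqxx /=; congr (_ == 0).
under eq_bigr => i _ do rewrite big_mkcond sum3.
rewrite sum3 /= /mxtrace sum3 !mxE !sum3 !mxE /=.
have S i j : N j i = N i j by rewrite -{1}Ns mxE.
rewrite (S 0 1) (S 0 2) (S 1 2).
pose c i j := p@_(U_(i) + U_(j)); rewrite -!/(c _ _).
have C i j : c j i = c i j by rewrite /c addmC.
by rewrite (C 0 1) (C 0 2) (C 1 2); clearbody c; field.
Qed.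

Definition vec_mx_of (l : 'I_3 -> F) : F * F * F := (l 0, l 1, l 2).

Lemma gram_mul p (c : F) (l m : 'I_3 -> F) :
  (forall i j, p@_(U_(i) + U_(j)) = c * (l i * m j + (i != j)%:R * (l j * m i))) ->
  gram p = \matrix_(i, j) (c / 2 * (l i * m j + l j * m i)).
Proof.
have two0 := two_neq0 q_odd.
move=> E; apply/matrixP => i j; rewrite !mxE E.
by case: eqVneq => [->|_] /=; field.
Qed.

(** For a matrix B with columns v_k, B N B^T is the sum of the N_kl v_k v_l^T, so products of linear
    forms can be read off from a normal form N. *)
Definition cols (a b c : F * F * F) : 'M[F]_3 := (mxv a b c)^T.

Lemma cols_unit a b c : dot (cross a b) c != 0 -> cols a b c \in unitmx.
Proof. by rewrite unitmx_tr unitmxE det_mxv unitfE. Qed.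

Lemma indep_complete a b : cross a b != v0 -> exists c, cols a b c \in unitmx.
Proof.
by move=> /vneq0[c E]; exists c; apply: cols_unit; rewrite E oner_eq0.
Qed.

Lemma nonzero_complete a : a != v0 -> exists b c, cols a b c \in unitmx.
Proof.
case: a => [[x y] z] a0.
suff [b ab] : exists b, cross (x, y, z) b != v0.
  by have [c uc] := indep_complete ab; exists b, c.
have [E1|E1] := eqVneq (cross (x, y, z) (1, 0, 0)) v0; last by exists (1, 0, 0).
have [E2|E2] := eqVneq (cross (x, y, z) (0, 1, 0)) v0; last by exists (0, 1, 0).
case/negP: a0; move: E1 E2 => -[_ /= z0 y0] [_ _ /= x0].
have -> : x = 0 by rewrite -x0; ring.
have -> : y = 0 by rewrite -[RHS]oppr0 -y0; ring.
by have -> : z = 0 by rewrite -z0; ring.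
Qed.

Lemma vec_parallel (l m : 'I_3 -> F) k :
  vec_mx_of m = vscale k (vec_mx_of l) -> forall i, m i = k * l i.
Proof. by move=> [e0 e1 e2]; apply: ord3P. Qed.

Lemma vec_neq0 (l : 'I_3 -> F) i : l i != 0 -> vec_mx_of l != v0.
Proof. by apply: contraNneq => -[l0 l1 l2]; apply/eqP; move: i; apply: ord3P. Qed.

Lemma gram_double_line d p : is_double_line p -> has_type d H1 (gram p).
Proof.
move=> [c [l [c0 /linear_form_coeff[l1 [i li]] Ep]]].
have two0 := two_neq0 q_odd.
pose lv i := l@_U_(i); have -> := @gram_mul p c lv lv.
  have [b [e uB]] := nonzero_complete (vec_neq0 (l := lv) li).
  exists c, (cols (vec_mx_of lv) b e); split=> //; clearbody lv.
  rewrite /cols /mxv trmxK trmx3 /= !mulmx3 scalemx3.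
  by apply/matrixP; do 2!apply: ord3P; rewrite !mxE /=; field.
by move=> j k; rewrite Ep mcoeffZ mcoeff_linear_mul.
Qed.

Lemma gram_real_line_pair d p : is_real_line_pair p -> has_type d H2r (gram p).
Proof.
move=> [c [l [m [c0 /linear_form_coeff[l1 [i li]] /linear_form_coeff[m1 _] lm Ep]]]].
have two0 := two_neq0 q_odd.
pose lv i := l@_U_(i); pose mv i := m@_U_(i).
have -> := @gram_mul p c lv mv.
  have l0 : vec_mx_of lv != v0 by apply: (vec_neq0 (i := i)).
  have lm0 : cross (vec_mx_of lv) (vec_mx_of mv) != v0.
    apply/negP => /(parallelP l0)[k /vec_parallel Ek].
    case/eqP: (lm k); rewrite (linear_expand m1) (linear_expand l1) scaler_sumr.
    by apply: eq_bigr => j _; rewrite scalerA -Ek.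
  have [e uB] := indep_complete lm0.
  exists (c / 2), (cols (vec_mx_of lv) (vec_mx_of mv) e).
  split; rewrite ?mulf_neq0 ?invr_eq0 //.
  clearbody lv mv; rewrite /cols /mxv trmxK trmx3 /= !mulmx3 scalemx3.
  by apply/matrixP; do 2!apply: ord3P; rewrite !mxE /=; field.
by move=> j k; rewrite Ep mcoeffZ mcoeff_linear_mul.
Qed.

(** A kernel vector of the Gram matrix would be a singular point already over F, so the hypothesis
    is applied to the identity extension. *)
Lemma gram_nonsingular d p : ~~ square d -> is_nonsingular_conic p ->
  has_type d H3 (gram p).
Proof.
move=> nd [[p0 hp] sing].
have two0 := two_neq0 q_odd.
apply: type_nonsingular; rewrite ?gram_sym //.
apply/negP => /det0P[v v0 vP].
have Ep : p = \sum_i \sum_j gram p i j *: ('X_i * 'X_j).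
  apply/mpolyP => u; rewrite raddf_sum /=.
  under eq_bigr => i _.
    rewrite raddf_sum /=.
    under eq_bigr => j _ do rewrite mcoeffZ -mpolyXD mcoeffX.
    over.
  have [u2|u2] := eqVneq (mdeg u) 2%N; last first.
    rewrite (dhomog_nemf_coeff hp) // big1 // => i _; rewrite big1 // => j _.
    have [Eu|_] := eqVneq (U_(i) + U_(j))%MM u; last by rewrite mulr0.
    by rewrite -Eu mdegD !mdeg1 in u2.
  have [a [b ->]] := mdeg2P u2.
  under eq_bigr => i _ do under eq_bigr => j _ do rewrite mnm1D_eq.
  rewrite !sum3 !mxE /=.
  pose c i j := p@_(U_(i) + U_(j)); rewrite -!/(c _ _).
  have C i j : c j i = c i j by rewrite /c addmC.
  rewrite (C 0 1) (C 0 2) (C 1 2).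
  clearbody c.
  by move: a b; do 2!apply: ord3P;
    rewrite /= ?(C 0 1) ?(C 0 2) ?(C 1 2); field.
have Eid : map_mpoly idfun p = p by apply/mpolyP => u; rewrite mcoeff_map_mpoly0.
have Pv i : gram p i 0 * v 0 0 + gram p i 1 * v 0 1 + gram p i 2 * v 0 2 = 0.
  have := congr1 (fun w : 'rV_3 => w 0 i) vP.
  rewrite [LHS]mxE [RHS]mxE sum3 => <-.
  have S j : gram p j i = gram p i j by rewrite -{1}gram_sym mxE.
  by rewrite !S; ring.
have dX (i k : 'I_3) : ('X_i)^`M(k).@[fun j => v 0 j] = (i == k)%:R :> F.
  rewrite mderivX mnm1E; have [->|_] := eqVneq i k; last by rewrite scale0r meval0.
  by rewrite scale1r -{1}[U_(k)%MM]add0m addmK mpolyX0 meval1.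
case: (sing F idfun (fun i => v 0 i)); rewrite Eid; split.
- by apply/existsP; apply: contraNT v0; rewrite negb_exists => /forallP E;
    apply/eqP/rowP => i; rewrite mxE; apply/eqP; move: (E i); rewrite negbK.
- rewrite {1}Ep raddf_sum /=; apply: big1 => i _; rewrite raddf_sum /=.
  transitivity (v 0 i * (gram p i 0 * v 0 0 + gram p i 1 * v 0 1 + gram p i 2 * v 0 2));
    last by rewrite Pv mulr0.
  by rewrite sum3 !mevalZ !mevalM !mevalXU; ring.
move=> k; rewrite {1}Ep (raddf_sum (mderiv k)) raddf_sum /=.
transitivity (2 * (gram p k 0 * v 0 0 + gram p k 1 * v 0 1 + gram p k 2 * v 0 2));
  last by rewrite Pv mulr0.
transitivity (\sum_i \sum_j gram p i j *
    ((i == k)%:R * v 0 j + v 0 i * (j == k)%:R)).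
  apply: eq_bigr => i _; rewrite (raddf_sum (mderiv k)) raddf_sum /=.
  apply: eq_bigr => j _.
  by rewrite mderivZ mevalZ mderivM mevalD !mevalM !dX !mevalXU.
have S i j : gram p j i = gram p i j by rewrite -{1}gram_sym mxE.
pose g i j := gram p i j; rewrite !sum3 -!/(g _ _).
have {}S i j : g j i = g i j by apply: S.
clearbody g; rewrite (S 0 1) (S 0 2) (S 1 2); move: k; apply: ord3P;
  by rewrite /= ?(S 0 1) ?(S 0 2) ?(S 1 2); ring.
Qed.

(** Write l = x + eps y with x, y over F and eps negated by conjugation. Then l l' = x^2 - e y^2
    with e = eps^2 a nonsquare of F, and e = d r^2 for some r, which is absorbed into y. *)
Lemma gram_imaginary_line_pair d p : ~~ square d -> is_imaginary_line_pair p ->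
  has_type d H2i (gram p).
Proof.
move=> nd [E [iota [c [l [cE c0 /linear_form_coeff[l1 _] dl Ep]]]]].
have two0 := two_neq0 q_odd.
have twoE : 2 != 0 :> E by rewrite -(rmorph_nat iota) fmorph_eq0.
pose s (x : E) := x ^+ #|F|.
have q0 : (0 < #|F|)%N by apply/card_gt0P; exists 0.
have sD x y : s (x + y) = s x + s y by apply: frobeniusD iota _ _.
have sM x y : s (x * y) = s x * s y by apply: exprMn.
have sI a : s (iota a) = iota a by rewrite /s -rmorphXn expf_card.
have sN x : s (- x) = - s x.
  by rewrite -mulN1r sM -(rmorph1 iota) -rmorphN sI rmorphN rmorph1 mulN1r.
have sV x : s x^-1 = (s x)^-1 by apply: exprVn.
have sK x : s (s x) = x by rewrite /s -exprM -[in RHS](expf_card x) cE.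
have s_fix x : s x = x -> exists a, x = iota a.
  exact: frobenius_fixed.
set l' := map_mpoly _ l in dl Ep.
have l'E u : l'@_u = s l@_u.
  by rewrite mcoeff_map_mpoly0 // expr0n; case: #|F| q0.
have l'1 u : mdeg u != 1%N -> l'@_u = 0.
  by move=> u1; rewrite l'E l1 // /s expr0n; case: #|F| q0.
have not_prop k : (forall i, s l@_U_(i) = k * l@_U_(i)) -> False.
  move=> K; case/eqP: (dl k); rewrite (linear_expand l'1) (linear_expand l1) scaler_sumr.
  by apply: eq_bigr => i _; rewrite scalerA -K l'E.
have [z zs] : exists z, s z != z.
  have [/existsP[i Hi]|] := boolP [exists i, s l@_U_(i) != l@_U_(i)].
    by exists l@_U_(i).
  rewrite negb_exists => /forallP K; case: (not_prop 1) => i.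
  by rewrite mul1r; apply/eqP; move: (K i); rewrite negbK.
(* Conjugation negates eps, so eps^2 lies in F; it is a nonsquare there, as a root in F would be
   fixed by conjugation. *)
pose eps := z - s z; have eps0 : eps != 0 by rewrite subr_eq0 eq_sym.
have s_eps : s eps = - eps by rewrite /eps sD sN sK opprB addrC.
have [e Ee] : exists e, eps ^+ 2 = iota e.
  by apply: s_fix; rewrite expr2 sM s_eps mulrNN.
have ne : ~~ square e.
  apply/negP => /squareP[r Er].
  have : (eps == iota r) || (eps == - iota r).
    by rewrite -eqf_sqr Ee Er rmorphXn.
  have epsN : eps != - eps by rewrite -subr_eq0 opprK -mulr2n -mulr_natl mulf_neq0.
  by case/orP => /eqP Eeps; case/eqP: epsN; rewrite -s_eps Eeps ?sN sI.
have [x Ex] : exists x, forall i, iota (x i) = (l@_U_(i) + s l@_U_(i)) / 2.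
  apply: (fin_all_exists (P := fun i a => iota a = (l@_U_(i) + s l@_U_(i)) / 2)).
  move=> i; have [|a Ea] := s_fix ((l@_U_(i) + s l@_U_(i)) / 2); last by exists a.
  by rewrite sM sV sD sK -(rmorph_nat iota 2) sI addrC.
have [y Ey] : exists y, forall i, iota (y i) = (l@_U_(i) - s l@_U_(i)) / (2 * eps).
  apply: (fin_all_exists (P := fun i a => iota a = (l@_U_(i) - s l@_U_(i)) / (2 * eps))).
  move=> i; have [|a Ea] := s_fix ((l@_U_(i) - s l@_U_(i)) / (2 * eps)); last by exists a.
  rewrite sM sV sM s_eps sD sN sK -(rmorph_nat iota 2) sI (rmorph_nat iota 2).
  by field; rewrite eps0 twoE oppr_eq0.
have El i : l@_U_(i) = iota (x i) + eps * iota (y i).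
  by rewrite Ex Ey; field; rewrite eps0 twoE.
have Esl i : s l@_U_(i) = iota (x i) - eps * iota (y i).
  by rewrite El sD sM s_eps !sI mulNr.
have Eg : gram p = \matrix_(i, j) (c * (x i * x j - e * (y i * y j))).
  have pE i j : iota p@_(U_(i) + U_(j)) = iota c * (l@_U_(i) * s l@_U_(j) +
       (i != j)%:R * (l@_U_(j) * s l@_U_(i))).
    have := congr1 (fun r => r@_(U_(i) + U_(j))) Ep.
    by rewrite mcoeff_map_mpoly mcoeffZ mcoeff_linear_mul // !l'E.
  apply/matrixP => i j; rewrite !mxE; apply: (fmorph_inj iota).
  rewrite (fun_if iota) !rmorphM fmorphV rmorphB !rmorphM -Ee (rmorph_nat iota 2).
  rewrite pE !Esl !El.
  by case: eqVneq => [->|ij] /=; field.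
(* If x = 0, or if y = k x, the conjugate of l is a multiple of l, by -1 or by (1 - eps k)/(1 + eps
   k), against [dl]. *)
have xy0 : cross (vec_mx_of x) (vec_mx_of y) != v0.
  apply/negP => xy; have [x0|x0] := eqVneq (vec_mx_of x) v0.
    have X i : x i = 0 by case: x0 => ? ? ?; move: i; apply: ord3P.
    by apply: (not_prop (-1)) => i; rewrite Esl El X rmorph0; ring.
  have [k /vec_parallel Ek] := parallelP x0 xy.
  have k0 : 1 + eps * iota k != 0.
    apply/eqP => K0; have Kn0 : iota k != 0.
      by apply/eqP => E0; move/eqP: K0; rewrite E0 mulr0 addr0 oner_eq0.
    have Eeps : eps = - (iota k)^-1.
      by apply: (mulIf Kn0); rewrite mulNr mulVf //; apply/eqP; rewrite -addr_eq0 addrC K0.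
    have : s eps = eps by rewrite Eeps sN sV sI.
    rewrite s_eps => /eqP; rewrite eq_sym -subr_eq0 opprK -mulr2n -mulr_natl.
    by rewrite mulf_eq0 (negPf twoE) (negPf eps0).
  apply: (not_prop ((1 - eps * iota k) / (1 + eps * iota k))) => i.
  by rewrite Esl El Ek rmorphM; field.
have [r [r0 Er]] := nonsquare_mulP q_odd nd ne.
have [n En] := vneq0 xy0.
exists c, (cols (vec_mx_of x) (vscale r (vec_mx_of y)) n); split=> //.
  apply: cols_unit; rewrite (_ : dot _ _ = r * dot (cross (vec_mx_of x) (vec_mx_of y)) n).
    by rewrite En mulr1.
  by clear; rewrite /dot /cross /vscale /=; ring.
rewrite Eg Er; clear; rewrite /cols /mxv trmxK trmx3 /= !mulmx3 scalemx3.
by apply/matrixP; do 2!apply: ord3P; rewrite !mxE /=; ring.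
Qed.

Lemma gram_type d h p : ~~ square d -> in_hyperplane_orbit h p ->
  has_type d h (gram p).
Proof.
move=> nd; case: h => /=.
- exact: gram_double_line.
- exact: gram_real_line_pair.
- exact: gram_imaginary_line_pair.
exact: gram_nonsingular.
Qed.

End Gram.

(** * Stabilizers of lines *)

Section Stabilizers5_to_10.
Variable F : finFieldType.
Hypothesis q_odd : odd #|F|.
Local Notation q := (#|F|%:R : rat).
Implicit Types (M : F -> F -> 'M[F]_3).

Lemma congr_mx3 (s11 s12 s13 s22 s23 s33 a1 b1 c1 a2 b2 c2 a3 b3 c3 : F) :
  let e a b c a' b' c' := s11 * (a * a') + s12 * (a * b' + b * a') +
    s13 * (a * c' + c * a') + s22 * (b * b') + s23 * (b * c' + c * b') +
    s33 * (c * c') in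
  mx3 a1 b1 c1 a2 b2 c2 a3 b3 c3 *m
    mx3 s11 s12 s13 s12 s22 s23 s13 s23 s33 *m
    (mx3 a1 b1 c1 a2 b2 c2 a3 b3 c3)^T =
  mx3 (e a1 b1 c1 a1 b1 c1) (e a1 b1 c1 a2 b2 c2) (e a1 b1 c1 a3 b3 c3)
      (e a1 b1 c1 a2 b2 c2) (e a2 b2 c2 a2 b2 c2) (e a2 b2 c2 a3 b3 c3)
      (e a1 b1 c1 a3 b3 c3) (e a2 b2 c2 a3 b3 c3) (e a3 b3 c3 a3 b3 c3).
Proof. by rewrite trmx3 !mulmx3; congr mx3; ring. Qed.

Definition stabilizer M := [set A in unitmx | K_act A (line_of M) == line_of M].

Definition maps_into M (N A : 'M[F]_3) := exists x y, A *m N *m A^T = M x y.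

(** It suffices to test the two spanning points: A acts injectively, so an image contained in the
    finite line equals it. *)
Lemma stabilizerP M A : (forall x y, M x y = x *: M 1 0 + y *: M 0 1) ->
  A \in unitmx ->
  reflect (maps_into M (M 1 0) A /\ maps_into M (M 0 1) A)
          (K_act A (line_of M) == line_of M).
Proof.
move=> Mlin uA; have act_inj : injective (fun N : 'M[F]_3 => A *m N *m A^T).
  move=> N N' /(congr1 (fun X => invmx A *m X *m invmx A^T)).
  by rewrite !mulmxA !mulVmx // !mul1mx -!mulmxA !mulmxV ?unitmx_tr // !mulmx1.
apply: (iffP eqP) => [E|[[x [y E1]] [x' [y' E2]]]].
  have fin N : N \in line_of M -> maps_into M N A.
    move=> NL; have : A *m N *m A^T \in line_of M by rewrite -E; apply: imset_f.
    by case/imsetP => -[x y] _ E'; exists x, y.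
  by split; apply: fin; [apply: (imset_f _ (x := (1, 0)))
                        |apply: (imset_f _ (x := (0, 1)))].
apply/eqP; rewrite eqEcard [#|K_act _ _|](card_imset _ act_inj) leqnn andbT.
apply/subsetP => _ /imsetP[_ /imsetP[[u v] _ ->] ->].
rewrite Mlin mulmxDr mulmxDl -!(scalemxAl, scalemxAr) E1 E2.
apply/imsetP; exists (u * x + v * x', u * y + v * y') => //=.
by rewrite [M x y]Mlin [M x' y']Mlin [RHS]Mlin !scalerDl !scalerDr !scalerA addrACA.
Qed.

Lemma card_stabilizer M (T : finType) (D : {set T}) (f : T -> 'M[F]_3) :
  (forall x y, M x y = x *: M 1 0 + y *: M 0 1) ->
  {in D &, injective f} ->
  (forall t, t \in D -> [/\ \det (f t) != 0, maps_into M (M 1 0) (f t)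
                           & maps_into M (M 0 1) (f t)]) ->
  (forall A, \det A != 0 -> maps_into M (M 1 0) A -> maps_into M (M 0 1) A ->
     exists2 t, t \in D & A = f t) ->
  #|stabilizer M| = #|D|.
Proof.
move=> Mlin f_inj D_stab stab_D; rewrite -(card_in_imset f_inj).
have uE (A : 'M[F]_3) : (A \in unitmx) = (\det A != 0) by rewrite unitmxE unitfE.
apply: eq_card => A; rewrite inE; apply/andP/imsetP => [[uA sA]|[t tD ->]].
  have [s1 s2] := stabilizerP Mlin uA sA.
  by have [t tD ->] := stab_D A (etrans (esym (uE A)) uA) s1 s2; exists t.
have [u s1 s2] := D_stab t tD; rewrite uE; split=> //.
by apply/stabilizerP => //; rewrite uE.
Qed.

Definition nz : {set F} := [set x | x != 0].

Lemma card_nz : #|nz|%:R = q - 1 :> rat.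
Proof.
rewrite card_neq0; have := finNzRing_gt1 F; case: #|F| => //= n _.
by rewrite -[n.+1]addn1 natrD addrK.
Qed.

(** Signs are indexed by Booleans so that they can be components of the finite parameter sets of the
    stabilizers. *)
Definition sgn (b : bool) : F := if b then -1 else 1.

Lemma sgn_inj b b' x : x != 0 -> sgn b * x = sgn b' * x -> b = b'.
Proof.
move=> x0 /(mulIf x0); have n1 : -1 != 1 :> F.
  by rewrite -subr_eq0 -opprD oppr_eq0 (two_neq0 q_odd).
by case: b b' => [] [] //= /eqP; rewrite ?(negPf n1) // eq_sym (negPf n1).
Qed.

Lemma sgnK b : sgn b * sgn b = 1.
Proof. by case: b => /=; ring. Qed.

Lemma sgn_neq0 b : sgn b != 0.
Proof. by case: b; rewrite /= ?oppr_eq0 oner_eq0. Qed.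

Lemma sqrt_sgn (x y : F) : x ^+ 2 = y ^+ 2 -> exists b, x = sgn b * y.
Proof.
move=> /eqP; rewrite eqf_sqr => /orP[] /eqP->.
  by exists false; rewrite mul1r.
by exists true; rewrite mulN1r.
Qed.

Definition line5 (x y : F) := mx3 x 0 0 0 y 0 0 0 0.

(** The first two columns of A are fixed or exchanged up to scalars. The third multiplies only zeros
    of the matrices, so it is free apart from the condition c3 != 0. *)
Lemma card_stabilizer5 : #|stabilizer line5|%:R =
  2 * (q - 1) ^+ 2 * (q ^+ 3 - q ^+ 2).
Proof.
pose f (t : bool * (F * F) * (F * F) * F) : 'M[F]_3 :=
  let: (s, (x, y), (c1, c2), c3) := t in
  if s then mx3 0 y c1 x 0 c2 0 0 c3 else mx3 x 0 c1 0 y c2 0 0 c3.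
rewrite (card_stabilizer
  (D := setX (setX (setX [set: bool] (setX nz nz)) [set: F * F]) nz) (f := f)).
- rewrite !cardsX !cardsT card_prod card_bool !natrM card_nz; ring.
- by move=> x y; rewrite /line5 !scalemx3 addmx3; congr mx3; ring.
- move=> [[[s [x y]] [c1 c2]] c3] [[[s' [x' y']] [c1' c2']] c3'].
  rewrite !inE /= !andbT => /andP[/andP[x0 y0] c0] /andP[/andP[x'0 y'0] c'0].
  case: s s' => [] [] /= /mx3_inj[[? ? ?] [[? ? ?] [? ? ?]]]; subst=> //;
    by rewrite ?eqxx in x0 x'0.
- move=> [[[s [x y]] [c1 c2]] c3] /[!inE] /= /[!andbT] /andP[/andP[x0 y0] c0].
  case: s; rewrite /f det_mx3; split.
  + by rewrite (_ : _ + _ = - (x * y * c3)) ?oppr_eq0 ?mulf_neq0 //; ring.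
  + by exists 0, (x ^+ 2); rewrite congr_mx3; congr mx3; ring.
  + by exists (y ^+ 2), 0; rewrite congr_mx3; congr mx3; ring.
  + by rewrite (_ : _ + _ = x * y * c3) ?mulf_neq0 //; ring.
  + by exists (x ^+ 2), 0; rewrite congr_mx3; congr mx3; ring.
  by exists 0, (y ^+ 2); rewrite congr_mx3; congr mx3; ring.
move=> A; rewrite [A]mx3_eta.
move: (A 0 0) (A 0 1) (A 0 2) (A 1 0) (A 1 1) (A 1 2) (A 2 0) (A 2 1) (A 2 2).
move=> a1 b1 c1 a2 b2 c2 a3 b3 c3 {A} dA [x [y]] + [x' [y']].
rewrite !congr_mx3 /line5 => /mx3_inj[[E11 E12 E13] [[_ E22 E23] [_ _ E33]]].
move=> /mx3_inj[[E11' E12' E13'] [[_ E22' E23'] [_ _ E33']]].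
have a30 : a3 = 0 by apply/eqP; rewrite -sqrf_eq0; apply/eqP; rewrite -E33; ring.
have b30 : b3 = 0 by apply/eqP; rewrite -sqrf_eq0; apply/eqP; rewrite -E33'; ring.
have a120 : a1 * a2 = 0 by rewrite -E12; ring.
have b120 : b1 * b2 = 0 by rewrite -E12'; ring.
have {}dA : c3 * (a1 * b2 - a2 * b1) != 0.
  by move: dA; rewrite det_mx3 a30 b30; apply: contra_neq => E; apply: etrans E; ring.
move: dA; rewrite mulf_eq0 negb_or => /andP[c30 ab].
move/eqP: a120; rewrite mulf_eq0 => /orP[] /eqP a0; subst.
  move: ab; rewrite mul0r sub0r oppr_eq0 mulf_eq0 negb_or => /andP[a20 b10].
  exists (true, (a2, b1), (c1, c2), c3); first by rewrite !inE a20 b10 c30.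
  move/eqP: b120; rewrite mulf_eq0 (negPf b10) /= => /eqP->.
  by [].
move: ab; rewrite mul0r subr0 mulf_eq0 negb_or => /andP[a10 b20].
exists (false, (a1, b2), (c1, c2), c3); first by rewrite !inE a10 b20 c30.
by move/eqP: b120; rewrite mulf_eq0 (negPf b20) orbF => /eqP->.
Qed.

Lemma mx3_forall (P : 'M[F]_3 -> Prop) :
  (forall a1 b1 c1 a2 b2 c2 a3 b3 c3, P (mx3 a1 b1 c1 a2 b2 c2 a3 b3 c3)) ->
  forall A, P A.
Proof. by move=> H A; rewrite [A]mx3_eta. Qed.

Definition line6 (x y : F) := mx3 x y 0 y 0 0 0 0 0.

(** The only point of rank one, (1, 0), must be fixed, which determines the first column up to a
    scalar. *)
Lemma card_stabilizer6 : #|stabilizer line6|%:R =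
  q * (q - 1) ^+ 2 * (q ^+ 3 - q ^+ 2).
Proof.
pose f (t : (F * F * F) * (F * F * F)) : 'M[F]_3 :=
  let: ((a1, b2, c3), (b1, c1, c2)) := t in mx3 a1 b1 c1 0 b2 c2 0 0 c3.
rewrite (card_stabilizer
  (D := setX (setX (setX nz nz) nz) [set: F * F * F]) (f := f)).
- rewrite !cardsX !cardsT !card_prod !natrM card_nz; ring.
- by move=> x y; rewrite /line6 !scalemx3 addmx3; congr mx3; ring.
- move=> [[[a1 b2] c3] [[b1 c1] c2]] [[[a1' b2'] c3'] [[b1' c1'] c2']] _ _.
  by move=> /mx3_inj[[-> -> ->] [[_ -> ->] [_ _ ->]]].
- move=> [[[a1 b2] c3] [[b1 c1] c2]] /[!inE] /= /[!andbT] /andP[/andP[a0 b0] c0].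
  rewrite /f det_mx3; split.
  + by rewrite (_ : _ + _ = a1 * b2 * c3) ?mulf_neq0 //; ring.
  + by exists (a1 ^+ 2), 0; rewrite congr_mx3; congr mx3; ring.
  by exists (2 * a1 * b1), (a1 * b2); rewrite congr_mx3; congr mx3; ring.
apply: mx3_forall => a1 b1 c1 a2 b2 c2 a3 b3 c3 dA [x [y]] + [x' [y']].
rewrite !congr_mx3 /line6 => /mx3_inj[[E11 E12 E13] [[_ E22 E23] [_ _ E33]]].
move=> /mx3_inj[[E11' E12' E13'] [[_ E22' E23'] [_ _ E33']]].
have a20 : a2 = 0 by apply/eqP; rewrite -sqrf_eq0; apply/eqP; rewrite -E22; ring.
have a30 : a3 = 0 by apply/eqP; rewrite -sqrf_eq0; apply/eqP; rewrite -E33; ring.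
have {}dA : a1 * (b2 * c3 - c2 * b3) != 0.
  by move: dA; rewrite det_mx3 a20 a30; apply: contra_neq => E; apply: etrans E; ring.
move: dA; rewrite mulf_eq0 negb_or => /andP[a10 bc].
have b30 : b3 = 0.
  by apply: (mulfI a10); rewrite mulr0; apply: etrans E13'; rewrite a30; ring.
move: bc; rewrite b30 mulr0 subr0 mulf_eq0 negb_or => /andP[b20 c30].
exists ((a1, b2, c3), (b1, c1, c2)); first by rewrite !inE a10 b20 c30.
by rewrite /f a20 a30 ?b30.
Qed.

Definition line8 (k x y : F) := mx3 x 0 0 0 y 0 0 0 (- (k * y)).

Definition nonisotropic (k : F) := [set t : F * F | t.1 ^+ 2 - k * t.2 ^+ 2 != 0].

(** The point of rank one is fixed, and the lower block is a similitude of the binary form y^2 - k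
    z^2: a first row (u, w) of nonzero value, and an orthogonal row fixed up to sign. The number of
    pairs (u, w) depends on whether k is a square and is left open here. *)
Lemma card_stabilizer8 k : k != 0 -> #|stabilizer (line8 k)|%:R =
  2 * (q - 1) * #|nonisotropic k|%:R.
Proof.
move=> k0.
pose f (t : F * bool * (F * F)) : 'M[F]_3 :=
  let: (a1, s, (u, w)) := t in
  mx3 a1 0 0 0 u w 0 (sgn s * k * w) (sgn s * u).
rewrite (card_stabilizer
  (D := setX (setX nz [set: bool]) (nonisotropic k)) (f := f)).
- rewrite !cardsX !cardsT card_bool !natrM card_nz; ring.
- by move=> x y; rewrite /line8 !scalemx3 addmx3; congr mx3; ring.
- move=> [[a1 s] [u w]] [[a1' s'] [u' w']].
  rewrite !inE /= !andbT => /andP[_ uw] /andP[_ _].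
  move=> /mx3_inj[[-> _ _] [[_ eu ew] [_ e1 e2]]]; subst u' w'.
  have [u0|u0] := eqVneq u 0; last by rewrite (sgn_inj u0 e2).
  have kw0 : k * w != 0.
    rewrite mulf_neq0 //; apply: contra_neq uw => w0.
    by rewrite u0 w0 /= !expr0n mulr0 subr0.
  by rewrite -!mulrA in e1; rewrite (sgn_inj kw0 e1).
- move=> [[a1 s] [u w]] /[!inE] /= /[!andbT] /andP[a0 uw].
  have S := sgnK s; rewrite /f det_mx3; split.
  + rewrite (_ : _ + _ = a1 * sgn s * (u ^+ 2 - k * w ^+ 2)); last by ring.
    by rewrite !mulf_neq0 // sgn_neq0.
  + by exists (a1 ^+ 2), 0; rewrite congr_mx3; congr mx3; ring.
  exists 0, (u ^+ 2 - k * w ^+ 2); rewrite congr_mx3; congr mx3; try ring.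
  transitivity (- (k * (u ^+ 2 - k * w ^+ 2)) * (sgn s * sgn s)); first by ring.
  by rewrite S mulr1.
apply: mx3_forall => a1 b1 c1 a2 b2 c2 a3 b3 c3 dA [x [y]] + [x' [y']].
rewrite !congr_mx3 /line8 => /mx3_inj[[E11 E12 E13] [[_ E22 E23] [_ _ E33]]].
move=> /mx3_inj[[E11' E12' E13'] [[_ E22' E23'] [_ _ E33']]].
have a120 : a1 * a2 = 0 by rewrite -E12; ring.
have a130 : a1 * a3 = 0 by rewrite -E13; ring.
have a230 : a2 * a3 = 0 by rewrite -E23; ring.
have a33 : a3 ^+ 2 = - k * a2 ^+ 2.
  by apply: (lin_eq E33); rewrite -E22; ring.
have a20 : a2 = 0.
  apply/eqP/negPn/negP => a20; move/eqP: a230; rewrite mulf_eq0 (negPf a20) /=.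
  move=> /eqP a30; move/eqP: a33; rewrite a30 expr0n eq_sym mulf_eq0 oppr_eq0.
  by rewrite (negPf k0) sqrf_eq0 (negPf a20).
have a30 : a3 = 0 by apply/eqP; rewrite -sqrf_eq0 a33 a20 expr0n mulr0.
have {}dA : a1 * (b2 * c3 - c2 * b3) != 0.
  by move: dA; rewrite det_mx3 a20 a30; apply: contra_neq => E; apply: etrans E; ring.
move: dA; rewrite mulf_eq0 negb_or => /andP[a10 bc].
have e12 : b1 * b2 - k * (c1 * c2) = 0 by rewrite -E12'; ring.
have e13 : b1 * b3 - k * (c1 * c3) = 0 by rewrite -E13'; ring.
have b10 : b1 = 0.
  apply: (mulIf bc); rewrite mul0r.
  transitivity ((b1 * b2 - k * (c1 * c2)) * c3 - (b1 * b3 - k * (c1 * c3)) * c2).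
    by ring.
  by rewrite e12 e13 !mul0r subr0.
have c10 : c1 = 0.
  apply: (mulfI k0); apply: (mulIf bc); rewrite mulr0 mul0r.
  transitivity ((b1 * b2 - k * (c1 * c2)) * b3 - (b1 * b3 - k * (c1 * c3)) * b2).
    by ring.
  by rewrite e12 e13 !mul0r subr0.
have e23 : b2 * b3 = k * (c2 * c3) by apply: (lin_eq E23'); ring.
have e33 : b3 ^+ 2 - k * c3 ^+ 2 = - k * (b2 ^+ 2 - k * c2 ^+ 2).
  by apply: (lin_eq E33'); rewrite -E22'; ring.
(* Orthogonality makes the last row a multiple of (k c2, b2); comparing values will give l^2 = 1. *)
have [l [El1 El2]] : exists l, b3 = l * (k * c2) /\ c3 = l * b2.
  have [b20|b20] := eqVneq b2 0; last first.
    exists (c3 / b2); rewrite mulfVK //; split=> //.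
    by apply: (mulfI b20); rewrite e23; field.
  have c20 : c2 != 0 by apply: contra_neq bc => c20; rewrite b20 c20; ring.
  exists (b3 / (k * c2)); rewrite b20 mulr0 mulfVK ?mulf_neq0 //; split=> //.
  apply/eqP; move/eqP: e23; rewrite b20 mul0r eq_sym !mulf_eq0.
  by rewrite (negPf k0) (negPf c20).
have N0 : b2 ^+ 2 - k * c2 ^+ 2 != 0.
  apply: contra_neq bc => N0; rewrite El1 El2.
  by rewrite -[RHS](mulr0 l) -N0; ring.
have /sqrt_sgn[s Es] : l ^+ 2 = 1 ^+ 2.
  apply: (mulIf (mulf_neq0 k0 N0)); move: e33; rewrite El1 El2 => e33.
  by apply: (lin_eq (esym e33)); ring.
exists (a1, s, (b2, c2)); first by rewrite !inE /= a10 N0.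
by rewrite /f a20 a30 b10 c10 El1 El2 Es mulr1 !mulrA.
Qed.

Definition line9 (x y : F) := mx3 x 0 y 0 y 0 y 0 0.

(** Fixing the only point of rank one and the zero last diagonal entry make A upper triangular. The
    vanishing (0, 1) entry and the equality of the (0, 2) and (1, 1) entries then determine the
    lower part of the last column. *)
Lemma card_stabilizer9 : #|stabilizer line9|%:R = q ^+ 2 * (q - 1) ^+ 2.
Proof.
pose f (t : (F * F) * (F * F)) : 'M[F]_3 :=
  let: ((a, m), (b, e)) := t in mx3 a b e 0 m (- (b * m) / a) 0 0 (m ^+ 2 / a).
rewrite (card_stabilizer (D := setX (setX nz nz) [set: F * F]) (f := f)).
- rewrite !cardsX !cardsT !card_prod !natrM card_nz; ring.
- by move=> x y; rewrite /line9 !scalemx3 addmx3; congr mx3; ring.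
- move=> [[a m] [b e]] [[a' m'] [b' e']] _ _.
  by move=> /mx3_inj[[-> -> ->] [[_ -> _] _]].
- move=> [[a m] [b e]] /[!inE] /= /[!andbT] /andP[a0 m0].
  rewrite /f det_mx3; split.
  + by rewrite (_ : _ + _ = m ^+ 3) ?expf_neq0 //; field.
  + by exists (a ^+ 2), 0; rewrite congr_mx3; congr mx3; ring.
  exists (2 * a * e + b ^+ 2), (m ^+ 2); rewrite congr_mx3.
  by congr mx3; field.
apply: mx3_forall => a1 b1 c1 a2 b2 c2 a3 b3 c3 dA [x [y]] + [x' [y']].
rewrite !congr_mx3 /line9 => /mx3_inj[[E11 E12 E13] [[_ E22 E23] [_ _ E33]]].
move=> /mx3_inj[[E11' E12' E13'] [[_ E22' E23'] [_ _ E33']]].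
have a30 : a3 = 0 by apply/eqP; rewrite -sqrf_eq0; apply/eqP; rewrite -E33; ring.
have a20 : a2 = 0.
  apply/eqP; rewrite -sqrf_eq0; apply/eqP; apply: (lin_eq E22).
  by rewrite -E13 a30; ring.
have {}dA : a1 * (b2 * c3 - c2 * b3) != 0.
  by move: dA; rewrite det_mx3 a20 a30; apply: contra_neq => E; apply: etrans E; ring.
move: dA; rewrite mulf_eq0 negb_or => /andP[a10 bc].
have b30 : b3 = 0.
  apply/eqP; rewrite -sqrf_eq0; apply/eqP.
  by apply: (lin_eq E33'); rewrite a30; ring.
move: bc; rewrite b30 mulr0 subr0 mulf_eq0 negb_or => /andP[b20 c30].
exists ((a1, b2), (b1, c1)); first by rewrite !inE a10 b20.
rewrite /f a20 a30 ?b30; congr mx3; apply: (mulfI a10).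
  transitivity (- (b1 * b2)); last by field.
  by apply: (lin_eq E12'); rewrite a20; ring.
transitivity (b2 ^+ 2); last by field.
by apply: (lin_eq E13'); rewrite -E22' a20 a30 b30; ring.
Qed.

(** The case u = 0 of [rep_o10], to which [K_orbit_line10] reduces the general one. *)
Definition line10 (d x y : F) := mx3 (d * x) y 0 y x 0 0 0 0.

Definition nonzero_pairs := [set t : F * F | t != (0, 0)].

Lemma card_nonzero_pairs : #|nonzero_pairs|%:R = q ^+ 2 - 1 :> rat.
Proof.
rewrite cardsE (cardC1 (0, 0)) card_prod.
have := finNzRing_gt1 F; case: #|F| => // n _; rewrite mulSn /=.
by rewrite -[n.+1]addn1 !natrD natrM natrD; ring.
Qed.

(** The upper left block is multiplication by the nonzero element a1 + a2 sqrt d of F(sqrt d) in the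
    basis 1, sqrt d, preceded by conjugation when the sign is -1. *)
Lemma card_stabilizer10 d : ~~ square d -> #|stabilizer (line10 d)|%:R =
  2 * (q ^+ 2 - 1) * (q ^+ 3 - q ^+ 2).
Proof.
have two0 := two_neq0 q_odd.
move=> nd; have d0 := nonsquare_neq0 nd.
pose f (t : bool * (F * F) * (F * F) * F) : 'M[F]_3 :=
  let: (s, (a1, a2), (c1, c2), c3) := t in
  mx3 a1 (sgn s * d * a2) c1 a2 (sgn s * a1) c2 0 0 c3.
rewrite (card_stabilizer (D := setX (setX (setX [set: bool]
  nonzero_pairs) [set: F * F]) nz) (f := f)).
- rewrite !cardsX !cardsT !card_prod card_bool !natrM card_nz card_nonzero_pairs.
  ring.
- by move=> x y; rewrite /line10 !scalemx3 addmx3; congr mx3; ring.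
- move=> [[[s [a1 a2]] [c1 c2]] c3] [[[s' [a1' a2']] [c1' c2']] c3'].
  rewrite !inE /= !andbT => /andP[a0 _] _.
  move=> /mx3_inj[[e1 e2 ->] [[e3 e4 ->] [_ _ ->]]]; subst a1' a2'.
  have [a10|a10] := eqVneq a1 0; last by rewrite (sgn_inj a10 e4).
  have a20 : d * a2 != 0.
    by rewrite mulf_neq0 //; apply: contraNneq a0 => a20; rewrite a10 a20.
  by rewrite -!mulrA in e2; rewrite (sgn_inj a20 e2).
- move=> [[[s [a1 a2]] [c1 c2]] c3] /[!inE] /= /[!andbT] /andP[a0 c0].
  have S := sgnK s; rewrite /f det_mx3; split.
  + rewrite (_ : _ + _ = sgn s * c3 * (a1 ^+ 2 - d * a2 ^+ 2)); last by ring.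
    rewrite !mulf_neq0 ?sgn_neq0 //; rewrite norm_eq0 //.
  + exists (d * a2 ^+ 2 + (sgn s * sgn s) * a1 ^+ 2), (d * a1 * a2 * (1 + sgn s * sgn s)).
    rewrite congr_mx3; congr mx3; try ring.
    transitivity (d * (a1 ^+ 2 + (sgn s * sgn s) * d * a2 ^+ 2)); first by ring.
    by rewrite S; ring.
  exists (2 * sgn s * a1 * a2), (sgn s * (a1 ^+ 2 + d * a2 ^+ 2)).
  by rewrite congr_mx3; congr mx3; ring.
apply: mx3_forall => a1 b1 c1 a2 b2 c2 a3 b3 c3 dA [x [y]] + [x' [y']].
rewrite !congr_mx3 /line10 => /mx3_inj[[E11 E12 E13] [[_ E22 E23] [_ _ E33]]].
move=> /mx3_inj[[E11' E12' E13'] [[_ E22' E23'] [_ _ E33']]].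
have ab3 : a3 * b3 = 0 by apply: (mulfI two0); apply: (lin_eq E33'); ring.
have e33 : b3 ^+ 2 = - d * a3 ^+ 2 by apply: (lin_eq E33); ring.
have a30 : a3 = 0.
  apply/eqP/negPn/negP => a30; move/eqP: ab3; rewrite mulf_eq0 (negPf a30) /=.
  move=> /eqP b30; move/eqP: e33; rewrite b30 expr0n eq_sym mulf_eq0 oppr_eq0.
  by rewrite (negPf d0) sqrf_eq0 (negPf a30).
have b30 : b3 = 0 by apply/eqP; rewrite -sqrf_eq0 e33 a30 expr0n mulr0.
have {}dA : c3 * (a1 * b2 - a2 * b1) != 0.
  by move: dA; rewrite det_mx3 a30 b30; apply: contra_neq => E; apply: etrans E; ring.
move: dA; rewrite mulf_eq0 negb_or => /andP[c30 ab].
have e1 : d * a1 ^+ 2 + b1 ^+ 2 = d * (d * a2 ^+ 2 + b2 ^+ 2).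
  by apply: (lin_eq E11); rewrite -E22; ring.
have e2 : a1 * b1 = d * (a2 * b2).
  by apply: (mulfI two0); apply: (lin_eq E11'); rewrite -E22'; ring.
have [l [El1 El2]] : exists l, b1 = l * (d * a2) /\ b2 = l * a1.
  have [a10|a10] := eqVneq a1 0; last first.
    exists (b2 / a1); rewrite mulfVK //; split=> //.
    by apply: (mulfI a10); rewrite e2; field.
  have a20 : a2 != 0 by apply: contra_neq ab => a20; rewrite a10 a20; ring.
  exists (b1 / (d * a2)); rewrite a10 mulr0 mulfVK ?mulf_neq0 //; split=> //.
  apply/eqP; move/eqP: e2; rewrite a10 mul0r eq_sym !mulf_eq0.
  by rewrite (negPf d0) (negPf a20).
have N0 : a1 ^+ 2 - d * a2 ^+ 2 != 0.
  apply: contra_neq ab => N0; rewrite El1 El2.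
  by rewrite -[RHS](mulr0 l) -N0; ring.
have /sqrt_sgn[s Es] : l ^+ 2 = 1 ^+ 2.
  apply: (mulIf (mulf_neq0 d0 N0)); move: e1; rewrite El1 El2 => e1.
  by apply: (lin_eq (esym e1)); ring.
exists (s, (a1, a2), (c1, c2), c3).
  rewrite inE /= !inE /= c30 !andbT; apply: contra_neq N0 => -[-> ->].
  by rewrite !expr0n mulr0 subr0.
by rewrite /f a30 b30 El1 El2 Es mulr1 !mulrA.
Qed.

End Stabilizers5_to_10.

(** * Stabilizers of the lines o12, o13 and o16 *)

Section Stabilizers12_13_16.
Variable F : finFieldType.
Hypothesis q_odd : odd #|F|.
Local Notation q := (#|F|%:R : rat).
Local Notation nz := (nz F).

Definition gl2_pairs :=
  [set t : (F * F) * (F * F) | t.1.1 * t.2.2 - t.1.2 * t.2.1 != 0].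

Lemma card_gl2_pairs : #|gl2_pairs|%:R = (q ^+ 2 - 1) * (q ^+ 2 - q) :> rat.
Proof.
rewrite natr_card.
rewrite (eq_bigr (fun t : (F * F) * (F * F) =>
  (t.1.1 * t.2.2 - t.1.2 * t.2.1 != 0)%:R)); last by move=> t _; rewrite inE.
rewrite -(pair_bigA _ (fun u v : F * F => (u.1 * v.2 - u.2 * v.1 != 0)%:R)) /=.
transitivity (\sum_(u : F * F) (u != (0, 0))%:R * (q ^+ 2 - q) : rat).
  apply: eq_bigr => u _; rewrite natr_cardE.
  have [->|u0] := eqVneq u (0, 0).
    rewrite mul0r (_ : [set v | _] = set0) ?cards0 //.
    by apply/setP => v; rewrite !inE !mul0r subr0 eqxx.
  rewrite natr_cardsC card_prod natrM mul1r; congr (_ - _%:R).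
  have s_inj : injective (fun k : F => (k * u.1, k * u.2)).
    move=> k l [e1 e2]; have [u10|u10] := eqVneq u.1 0; last exact: (mulIf u10).
    apply: (mulIf _ e2); apply: contraNneq u0 => u20.
    by rewrite [u]surjective_pairing u10 u20.
  rewrite -[RHS](card_imset _ s_inj); apply: eq_card => v; rewrite inE subr_eq0.
  apply/eqP/imsetP => [E|[k _ ->] /=]; last by ring.
  have [u10|u10] := eqVneq u.1 0.
    have u20 : u.2 != 0.
      by apply: contraNneq u0 => u20; rewrite [u]surjective_pairing u10 u20.
    exists (v.2 / u.2) => //; rewrite [LHS]surjective_pairing mulfVK // u10 mulr0.
    by congr pair; apply: (mulfI u20); rewrite -E u10 mul0r mulr0.
  exists (v.1 / u.1) => //; rewrite [LHS]surjective_pairing mulfVK //.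
  by congr pair; apply: (mulfI u10); rewrite E; field.
rewrite sum_indicator -card_nonzero_pairs; congr (_ * _).
Qed.

Definition line12 (x y : F) := mx3 0 x 0 x 0 y 0 y 0.

(** The points are the symmetric products of e2 with the vectors of the plane spanned by e1 and e3;
    A preserves this plane and the direction of e2. *)
Lemma card_stabilizer12 : #|stabilizer line12|%:R =
  (q - 1) * ((q ^+ 2 - 1) * (q ^+ 2 - q)).
Proof.
pose f (t : F * ((F * F) * (F * F))) : 'M[F]_3 :=
  let: (b, ((a1, a3), (c1, c3))) := t in mx3 a1 0 c1 0 b 0 a3 0 c3.
rewrite (card_stabilizer (D := setX nz gl2_pairs) (f := f)).
- by rewrite cardsX natrM card_nz card_gl2_pairs.
- by move=> x y; rewrite /line12 !scalemx3 addmx3; congr mx3; ring.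
- move=> [b [[a1 a3] [c1 c3]]] [b' [[a1' a3'] [c1' c3']]] _ _.
  by move=> /mx3_inj[[-> _ ->] [[_ -> _] [-> _ ->]]].
- move=> [b [[a1 a3] [c1 c3]]] /[!inE] /= /andP[b0 ac].
  rewrite /f det_mx3; split.
  + rewrite (_ : _ + _ = b * (a1 * c3 - a3 * c1)) ?mulf_neq0 //; ring.
  + by exists (a1 * b), (b * a3); rewrite congr_mx3; congr mx3; ring.
  by exists (b * c1), (b * c3); rewrite congr_mx3; congr mx3; ring.
have two0 := two_neq0 q_odd.
apply: mx3_forall => a1 b1 c1 a2 b2 c2 a3 b3 c3 dA [x [y]] + [x' [y']].
rewrite !congr_mx3 /line12 => /mx3_inj[[E11 E12 E13] [[_ E22 E23] [_ _ E33]]].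
move=> /mx3_inj[[E11' E12' E13'] [[_ E22' E23'] [_ _ E33']]].
have a11 : a1 * b1 = 0 by apply: (mulfI two0); apply: (lin_eq E11); ring.
have a22 : a2 * b2 = 0 by apply: (mulfI two0); apply: (lin_eq E22); ring.
have a33 : a3 * b3 = 0 by apply: (mulfI two0); apply: (lin_eq E33); ring.
have c11 : b1 * c1 = 0 by apply: (mulfI two0); apply: (lin_eq E11'); ring.
have c22 : b2 * c2 = 0 by apply: (mulfI two0); apply: (lin_eq E22'); ring.
have c33 : b3 * c3 = 0 by apply: (mulfI two0); apply: (lin_eq E33'); ring.
have a13 : a1 * b3 + a3 * b1 = 0 by apply: (lin_eq E13); ring.
have c13 : b1 * c3 + b3 * c1 = 0 by apply: (lin_eq E13'); ring.
have dE : b2 * (a1 * c3 - a3 * c1) - b1 * (a2 * c3 - c2 * a3)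
          - b3 * (a1 * c2 - c1 * a2) != 0.
  by move: dA; rewrite det_mx3; apply: contra_neq => E; apply: etrans E; ring.
have b10 : b1 = 0.
  apply/eqP/negPn/negP => b10.
  have a10 : a1 = 0 by apply: (mulIf b10); rewrite a11 mul0r.
  have c10 : c1 = 0 by apply: (mulfI b10); rewrite c11 mulr0.
  have a30 : a3 = 0.
    by apply: (mulIf b10); rewrite mul0r -a13 a10 mul0r add0r.
  have c30 : c3 = 0.
    by apply: (mulfI b10); rewrite mulr0 -c13 c10 mulr0 addr0.
  by case/eqP: dE; rewrite a10 c10 a30 c30; ring.
have b30 : b3 = 0.
  apply/eqP/negPn/negP => b30.
  have a30 : a3 = 0 by apply: (mulIf b30); rewrite a33 mul0r.
  have c30 : c3 = 0 by apply: (mulfI b30); rewrite c33 mulr0.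
  have a10 : a1 = 0.
    by apply: (mulIf b30); rewrite mul0r -a13 a30 mul0r addr0.
  have c10 : c1 = 0.
    by apply: (mulfI b30); rewrite mulr0 -c13 c30 mulr0 add0r.
  by case/eqP: dE; rewrite a10 c10 a30 c30; ring.
have {}dE : b2 * (a1 * c3 - a3 * c1) != 0.
  by apply: contra_neq dE => E; rewrite E b10 b30 !mul0r !subr0.
move: dE; rewrite mulf_eq0 negb_or => /andP[b20 ac].
exists (b2, ((a1, a3), (c1, c3))); first by rewrite !inE b20.
rewrite /f b10 b30; congr mx3.
  by apply: (mulIf b20); rewrite a22 mul0r.
by apply: (mulfI b20); rewrite c22 mulr0.
Qed.

Definition line13 (k x y : F) := mx3 0 x 0 x y 0 0 0 (- (k * y)).

(** The zero entries force A to be diagonal, and the ratio of the last two diagonal entries of the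
    image of (0, 1) leaves a sign. *)
Lemma card_stabilizer13 k : k != 0 -> #|stabilizer (line13 k)|%:R =
  2 * (q - 1) ^+ 2.
Proof.
move=> k0; pose f (t : F * F * bool) : 'M[F]_3 :=
  let: (a, m, s) := t in mx3 a 0 0 0 m 0 0 0 (sgn F s * m).
rewrite (card_stabilizer (D := setX (setX nz nz) [set: bool]) (f := f)).
- by rewrite !cardsX cardsT card_bool !natrM card_nz; ring.
- by move=> x y; rewrite /line13 !scalemx3 addmx3; congr mx3; ring.
- move=> [[a m] s] [[a' m'] s']; rewrite !inE !andbT /= => /andP[_ m0] _.
  move=> /mx3_inj[[<- _ _] [[_ <- _] [_ _ /sgn_inj-> //]]].
- move=> [[a m] s] /[!inE] /= /[!andbT] /andP[a0 m0].
  have S := sgnK F s; rewrite /f det_mx3; split.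
  + rewrite (_ : _ + _ = a * m * (sgn F s * m)); last by ring.
    by rewrite !mulf_neq0 ?sgn_neq0.
  + by exists (a * m), 0; rewrite congr_mx3; congr mx3; ring.
  exists 0, (m ^+ 2); rewrite congr_mx3; congr mx3; try ring.
  transitivity (- (k * m ^+ 2) * (sgn F s * sgn F s)); first by ring.
  by rewrite S mulr1.
have two0 := two_neq0 q_odd.
apply: mx3_forall => a1 b1 c1 a2 b2 c2 a3 b3 c3 dA [x [y]] + [x' [y']].
rewrite !congr_mx3 /line13 => /mx3_inj[[E11 E12 E13] [[_ E22 E23] [_ _ E33]]].
move=> /mx3_inj[[E11' E12' E13'] [[_ E22' E23'] [_ _ E33']]].
have ab11 : a1 * b1 = 0 by apply: (mulfI two0); apply: (lin_eq E11); ring.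
have ab13 : a1 * b3 + a3 * b1 = 0 by apply: (lin_eq E13); ring.
have ab23 : a2 * b3 + a3 * b2 = 0 by apply: (lin_eq E23); ring.
have ab33 : a3 * b3 = - k * (a2 * b2).
  by apply: (mulfI two0); apply: (lin_eq E33); rewrite -E22; ring.
have bc11 : b1 ^+ 2 = k * c1 ^+ 2 by apply: (lin_eq E11'); ring.
have bc13 : b1 * b3 = k * (c1 * c3) by apply: (lin_eq E13'); ring.
have bc23 : b2 * b3 = k * (c2 * c3) by apply: (lin_eq E23'); ring.
have bc33 : b3 ^+ 2 - k * c3 ^+ 2 = - k * (b2 ^+ 2 - k * c2 ^+ 2).
  by apply: (lin_eq E33'); rewrite -E22'; ring.
have dE : b2 * (a1 * c3 - a3 * c1) - b1 * (a2 * c3 - c2 * a3)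
          - b3 * (a1 * c2 - c1 * a2) != 0.
  by move: dA; rewrite det_mx3; apply: contra_neq => E; apply: etrans E; ring.
have b10 : b1 = 0.
  apply/eqP/negPn/negP => b10.
  have a10 : a1 = 0 by apply: (mulIf b10); rewrite ab11 mul0r.
  have a30 : a3 = 0 by apply: (mulIf b10); rewrite mul0r -ab13 a10 mul0r add0r.
  have c10 : c1 != 0.
    by apply: contra_neq b10 => c10; apply/eqP; rewrite -sqrf_eq0 bc11 c10 expr0n mulr0.
  have [a20|a20] := eqVneq a2 0.
    by case/eqP: dE; rewrite a10 a20 a30; ring.
  have b30 : b3 = 0.
    by apply: (mulfI a20); rewrite mulr0 -ab23 a30 mul0r addr0.
  have c30 : c3 = 0.
    by apply: (mulfI (mulf_neq0 k0 c10)); rewrite -mulrA -bc13 b30 !mulr0.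
  by case/eqP: dE; rewrite a30 b30 c30; ring.
have c10 : c1 = 0.
  apply/eqP; rewrite -sqrf_eq0; apply/eqP; apply: (mulfI k0).
  by rewrite -bc11 b10 expr0n mulr0.
have {}dE : a1 * (b2 * c3 - b3 * c2) != 0.
  by apply: contra_neq dE => E; rewrite -E b10 c10; ring.
move: dE; rewrite mulf_eq0 negb_or => /andP[a10 bc].
have b30 : b3 = 0 by apply: (mulfI a10); rewrite mulr0 -ab13 b10 mulr0 addr0.
have {}bc : b2 * c3 != 0 by apply: contra_neq bc => ->; rewrite b30 mul0r subr0.
move: bc; rewrite mulf_eq0 negb_or => /andP[b20 c30].
have a30 : a3 = 0 by apply: (mulIf b20); rewrite mul0r -ab23 b30 mulr0 add0r.
have a20 : a2 = 0.
  apply: (mulfI (mulf_neq0 k0 b20)); rewrite mulr0 -[RHS]oppr0.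
  by rewrite -[X in - X](mulr0 a3) -b30 ab33; ring.
have c20 : c2 = 0.
  by apply: (mulfI (mulf_neq0 k0 c30)); rewrite mulr0 -(mulr0 b2) -b30 bc23; ring.
have /sqrt_sgn[s Es] : c3 ^+ 2 = b2 ^+ 2.
  by apply: (mulfI k0); apply: (lin_eq (esym bc33)); rewrite b30 c20; ring.
exists (a1, b2, s); first by rewrite !inE a10 b20.
by rewrite /f b10 b30 c10 c20 a20 a30 Es.
Qed.

Definition line16 (x y : F) := mx3 0 0 x 0 x y x y 0.

Lemma card_stabilizer16 : #|stabilizer line16|%:R = q * (q - 1) ^+ 2.
Proof.
(* The (1, 1) and (0, 2) entries agree on the line, whence the corner b^2 / c. *)
pose f (t : F * F * F) : 'M[F]_3 :=
  let: (b, c, a) := t in mx3 (b ^+ 2 / c) 0 0 a b 0 0 0 c.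
rewrite (card_stabilizer (D := setX (setX nz nz) [set: F]) (f := f)).
- by rewrite !cardsX cardsT !natrM card_nz; ring.
- by move=> x y; rewrite /line16 !scalemx3 addmx3; congr mx3; ring.
- move=> [[b c] a] [[b' c'] a'] _ _.
  by move=> /mx3_inj[_ [[-> -> _] [_ _ ->]]].
- move=> [[b c] a] /[!inE] /= /[!andbT] /andP[b0 c0].
  rewrite /f det_mx3; split.
  + by rewrite (_ : _ + _ = b ^+ 3) ?expf_neq0 //; field.
  + by exists (b ^+ 2), (a * c); rewrite congr_mx3; congr mx3; field.
  by exists 0, (b * c); rewrite congr_mx3; congr mx3; field.
have two0 := two_neq0 q_odd.
apply: mx3_forall => a1 b1 c1 a2 b2 c2 a3 b3 c3 dA [x [y]] + [x' [y']].
rewrite !congr_mx3 /line16 => /mx3_inj[[E11 E12 E13] [[_ E22 E23] [_ _ E33]]].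
move=> /mx3_inj[[E11' E12' E13'] [[_ E22' E23'] [_ _ E33']]].
have bc11 : b1 * c1 = 0 by apply: (mulfI two0); apply: (lin_eq E11'); ring.
have bc12 : b1 * c2 + c1 * b2 = 0 by apply: (lin_eq E12'); ring.
have bc33 : b3 * c3 = 0 by apply: (mulfI two0); apply: (lin_eq E33'); ring.
have bc22 : 2 * b2 * c2 = b1 * c3 + c1 * b3.
  by apply: (lin_eq E22'); rewrite -E13'; ring.
have ab11 : 2 * a1 * c1 + b1 ^+ 2 = 0 by apply: (lin_eq E11); ring.
have ab12 : a1 * c2 + c1 * a2 + b1 * b2 = 0 by apply: (lin_eq E12); ring.
have ab33 : 2 * a3 * c3 + b3 ^+ 2 = 0 by apply: (lin_eq E33); ring.
have ab22 : 2 * a2 * c2 + b2 ^+ 2 = a1 * c3 + c1 * a3 + b1 * b3.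
  by apply: (lin_eq E22); rewrite -E13; ring.
have dE : b2 * (a1 * c3 - a3 * c1) - b1 * (a2 * c3 - c2 * a3)
          - b3 * (a1 * c2 - c1 * a2) != 0.
  by move: dA; rewrite det_mx3; apply: contra_neq => E; apply: etrans E; ring.
have c10 : c1 = 0.
  apply/eqP/negPn/negP => c10.
  have b10 : b1 = 0 by apply: (mulIf c10); rewrite bc11 mul0r.
  have b20 : b2 = 0 by apply: (mulfI c10); rewrite mulr0 -bc12 b10 mul0r add0r.
  have b30 : b3 = 0.
    by apply: (mulfI c10); apply: (lin_eq (esym bc22)); rewrite b10 b20; ring.
  by case/eqP: dE; rewrite b10 b20 b30; ring.
have b10 : b1 = 0.
  by apply/eqP; rewrite -sqrf_eq0; apply/eqP; rewrite -ab11 c10; ring.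
have {}dE : a1 * (b2 * c3 - b3 * c2) != 0.
  by apply: contra_neq dE => E; rewrite -E b10 c10; ring.
move: dE; rewrite mulf_eq0 negb_or => /andP[a10 bc].
have c20 : c2 = 0.
  by apply: (mulfI a10); rewrite mulr0 -ab12 b10 c10; ring.
have {}bc : b2 * c3 != 0 by apply: contra_neq bc => ->; rewrite c20 mulr0 subr0.
move: bc; rewrite mulf_eq0 negb_or => /andP[b20 c30].
have b30 : b3 = 0 by apply: (mulIf c30); rewrite mul0r.
have a30 : a3 = 0.
  by apply: (mulIf (mulf_neq0 two0 c30)); apply: (lin_eq ab33); rewrite b30; ring.
exists (b2, c3, a2); first by rewrite !inE b20 c30.
rewrite /f b10 b30 c10 c20 a30; congr mx3; apply: (mulIf c30).
rewrite mulfVK //; apply: (lin_eq (esym ab22)); rewrite b10 c10 c20; ring.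
Qed.

End Stabilizers12_13_16.

(** * Stabilizers of the lines o14: monomial matrices *)

Section Stabilizer14.
Variable F : finFieldType.
Hypothesis q_odd : odd #|F|.
Local Notation q := (#|F|%:R : rat).
Local Notation nz := (nz F).
Local Notation sgn := (sgn F).

Definition line14 (k x y : F) := mx3 x 0 0 0 (- (k * (x + y))) 0 0 0 y.

(* Of the diagonal entries x, - k (x + y), y of the line only the middle one
   carries the coefficient k; j is the row to which the matrix moves it. *)
Definition monomial (j : 'I_3) (e : bool) (a b c : F) :=
  match nat_of_ord j with
  | 0 => if e then mx3 0 b 0 a 0 0 0 0 c else mx3 0 b 0 0 0 c a 0 0
  | 1 => if e then mx3 a 0 0 0 b 0 0 0 c else mx3 0 0 c 0 b 0 a 0 0
  | _ => if e then mx3 a 0 0 0 0 c 0 b 0 else mx3 0 0 c a 0 0 0 b 0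
  end.

(** If a1 a2 != 0, the first two entries of all three columns are nonzero. Then either the third row
    vanishes, or the columns a and c agree up to a common sign; both contradict invertibility. *)
Lemma orthogonal_columns (k a1 b1 c1 a2 b2 c2 a3 b3 c3 : F) : k != 0 ->
  a1 * (b2 * c3 - c2 * b3) - b1 * (a2 * c3 - c2 * a3)
    + c1 * (a2 * b3 - b2 * a3) != 0 ->
  a1 * a2 = k * (b1 * b2) -> a1 * a3 = k * (b1 * b3) -> a2 * a3 = k * (b2 * b3) ->
  a1 * a2 = c1 * c2 -> a1 * a3 = c1 * c3 -> a2 * a3 = c2 * c3 ->
  a1 * a2 = 0.
Proof.
move=> k0 dA ab12 ab13 ab23 ac12 ac13 ac23; apply/eqP/negPn/negP => a12.
move: (a12); rewrite mulf_eq0 negb_or => /andP[a10 a20].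
move: (a12); rewrite ac12 mulf_eq0 negb_or => /andP[c10 c20].
move: (a12); rewrite ab12 !mulf_eq0 !negb_or => /and3P[_ b10 b20].
have [a30|a30] := eqVneq a3 0.
  have b30 : b3 = 0.
    by apply: (mulfI (mulf_neq0 k0 b10)); rewrite mulr0 -mulrA -ab13 a30 mulr0.
  have c30 : c3 = 0 by apply: (mulfI c10); rewrite mulr0 -ac13 a30 mulr0.
  by case/eqP: dA; rewrite a30 b30 c30; ring.
have c30 : c3 != 0.
  by apply: contra_neq (mulf_neq0 a10 a30) => c30; rewrite ac13 c30 mulr0.
have /sqrt_sgn[s Es] : a1 ^+ 2 = c1 ^+ 2.
  apply: (mulIf (mulf_neq0 a20 a30)).
  transitivity ((a1 * a2) * (a1 * a3)); first by ring.
  by rewrite {1}ac12 ac13 ac23; ring.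
have S := sgnK F s.
have Es2 : a2 = sgn s * c2.
  by apply: (mulfI a10); rewrite ac12 Es -[LHS]mul1r -S; ring.
have Es3 : a3 = sgn s * c3.
  by apply: (mulfI a10); rewrite ac13 Es -[LHS]mul1r -S; ring.
by case/eqP: dA; rewrite Es Es2 Es3; ring.
Qed.

Lemma single_nonzero (x y z : F) : x * y = 0 -> x * z = 0 -> y * z = 0 ->
  [\/ y = 0 /\ z = 0, x = 0 /\ z = 0 | x = 0 /\ y = 0].
Proof.
move=> /eqP; rewrite mulf_eq0 => /orP[]/eqP->; rewrite ?mul0r => + /eqP.
  move=> _; rewrite mulf_eq0 => /orP[]/eqP->; [exact: Or33|exact: Or32].
by move=> /eqP + _; rewrite mulf_eq0 => /orP[]/eqP->; [exact: Or33|exact: Or31].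
Qed.

Lemma orthogonal_columns_monomial (k a1 b1 c1 a2 b2 c2 a3 b3 c3 : F) : k != 0 ->
  \det (mx3 a1 b1 c1 a2 b2 c2 a3 b3 c3) != 0 ->
  a1 * a2 = k * (b1 * b2) -> a1 * a3 = k * (b1 * b3) -> a2 * a3 = k * (b2 * b3) ->
  a1 * a2 = c1 * c2 -> a1 * a3 = c1 * c3 -> a2 * a3 = c2 * c3 ->
  exists j e a b c, [/\ a != 0, b != 0, c != 0 &
    mx3 a1 b1 c1 a2 b2 c2 a3 b3 c3 = monomial j e a b c].
Proof.
rewrite det_mx3 => k0 dA ab12 ab13 ab23 ac12 ac13 ac23.
have a12 := orthogonal_columns k0 dA ab12 ab13 ab23 ac12 ac13 ac23.
have a13 : a1 * a3 = 0.
  apply: (@orthogonal_columns k a1 b1 c1 a3 b3 c3 a2 b2 c2) => //.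
  - by apply: contra_neq dA => E; apply: oppr_inj; rewrite oppr0; apply: etrans E; ring.
  - by apply: (lin_eq ab23); ring.
  - by apply: (lin_eq ac23); ring.
have a23 : a2 * a3 = 0.
  apply: (@orthogonal_columns k a2 b2 c2 a3 b3 c3 a1 b1 c1) => //.
  - by apply: contra_neq dA => E; apply: etrans E; ring.
  - by apply: (lin_eq ab12); ring.
  - by apply: (lin_eq ab13); ring.
  - by apply: (lin_eq ac12); ring.
  - by apply: (lin_eq ac13); ring.
have B x y : k * (x * y) = 0 -> x * y = 0.
  by move=> E; apply: (mulfI k0); rewrite E mulr0.
have b12 : b1 * b2 = 0 by apply: B; rewrite -ab12.
have b13 : b1 * b3 = 0 by apply: B; rewrite -ab13.
have b23 : b2 * b3 = 0 by apply: B; rewrite -ab23.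
rewrite ac12 in a12; rewrite ac13 in a13; rewrite ac23 in a23.
have A12 := ac12; have A13 := ac13; have A23 := ac23.
rewrite a12 in A12; rewrite a13 in A13; rewrite a23 in A23.
have nz3 (x y z : F) : x * y * z != 0 -> [/\ x != 0, y != 0 & z != 0].
  by rewrite !mulf_eq0 !negb_or -andbA => /and3P.
(* Each column has at most one nonzero entry. Of the 27 placements, the 21 that are not permutations
   give determinant zero. *)
case: (single_nonzero A12 A13 A23) => -[E1 E2];
case: (single_nonzero b12 b13 b23) => -[E3 E4];
case: (single_nonzero a12 a13 a23) => -[E5 E6]; subst;
  try by case/eqP: dA; ring.
- exists 1, true, a1, b2, c3.
  have [? ? ?] : [/\ a1 != 0, b2 != 0 & c3 != 0]; last by split.
    by apply: nz3; apply: contra_neq dA => E; apply: etrans E; ring.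
- exists 2, true, a1, b3, c2.
  have [? ? ?] : [/\ a1 != 0, b3 != 0 & c2 != 0]; last by split.
    by apply: nz3; apply: contra_neq dA => E; apply: oppr_inj; rewrite oppr0; apply: etrans E; ring.
- exists 0, true, a2, b1, c3.
  have [? ? ?] : [/\ a2 != 0, b1 != 0 & c3 != 0]; last by split.
    by apply: nz3; apply: contra_neq dA => E; apply: oppr_inj; rewrite oppr0; apply: etrans E; ring.
- exists 2, false, a2, b3, c1.
  have [? ? ?] : [/\ a2 != 0, b3 != 0 & c1 != 0]; last by split.
    by apply: nz3; apply: contra_neq dA => E; apply: etrans E; ring.
- exists 0, false, a3, b1, c2.
  have [? ? ?] : [/\ a3 != 0, b1 != 0 & c2 != 0]; last by split.
    by apply: nz3; apply: contra_neq dA => E; apply: etrans E; ring.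
- exists 1, false, a3, b2, c1.
  have [? ? ?] : [/\ a3 != 0, b2 != 0 & c1 != 0]; last by split.
    by apply: nz3; apply: contra_neq dA => E; apply: oppr_inj; rewrite oppr0; apply: etrans E; ring.
Qed.

Lemma line14_lin k (x y : F) :
  line14 k x y = x *: line14 k 1 0 + y *: line14 k 0 1.
Proof. by rewrite /line14 !scalemx3 addmx3; congr mx3; ring. Qed.

(** The equation of the line in the plane of diagonal matrices. *)
Lemma line14_weight k (x y m1 m12 m13 m21 m2 m23 m31 m32 m3 : F) :
  mx3 m1 m12 m13 m21 m2 m23 m31 m32 m3 = line14 k x y -> k * m1 + m2 + k * m3 = 0.
Proof. by move=> /mx3_inj[[-> _ _] [[_ -> _] [_ _ ->]]]; ring. Qed.

(** A monomial matrix acts on diagonal matrices through the squares of its entries, followed by a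
    permutation. *)
Lemma monomial_congr j e (a b c s1 s2 s3 : F) :
  monomial j e a b c *m mx3 s1 0 0 0 s2 0 0 0 s3 *m (monomial j e a b c)^T =
  monomial j e 1 1 1 *m
    mx3 (s1 * a ^+ 2) 0 0 0 (s2 * b ^+ 2) 0 0 0 (s3 * c ^+ 2) *m
    (monomial j e 1 1 1)^T.
Proof.
by rewrite /monomial; case: (nat_of_ord j) => [|[|?]]; case: e;
  rewrite !congr_mx3; congr mx3; ring.
Qed.

Lemma monomial_stabP j e (k a b c : F) : k = 1 \/ ~~ square k ->
  a != 0 -> b != 0 -> c != 0 ->
  maps_into (line14 k) (line14 k 1 0) (monomial j e a b c) ->
  maps_into (line14 k) (line14 k 0 1) (monomial j e a b c) ->
  [/\ a ^+ 2 = b ^+ 2, a ^+ 2 = c ^+ 2 & k = 1 \/ j = 1].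
Proof.
move=> kP a0 b0 c0.
have diagE (s1 s2 s3 x y : F) :
  monomial j e 1 1 1 *m mx3 s1 0 0 0 s2 0 0 0 s3 *m (monomial j e 1 1 1)^T
    = line14 k x y ->
  match nat_of_ord j with
  | 0 => if e then k * s2 + s1 + k * s3 = 0 else k * s2 + s3 + k * s1 = 0
  | 1 => k * s1 + s2 + k * s3 = 0
  | _ => if e then k * s1 + s3 + k * s2 = 0 else k * s3 + s1 + k * s2 = 0
  end.
  by rewrite /monomial; case: (nat_of_ord j) => [|[|?]]; case: e;
    rewrite congr_mx3 => /line14_weight E; apply: etrans E; ring.
move=> [x [y]]; rewrite {1}/line14 monomial_congr => /diagE E1.
move=> [x' [y']]; rewrite {1}/line14 monomial_congr => /diagE E2.
have sqk u : u ^+ 2 = k * b ^+ 2 -> k = 1.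
  move=> E; case: kP => // /negP[]; apply/squareP; exists (u / b).
  by rewrite exprMn E exprVn mulfK ?expf_neq0.
have k0 : k != 0.
  by case: kP => [->|/nonsquare_neq0//]; rewrite oner_eq0.
have [j1|j1] := eqVneq (nat_of_ord j) 1%N.
  move: E1 E2; rewrite j1 => E1 E2.
  have ab : a ^+ 2 = b ^+ 2 by apply: (mulfI k0); apply: (lin_eq E1); ring.
  split=> //; last by right; apply: val_inj.
  by rewrite ab; apply: (mulfI k0); apply: (lin_eq (esym E2)); ring.
have k1 : k = 1.
  move: E1 E2 j1; clear diagE; case: (nat_of_ord j) => [|[|?]] //; case: e => E1 E2 _.
  - by apply: (sqk c); apply: (mulfI k0); apply: (lin_eq E2); ring.
  - by apply: (sqk a); apply: (mulfI k0); apply: (lin_eq E1); ring.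
  - by apply: (sqk a); apply: (mulfI k0); apply: (lin_eq E1); ring.
  by apply: (sqk c); apply: (mulfI k0); apply: (lin_eq E2); ring.
move: E1 E2; rewrite k1; clear diagE; case: (nat_of_ord j) => [|[|?]]; case: e => E1 E2;
  (split; [apply: (lin_eq E1); ring | | by left]);
  by apply: etrans (_ : b ^+ 2 = _); [apply: (lin_eq E1); ring
                                     |apply: (lin_eq (esym E2)); ring].
Qed.

Lemma monomial_maps j e (k a b c s1 s2 s3 : F) :
  a ^+ 2 = b ^+ 2 -> a ^+ 2 = c ^+ 2 -> k = 1 \/ j = 1 ->
  k * s1 + s2 + k * s3 = 0 ->
  maps_into (line14 k) (mx3 s1 0 0 0 s2 0 0 0 s3) (monomial j e a b c).
Proof.
move=> ab ac kj s123; rewrite /maps_into monomial_congr -ab -ac.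
have -> : s2 = - (k * (s1 + s3)) by apply: (lin_eq s123); ring.
move: (a ^+ 2) => t; case: kj => [->|->]; last first.
  by case: e; rewrite /monomial /=;
    [exists (s1 * t), (s3 * t)|exists (s3 * t), (s1 * t)];
    rewrite congr_mx3 /line14; congr mx3; ring.
pose u := - (s1 + s3).
by case: j => [[|[|[|//]]] lt]; case: e; rewrite /monomial /=;
  [ exists (u * t), (s3 * t) | exists (u * t), (s1 * t) | exists (s1 * t), (s3 * t)
  | exists (s3 * t), (s1 * t) | exists (s1 * t), (u * t) | exists (s3 * t), (u * t) ];
  rewrite congr_mx3 /line14 /u; congr mx3; ring.
Qed.

Lemma monomial_inj j e a b c j' e' a' b' c' :
  a != 0 -> b != 0 -> c != 0 ->
  monomial j e a b c = monomial j' e' a' b' c' ->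
  [/\ j = j', e = e', a = a', b = b' & c = c'].
Proof.
move=> a0 b0 c0; case: j => [[|[|[|//]]] lt]; case: j' => [[|[|[|//]]] lt'];
  case: e; case: e'; rewrite /monomial /= => /mx3_inj[[? ? ?] [[? ? ?] [? ? ?]]];
  subst; rewrite ?eqxx // in a0 b0 c0; split=> //; exact: val_inj.
Qed.

Lemma det_monomial j e (a b c : F) : a != 0 -> b != 0 -> c != 0 ->
  \det (monomial j e a b c) != 0.
Proof.
move=> a0 b0 c0; have abc : a * b * c != 0 by rewrite !mulf_neq0.
have Nabc : - (a * b * c) != 0 by rewrite oppr_eq0.
by rewrite /monomial; case: (nat_of_ord j) => [|[|?]]; case: e; rewrite det_mx3;
  [ move: Nabc | move: abc | move: abc | move: Nabc | move: Nabc | move: abc ];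
  apply: contra_neq => E; apply: etrans E; ring.
Qed.

(** J holds the admissible positions of the middle entry: all three for k = 1, one for a nonsquare
    k. The 8 counts the exchange of the other two entries and two signs. *)
Lemma card_stabilizer14 k (J : {set 'I_3}) : k = 1 \/ ~~ square k ->
  (forall j, (j \in J) <-> (k = 1 \/ j = 1)) ->
  #|stabilizer (line14 k)|%:R = #|J|%:R * 8 * (q - 1).
Proof.
move=> kP JP.
have k0 : k != 0.
  by case: kP => [->|/nonsquare_neq0//]; rewrite oner_eq0.
pose f (t : 'I_3 * (bool * bool * bool) * F) : 'M[F]_3 :=
  let: (j, (e, s, s'), a) := t in monomial j e a (sgn s * a) (sgn s' * a).
have sg s a : a != 0 -> sgn s * a != 0.
  by move=> a0; rewrite mulf_neq0 // sgn_neq0.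
rewrite (card_stabilizer (D := setX (setX J [set: bool * bool * bool]) nz) (f := f)).
- by rewrite !cardsX cardsT !card_prod card_bool !natrM card_nz; ring.
- exact: line14_lin.
- move=> [[j [[e s] s']] a] [[j' [[e' t] t']] a'].
  rewrite !inE !andbT /= => /andP[_ a0] /andP[_ a'0].
  case/monomial_inj => // [||-> -> Ea]; rewrite ?sg //; subst a'.
  by move=> /(sgn_inj q_odd a0)-> /(sgn_inj q_odd a0)->.
- move=> [[j [[e s] s']] a] /[!inE] /= /[!andbT] /andP[jJ a0].
  have sq s0 : a ^+ 2 = (sgn s0 * a) ^+ 2.
    by rewrite exprMn expr2 [sgn s0 ^+ 2]expr2 sgnK mul1r.
  split; first by apply: det_monomial; rewrite ?sg.
    by apply: monomial_maps => //; [apply/JP | ring].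
  by apply: monomial_maps => //; [apply/JP | ring].
apply: mx3_forall => a1 b1 c1 a2 b2 c2 a3 b3 c3 dA s1 s2.
case: (s1) => x [y]; case: (s2) => x' [y'].
rewrite /line14 !congr_mx3 => /mx3_inj[[_ E12' E13'] [[_ _ E23'] _]].
move=> /mx3_inj[[_ E12 E13] [[_ _ E23] _]].
have [||||||j [e [a [b [c [a0 b0 c0 E]]]]]] := orthogonal_columns_monomial k0 dA.
- by apply: (lin_eq E12); ring.
- by apply: (lin_eq E13); ring.
- by apply: (lin_eq E23); ring.
- by apply: (lin_eq (etrans E12 (esym E12'))); ring.
- by apply: (lin_eq (etrans E13 (esym E13'))); ring.
- by apply: (lin_eq (etrans E23 (esym E23'))); ring.
rewrite E in s1 s2 *.
have [ab ac kj] := monomial_stabP kP a0 b0 c0 s1 s2.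
have [s Es] := sqrt_sgn (esym ab); have [s' Es'] := sqrt_sgn (esym ac).
exists (j, (e, s, s'), a); last by rewrite /f -Es -Es'.
by rewrite !inE a0 !andbT /=; apply/JP.
Qed.

End Stabilizer14.

(** * Stabilizers of the lines o15 *)

Section Stabilizers15.
Variable F : finFieldType.
Hypothesis q_odd : odd #|F|.
Local Notation q := (#|F|%:R : rat).
Local Notation nz := (nz F).
Local Notation sgn := (sgn F).

(** The discriminant of v t^2 + u v t - 1; a square root of it would give a root. *)
Lemma quadratic_discriminant (u v : F) : quadratic_condition u v ->
  ~~ square (v * (u ^+ 2 * v + 4)).
Proof.
have two0 := two_neq0 q_odd.
move=> [v0 irr]; apply/negP => /squareP[s Es].
case/eqP: (irr ((- (u * v) + s) / (2 * v))).
transitivity ((s ^+ 2 - v * (u ^+ 2 * v + 4)) / (4 * v)).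
  by field; rewrite v0 two0 (_ : 4 = 2 * 2) ?mulf_neq0 //; ring.
by rewrite Es subrr mul0r.
Qed.

Definition line15 (u v x y : F) := mx3 (v * y) x 0 x (u * x + y) 0 0 0 x.

Lemma line15_lin u v x y :
  line15 u v x y = x *: line15 u v 1 0 + y *: line15 u v 0 1.
Proof. by rewrite /line15 !scalemx3 addmx3; congr mx3; ring. Qed.

(** A fixes the singular point diag(v, 1, 0), so its upper left block is a similitude of v X^2 +
    Y^2: the second row is orthogonal to (p, r) and determined up to a sign. The two remaining
    equations express that the image of (1, 0) lies on the line. *)
Lemma stabilizer15_block (u v : F) A : quadratic_condition u v ->
  \det A != 0 ->
  maps_into (line15 u v) (line15 u v 1 0) A ->
  maps_into (line15 u v) (line15 u v 0 1) A ->
  exists (p r : F) e (s : F), [/\ s != 0,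
    A = mx3 p r 0 (- (sgn e * r / v)) (sgn e * p) 0 0 0 s,
    sgn e * (v * p ^+ 2 - r ^+ 2 + u * v * r * p) = v * s ^+ 2 &
    u * v * p ^+ 2 - 4 * p * r - u * r ^+ 2 = u * v * s ^+ 2].
Proof.
have two0 := two_neq0 q_odd.
move=> [v0 irr]; move: A.
apply: mx3_forall => a1 b1 c1 a2 b2 c2 a3 b3 c3 dA [x [y]] + [x' [y']].
rewrite !congr_mx3 /line15 => /mx3_inj[[E11 E12 E13] [[_ E22 E23] [_ _ E33]]].
move=> /mx3_inj[[E11' E12' E13'] [[_ E22' E23'] [_ _ E33']]].
have e11 : v * a1 ^+ 2 + b1 ^+ 2 = v * y' by apply: (lin_eq E11'); ring.
have e12 : v * (a1 * a2) + b1 * b2 = x' by apply: (lin_eq E12'); ring.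
have e13 : v * (a1 * a3) + b1 * b3 = 0 by apply: (lin_eq E13'); ring.
have e22 : v * a2 ^+ 2 + b2 ^+ 2 = u * x' + y' by apply: (lin_eq E22'); ring.
have e23 : v * (a2 * a3) + b2 * b3 = 0 by apply: (lin_eq E23'); ring.
have e33 : v * a3 ^+ 2 + b3 ^+ 2 = x' by apply: (lin_eq E33'); ring.
(* The image of a singular point is singular, and the only one has x = 0. *)
have x'0 : x' = 0.
  have E : (v * a3 ^+ 2 + b3 ^+ 2) * ((v * a1 ^+ 2 + b1 ^+ 2) *
      (v * a2 ^+ 2 + b2 ^+ 2) - (v * (a1 * a2) + b1 * b2) ^+ 2) = 0.
    transitivity ((v * (a1 * a3) + b1 * b3) *
      ((v * (a1 * a3) + b1 * b3) * (v * a2 ^+ 2 + b2 ^+ 2)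
       - 2 * (v * (a1 * a2) + b1 * b2) * (v * (a2 * a3) + b2 * b3)) +
      (v * (a2 * a3) + b2 * b3) ^+ 2 * (v * a1 ^+ 2 + b1 ^+ 2)); first by ring.
    by rewrite e13 e23; ring.
  rewrite e11 e12 e22 e33 in E.
  apply/eqP/negPn/negP => x'0; case/eqP: (irr (y' / x')).
  apply: (mulfI (expf_neq0 3 x'0)); rewrite mulr0 -E; field; exact: x'0.
rewrite x'0 in e12 e22 e33; rewrite mulr0 add0r in e22.
have dE : c1 * (a2 * b3 - a3 * b2) - c2 * (a1 * b3 - a3 * b1)
          + c3 * (a1 * b2 - a2 * b1) != 0.
  by move: dA; rewrite det_mx3; apply: contra_neq => E; apply: etrans E; ring.
have a30 : a3 = 0.
  apply/eqP/negPn/negP => a30; case/eqP: dE; apply: (mulfI (mulf_neq0 v0 a30)).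
  transitivity (c1 * (b3 * (v * (a2 * a3) + b2 * b3) - b2 * (v * a3 ^+ 2 + b3 ^+ 2))
    - c2 * (b3 * (v * (a1 * a3) + b1 * b3) - b1 * (v * a3 ^+ 2 + b3 ^+ 2))
    + c3 * (b2 * (v * (a1 * a3) + b1 * b3) - b1 * (v * (a2 * a3) + b2 * b3))).
    by ring.
  by rewrite e13 e23 e33; ring.
have b30 : b3 = 0 by apply/eqP; rewrite -sqrf_eq0 -e33 a30 expr0n mulr0 add0r.
have {}dE : c3 * (a1 * b2 - a2 * b1) != 0.
  by apply: contra_neq dE => E; rewrite -E a30 b30; ring.
move: dE; rewrite mulf_eq0 negb_or => /andP[c30 ab].
have c10 : c1 = 0.
  by apply: (mulIf c30); apply: (lin_eq E13); rewrite a30 b30; ring.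
have c20 : c2 = 0.
  by apply: (mulIf c30); apply: (lin_eq E23); rewrite a30 b30; ring.
have [l [El1 El2]] : exists l, a2 = - (l * b1 / v) /\ b2 = l * a1.
  have [a10|a10] := eqVneq a1 0; last first.
    exists (b2 / a1); split; last by rewrite mulfVK.
    apply: (mulfI (mulf_neq0 v0 a10)); apply: (lin_eq e12); field.
    by rewrite v0 a10.
  have b10 : b1 != 0 by apply: contra_neq ab => b10; rewrite a10 b10; ring.
  exists (- (v * a2) / b1); split; first by field; rewrite b10 v0.
  by rewrite a10 mulr0; apply: (mulfI b10); apply: (lin_eq e12); rewrite a10; ring.
have N0 : v * a1 ^+ 2 + b1 ^+ 2 != 0.
  apply: contra_neq ab => N0; apply: (mulfI v0); rewrite El1 El2.
  by transitivity (l * (v * a1 ^+ 2 + b1 ^+ 2)); [field | rewrite N0; ring].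
have /sqrt_sgn[e Ee] : l ^+ 2 = 1 ^+ 2.
  apply: (mulIf N0); rewrite expr1n mul1r [RHS]e11 -e22 El1 El2; field; exact: v0.
rewrite mulr1 in Ee; subst l.
have S := sgnK F e.
have e33x : c3 ^+ 2 = x by apply: (lin_eq E33); rewrite a30 b30; ring.
exists a1, b1, e, c3; split=> //.
- by rewrite a30 b30 c10 c20 El1 El2.
- rewrite e33x; apply: (mulfI v0); rewrite -E12 El1 El2 c10 c20; field; exact: v0.
have f11 : 2 * a1 * b1 + u * b1 ^+ 2 = v * y.
  by apply: (lin_eq E11); rewrite c10; ring.
have f22 : (sgn e * sgn e) * (u * a1 ^+ 2 - 2 * a1 * b1 / v) = u * x + y.
  by apply: (lin_eq E22); rewrite El1 El2 c20; field.
rewrite S mul1r in f22.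
transitivity (v * (u * a1 ^+ 2 - 2 * a1 * b1 / v) - (2 * a1 * b1 + u * b1 ^+ 2)).
  by field.
by rewrite f22 f11 e33x; ring.
Qed.

(** For the sign +1 the equations give p r = 0, and both cases occur because - v = t^2. For the sign
    -1 they factor; one factor would make - (u^2 v + 4) a square, the other v (u^2 v + 4), and both
    are nonsquares here. *)
Lemma card_stabilizer15_square (u v : F) : quadratic_condition u v ->
  square (- v) -> #|stabilizer (line15 u v)|%:R = 4 * (q - 1).
Proof.
have two0 := two_neq0 q_odd.
move=> uv /squareP[t Et]; have := quadratic_discriminant uv.
have v0 : v != 0 by case: uv.
have t0 : t != 0.
  by apply: contra_neq v0 => t0; apply: oppr_inj; rewrite Et t0 expr0n oppr0.
have Ev : v = - t ^+ 2 by rewrite -Et opprK.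
move=> nD; have w0 : u ^+ 2 * v + 4 != 0.
  by apply: contraNneq nD => ->; rewrite mulr0 square0.
have nw : ~~ square (- (u ^+ 2 * v + 4)).
  apply: contra nD; rewrite -(square_mulr _ t0).
  by rewrite -Et mulNr mulrN opprK.
pose f (a : bool * bool * F) : 'M[F]_3 :=
  let: (k, e, s) := a in
  if k then mx3 (sgn e * s) 0 0 0 (sgn e * s) 0 0 0 s
  else mx3 0 (sgn e * s * t) 0 (sgn e * s / t) 0 0 0 0 s.
rewrite (card_stabilizer (D := setX [set: bool * bool] nz) (f := f)).
- by rewrite !cardsX !cardsT card_prod card_bool !natrM card_nz; ring.
- exact: line15_lin.
- move=> [[k e] s] [[k' e'] s']; rewrite !inE /= => s0 s'0.
  have sg i : sgn i * s != 0 by rewrite mulf_neq0 ?sgn_neq0.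
  have sg' i : sgn i * s' != 0 by rewrite mulf_neq0 ?sgn_neq0.
  case: k k' => [] [] /mx3_inj[[E1 E2 _] [_ [_ _ E3]]]; subst s'.
  + by rewrite (sgn_inj q_odd s0 E1).
  + by move: (sg e); rewrite E1 eqxx.
  + by move: (sg' e'); rewrite -E1 eqxx.
  by rewrite (sgn_inj q_odd s0 (mulIf t0 E2)).
- move=> [[k e] s] /[!inE] /= s0; have S := sgnK F e.
  have Sx x : (sgn e * sgn e) * x = x by rewrite S mul1r.
  case: k; rewrite /f det_mx3; split.
  + rewrite (_ : _ + _ = (sgn e * sgn e) * s ^+ 3); last by ring.
    by rewrite Sx expf_neq0.
  + exists (s ^+ 2), 0; rewrite -(Sx (s ^+ 2)) congr_mx3; congr mx3; try ring.
    by rewrite Sx; ring.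
  + exists 0, (s ^+ 2); rewrite -(Sx (s ^+ 2)) congr_mx3; congr mx3; by ring.
  + rewrite (_ : _ + _ = - ((sgn e * sgn e) * s ^+ 3)); last by field.
    by rewrite Sx oppr_eq0 expf_neq0.
  + exists (s ^+ 2), (- (u * s ^+ 2)); rewrite congr_mx3; congr mx3; try ring.
    * by rewrite Ev -(Sx (s ^+ 2)); ring.
    * by rewrite -(Sx (s ^+ 2)); field.
    * by rewrite -(Sx (s ^+ 2)); field.
  exists 0, (- (s ^+ 2)); rewrite congr_mx3; congr mx3; try ring.
  + by rewrite Ev -(Sx (s ^+ 2)); ring.
  by rewrite Ev -[in RHS](Sx (s ^+ 2)); field.
move=> A dA s1 s2; have [p [r [e [s [s0 -> e1 e2]]]]] := stabilizer15_block uv dA s1 s2.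
case: e e1 => /= e1.
  have : (u * v * p - 2 * r) * (2 * p + u * r) = 0.
    transitivity ((u * v * p ^+ 2 - 4 * p * r - u * r ^+ 2)
       - u * (-1 * (v * p ^+ 2 - r ^+ 2 + u * v * r * p))); first by ring.
    by rewrite e1 e2; ring.
  move/eqP; rewrite mulf_eq0 => /orP[] /eqP E.
    have Er : r = u * v * p / 2 by apply: (mulfI two0); apply: (lin_eq (esym E)); field.
    case/negP: nw; apply/squareP; exists (2 * s / p).
    have p0 : p != 0.
      apply: contra_neq s0 => p0; apply/eqP; rewrite -sqrf_eq0; apply/eqP.
      by apply: (mulfI v0); rewrite -e1 Er p0; ring.
    apply: (mulfI v0); apply: (mulfI (expf_neq0 2 p0)).
    transitivity (4 * (v * s ^+ 2)); last by field.
    by rewrite -e1 Er; field.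
  have Ep : p = - (u * r / 2) by apply: (mulfI two0); apply: (lin_eq E); field.
  case/negP: nD; apply/squareP; exists (2 * v * s / r).
  have r0 : r != 0.
    apply: contra_neq s0 => r0; apply/eqP; rewrite -sqrf_eq0; apply/eqP.
    by apply: (mulfI v0); rewrite -e1 Ep r0; ring.
  apply: (mulfI (expf_neq0 2 r0)).
  transitivity (4 * v * (v * s ^+ 2)); last by field.
  by rewrite -e1 Ep; field.
have : p * r = 0.
  apply: (mulfI w0); rewrite mulr0.
  transitivity (u * (1 * (v * p ^+ 2 - r ^+ 2 + u * v * r * p))
     - (u * v * p ^+ 2 - 4 * p * r - u * r ^+ 2)); first by ring.
  by rewrite e1 e2; ring.
move/eqP; rewrite mulf_eq0 => /orP[] /eqP E.
  have /sqrt_sgn[e Ee] : r ^+ 2 = (s * t) ^+ 2.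
    by rewrite exprMn -Et; apply: (lin_eq (esym e1)); rewrite E; ring.
  exists (false, e, s); first by rewrite !inE.
  rewrite /f E Ee Ev; congr mx3; try ring; field.
  by rewrite t0 oppr_eq0 expf_neq0.
have /sqrt_sgn[e Ee] : p ^+ 2 = s ^+ 2.
  by apply: (mulfI v0); apply: (lin_eq e1); rewrite E; ring.
exists (true, e, s); first by rewrite !inE.
by rewrite /f E Ee; congr mx3; ring.
Qed.

(** The solutions with p = 0 disappear, as they would make - v a square. In exchange - (u^2 v + 4)
    is now a square t^2, so that one factor for the sign -1 yields a second family. *)
Lemma card_stabilizer15_nonsquare (u v : F) : quadratic_condition u v ->
  ~~ square (- v) -> #|stabilizer (line15 u v)|%:R = 4 * (q - 1).
Proof.
have two0 := two_neq0 q_odd.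
move=> uv nv; have nD := quadratic_discriminant uv.
have v0 : v != 0 by case: uv.
have w0 : u ^+ 2 * v + 4 != 0.
  by apply: contraNneq nD => ->; rewrite mulr0 square0.
have [t Et] : exists t, - (u ^+ 2 * v + 4) = t ^+ 2.
  have /squareP[t Et] := square_mul_nonsquare q_odd nv nD.
  exists (t / v); apply: (mulfI (expf_neq0 2 v0)).
  by rewrite exprMn exprVn mulrCA divff ?expf_neq0 // mulr1 -Et; ring.
have t0 : t != 0.
  by apply: contra_neq w0 => t0; apply: oppr_inj; rewrite Et t0 expr0n oppr0.
pose f (a : bool * bool * F) : 'M[F]_3 :=
  let: (k, e, s) := a in
  if k then mx3 (sgn e * s) 0 0 0 (sgn e * s) 0 0 0 s
  else mx3 (sgn e * s * 2 / t) (sgn e * s * (u * v) / t) 0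
           (sgn e * s * u / t) (- (sgn e * s * 2 / t)) 0 0 0 s.
rewrite (card_stabilizer (D := setX [set: bool * bool] nz) (f := f)).
- by rewrite !cardsX !cardsT card_prod card_bool !natrM card_nz; ring.
- exact: line15_lin.
- move=> [[k e] s] [[k' e'] s']; rewrite !inE /= => s0 s'0.
  have sg i : sgn i * s != 0 by rewrite mulf_neq0 ?sgn_neq0.
  have dbl0 (x : F) : x = - x -> x = 0.
    by move=> E; apply: (mulfI two0); apply: (lin_eq E); ring.
  case: k k' => [] [] /mx3_inj[[E1 E2 _] [[_ E4 _] [_ _ E3]]]; subst s'.
  + by rewrite (sgn_inj q_odd s0 E1).
  + by move: (sg e); rewrite (dbl0 (sgn e * s)) ?eqxx // {2}E1 -E4.
  + by move: (sg e'); rewrite (dbl0 (sgn e' * s)) ?eqxx // -{1}E1 -E4 opprK.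
  have tt : 2 / t != 0 by rewrite mulf_neq0 ?invr_eq0.
  by rewrite -!mulrA in E1; rewrite (sgn_inj q_odd (mulf_neq0 s0 tt) E1).
- move=> [[k e] s] /[!inE] /= s0; have S := sgnK F e.
  have Sx x : (sgn e * sgn e) * x = x by rewrite S mul1r.
  have X0 : - (u ^+ 2 * v + 4) / t ^+ 2 = 1 by rewrite Et divff ?expf_neq0.
  case: k; rewrite /f det_mx3; split.
  + rewrite (_ : _ + _ = (sgn e * sgn e) * s ^+ 3); last by ring.
    by rewrite Sx expf_neq0.
  + exists (s ^+ 2), 0; rewrite -(Sx (s ^+ 2)) congr_mx3; congr mx3; try ring.
    by rewrite Sx; ring.
  + exists 0, (s ^+ 2); rewrite -(Sx (s ^+ 2)) congr_mx3; congr mx3; by ring.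
  + rewrite (_ : _ + _ = (sgn e * sgn e) * (s ^+ 3 * (- (u ^+ 2 * v + 4) / t ^+ 2)));
      last by field.
    by rewrite Sx X0 mulr1 expf_neq0.
  + have XE c : (sgn e * sgn e) * (s ^+ 2 * (c * (- (u ^+ 2 * v + 4) / t ^+ 2))) =
        s ^+ 2 * c by rewrite Sx X0 mulr1.
    exists (s ^+ 2), (- u * s ^+ 2); rewrite congr_mx3; congr mx3; try ring.
    * transitivity (s ^+ 2 * - (u * v)); last by ring.
      by rewrite -XE; field.
    * by rewrite -[RHS]mulr1 -XE; field.
    * by rewrite -[RHS]mulr1 -XE; field.
  have XE c : (sgn e * sgn e) * (s ^+ 2 * (c * (- (u ^+ 2 * v + 4) / t ^+ 2))) =
        s ^+ 2 * c by rewrite Sx X0 mulr1.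
  exists 0, (- s ^+ 2); rewrite congr_mx3; congr mx3; try ring.
  + transitivity (s ^+ 2 * - v); last by ring.
    by rewrite -XE; field.
  transitivity (s ^+ 2 * - 1); last by ring.
  by rewrite -XE; field.
move=> A dA s1 s2; have [p [r [e [s [s0 -> e1 e2]]]]] := stabilizer15_block uv dA s1 s2.
case: e e1 => /= e1.
  have : (u * v * p - 2 * r) * (2 * p + u * r) = 0.
    transitivity ((u * v * p ^+ 2 - 4 * p * r - u * r ^+ 2)
       - u * (-1 * (v * p ^+ 2 - r ^+ 2 + u * v * r * p))); first by ring.
    by rewrite e1 e2; ring.
  move/eqP; rewrite mulf_eq0 => /orP[] /eqP E; last first.
    have Ep : p = - (u * r / 2) by apply: (mulfI two0); apply: (lin_eq E); field.
    case/negP: nD; apply/squareP; exists (2 * v * s / r).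
    have r0 : r != 0.
      apply: contra_neq s0 => r0; apply/eqP; rewrite -sqrf_eq0; apply/eqP.
      by apply: (mulfI v0); rewrite -e1 Ep r0; ring.
    apply: (mulfI (expf_neq0 2 r0)).
    transitivity (4 * v * (v * s ^+ 2)); last by field.
    by rewrite -e1 Ep; field.
  have Er : r = u * v * p / 2 by apply: (mulfI two0); apply: (lin_eq (esym E)); field.
  have /sqrt_sgn[e Ee] : (t * p) ^+ 2 = (2 * s) ^+ 2.
    apply: (mulfI v0); rewrite exprMn -Et.
    transitivity (4 * (v * s ^+ 2)); last by ring.
    by rewrite -e1 Er; field.
  have Ep : p = sgn e * s * 2 / t by apply: (mulfI t0); rewrite Ee; field.
  exists (false, e, s); first by rewrite !inE.
  by rewrite /f Er Ep; congr mx3; field; rewrite ?two0 ?v0 ?t0.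
have : p * r = 0.
  apply: (mulfI w0); rewrite mulr0.
  transitivity (u * (1 * (v * p ^+ 2 - r ^+ 2 + u * v * r * p))
     - (u * v * p ^+ 2 - 4 * p * r - u * r ^+ 2)); first by ring.
  by rewrite e1 e2; ring.
move/eqP; rewrite mulf_eq0 => /orP[] /eqP E.
  case/negP: nv; apply/squareP; exists (r / s).
  apply: (mulfI (expf_neq0 2 s0)); transitivity (r ^+ 2); last by field.
  by apply: (lin_eq e1); rewrite E; ring.
have /sqrt_sgn[e Ee] : p ^+ 2 = s ^+ 2.
  by apply: (mulfI v0); apply: (lin_eq e1); rewrite E; ring.
exists (true, e, s); first by rewrite !inE.
by rewrite /f E Ee; congr mx3; ring.
Qed.

End Stabilizers15.

(** * The stabilizer of a line without singular points *)

Lemma cubic_extension (F : finFieldType) (al be ga : F) :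
  cubic_condition al be ga ->
  exists (K : finFieldType) (iota : {rmorphism F -> K}) (z : K),
    z ^+ 3 + iota ga * z ^+ 2 - iota be * z + iota al = 0 /\
    bijective (fun t : F * F * F =>
      iota t.1.1 + iota t.1.2 * z + iota t.2 * z ^+ 2).
Proof.
move=> irr; pose p : {poly F} := 'X^3 + ga *: 'X^2 - be *: 'X + al%:P.
have sp : size p = 4%N.
  rewrite /p -!addrA size_polyDl ?size_polyXn // (leq_ltn_trans (size_polyD _ _)) //.
  rewrite gtn_max (leq_ltn_trans (size_scale_leq _ _)) ?size_polyXn //=.
  rewrite (leq_ltn_trans (size_polyD _ _)) // gtn_max size_polyN.
  rewrite (leq_ltn_trans (size_scale_leq _ _)) ?size_polyX //=.
  by rewrite size_polyC; case: (al != 0).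
have irr_p : irreducible_poly p.
  apply: cubic_irreducible => [|x]; first by rewrite sp.
  rewrite rootE !(hornerD, hornerN, hornerZ, hornerXn, hornerX, hornerC).
  exact: irr.
have [L dimL [z pz genL]] := irredp_FAdjoin irr_p.
pose K : finFieldType := FinFieldExtType L.
pose iota : {rmorphism F -> L} := in_alg L.
exists K, (iota : {rmorphism F -> K}), (z : K).
have pz0 : z ^+ 3 + iota ga * z ^+ 2 - iota be * z + iota al = 0.
  move: pz; rewrite rootE /p !(rmorphD, rmorphN, rmorphB) /= !map_polyZ !map_polyXn.
  rewrite map_polyX map_polyC /=.
  by rewrite !hornerE => /eqP <-; rewrite ?hornerXn.
have indep a b c : iota a + iota b * z + iota c * z ^+ 2 = 0 ->
    [/\ a = 0, b = 0 & c = 0].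
  pose r : {poly F} := a%:P + b *: 'X + c *: 'X^2.
  move=> rz0; have r0 : r = 0.
    (* A nonzero relation of degree at most 2 is coprime to the irreducible cubic, so the two cannot
       share the root z. *)
    apply/eqP/negPn/negP => nr; have cop : coprimep p r.
      have [_ irrp] := irr_p; apply/negPn/negP => ncop.
      have : gcdp p r %= p by apply: irrp; rewrite ?dvdp_gcdl.
      move=> /andP[_ pg]; have := dvdp_leq nr (dvdp_trans pg (dvdp_gcdr _ _)).
      rewrite sp leqNgt => /negP[]; rewrite /r -addrA.
      rewrite (leq_ltn_trans (size_polyD _ _)) // gtn_max size_polyC.
      apply/andP; split; first by case: (_ != 0).
      rewrite (leq_ltn_trans (size_polyD _ _)) // gtn_max.
      by rewrite !(leq_ltn_trans (size_scale_leq _ _)) ?size_polyX ?size_polyXn.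
    have := coprimep_root (p := map_poly iota p) (q := map_poly iota r) (x := z).
    rewrite coprimep_map => /(_ cop pz) /eqP[].
    rewrite /r !rmorphD /= !map_polyZ map_polyXn map_polyX map_polyC.
    by rewrite !(hornerD, hornerZ, hornerXn, hornerX, hornerC).
  have e i : r`_i = 0 by rewrite r0 coef0.
  move: (e 0%N) (e 1%N) (e 2%N); rewrite /r !coefE /= !mulr0 !mulr1.
  by rewrite !addr0 !add0r.
split=> //; pose psi (t : F * F * F) : K :=
  iota t.1.1 + iota t.1.2 * z + iota t.2 * z ^+ 2.
apply: (@inj_card_bij _ K psi).
  move=> [[a b] c] [[a' b'] c'] E.
  have [] := indep (a - a') (b - b') (c - c').
    rewrite !rmorphB; transitivity (psi (a, b, c) - psi (a', b', c')).
      by rewrite /psi /=; ring.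
    by rewrite E subrr.
  by move=> /eqP + /eqP + /eqP; rewrite !subr_eq0 => /eqP-> /eqP-> /eqP->.
rewrite -(card_vspacef (T := K) (Vector.class L)) card_vspace.
by rewrite dimL sp !card_prod !expnS expn0 muln1 mulnA.
Qed.

Section CubicField.
Variables (F K : finFieldType) (iota : {rmorphism F -> K}) (z : K) (al be ga : F).
Hypothesis q_odd : odd #|F|.
Hypothesis irr : cubic_condition al be ga.
Hypothesis z_root : z ^+ 3 + iota ga * z ^+ 2 - iota be * z + iota al = 0.

Definition comb (a b c : F) : K := iota a + iota b * z + iota c * z ^+ 2.

Hypothesis comb_bij : bijective (fun t : F * F * F => comb t.1.1 t.1.2 t.2).

Local Notation Q := #|F|.
Local Notation nz := (nz F).

Lemma comb_inj a b c a' b' c' :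
  comb a b c = comb a' b' c' -> [/\ a = a', b = b' & c = c'].
Proof.
by move=> E; have := bij_inj comb_bij (x1 := (a, b, c)) (x2 := (a', b', c')) E; case.
Qed.

Lemma card_K : #|K| = (Q ^ 3)%N.
Proof. by rewrite -(bij_eq_card comb_bij) !card_prod !expnS expn0 muln1 mulnA. Qed.

(** The i-th power of the Frobenius automorphism of K over F. *)
Definition fr i (x : K) := x ^+ (Q ^ i).

Lemma frS i x : fr i.+1 x = fr i x ^+ Q.
Proof. by rewrite /fr expnSr exprM. Qed.

Lemma frS1 i x : fr i.+1 x = fr 1 (fr i x).
Proof. by rewrite frS {2}/fr expn1. Qed.

Lemma frD i x y : fr i (x + y) = fr i x + fr i y.
Proof.
elim: i => [|i IHi]; first by rewrite /fr expn0 !expr1.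
by rewrite !frS IHi (frobeniusD iota).
Qed.

Lemma frM i x y : fr i (x * y) = fr i x * fr i y.
Proof. exact: exprMn. Qed.

Lemma frX i x n : fr i (x ^+ n) = fr i x ^+ n.
Proof. by rewrite /fr -!exprM mulnC. Qed.

Lemma frI i a : fr i (iota a) = iota a.
Proof.
elim: i => [|i IHi]; first by rewrite /fr expn0 expr1.
by rewrite frS IHi -rmorphXn expf_card.
Qed.

Lemma frN i x : fr i (- x) = - fr i x.
Proof. by rewrite -mulN1r frM -(rmorphN1 iota) frI rmorphN1 mulN1r. Qed.

Lemma fr_eq0 i x : fr i x = 0 -> x = 0.
Proof. by move/eqP; rewrite expf_eq0 => /andP[_ /eqP]. Qed.

Lemma fr3 x : fr 3 x = x.
Proof. by rewrite /fr -card_K expf_card. Qed.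

Lemma fr1_fixed x : fr 1 x = x -> exists a, x = iota a.
Proof. by rewrite /fr expn1; apply: frobenius_fixed. Qed.

Lemma fr2_fixed x : fr 2 x = x -> exists a, x = iota a.
Proof.
move=> E; apply: fr1_fixed; rewrite -{1}E.
by rewrite -[RHS]fr3 /fr -exprM -expnD.
Qed.

(** K has odd degree over F, hence no quadratic subfield: if Frobenius negated x, so would its cube,
    which is the identity. *)
Lemma sqr_in_base (x : K) b : x ^+ 2 = iota b -> exists a, x = iota a.
Proof.
have two0 : 2 != 0 :> K.
  by rewrite -(rmorph_nat iota) fmorph_eq0 two_neq0.
move=> E; have : fr 1 x ^+ 2 = x ^+ 2 by rewrite -frX E frI.
move/eqP; rewrite eqf_sqr => /orP[/eqP /fr1_fixed //|/eqP x1].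
have : fr 3 x = - x.
  by rewrite (frS1 2) (frS1 1%N) x1 frN x1 opprK x1.
rewrite fr3 => xN; exists 0; rewrite rmorph0; apply: (mulfI two0).
by apply: (lin_eq xN); ring.
Qed.

(** Were a != 0, Frobenius would send x to the other root - b/a - x and its square would fix x,
    which puts x in F. *)
Lemma quadratic_indep (x : K) a b c : (forall k, x <> iota k) ->
  iota a * x ^+ 2 + iota b * x + iota c = 0 -> [/\ a = 0, b = 0 & c = 0].
Proof.
move=> xF E; have a0 : a = 0.
  apply/eqP/negPn/negP => a0; have ia0 : iota a != 0 by rewrite fmorph_eq0.
  have E1 : iota a * fr 1 x ^+ 2 + iota b * fr 1 x + iota c = 0.
    have := congr1 (fr 1) E.
    rewrite !frD (frM _ (iota a)) (frM _ (iota b)) frX !frI => ->.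
    by rewrite -(rmorph0 iota) frI.
  have D : (fr 1 x - x) * (iota a * (fr 1 x + x) + iota b) = 0.
    by apply: (lin_eq (etrans E1 (esym E))); ring.
  move/eqP: D; rewrite mulf_eq0 subr_eq0 => /orP[/eqP /fr1_fixed[k /xF]//|/eqP D].
  have fx : fr 1 x = - iota (b / a) - x.
    apply: (mulfI ia0); apply: (lin_eq D); rewrite rmorphM fmorphV; field.
    exact: ia0.
  have /fr2_fixed[k /xF//] : fr 2 x = x.
  by rewrite (frS1 1%N) fx frD !frN frI fx; ring.
move: E; rewrite a0 rmorph0 mul0r add0r => E.
have b0 : b = 0.
  apply/eqP/negPn/negP => b0; case: (xF (- (c / b))).
  have ib0 : iota b != 0 by rewrite fmorph_eq0.
  apply: (mulfI ib0); apply: (lin_eq E); rewrite rmorphN rmorphM fmorphV; field.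
  exact: ib0.
split=> //; move/eqP: E; rewrite b0 rmorph0 mul0r add0r fmorph_eq0.
by move/eqP.
Qed.

Lemma z_notin_base k : z <> iota k.
Proof.
move=> E; case/eqP: (irr k); apply: (fmorph_inj iota).
by rewrite rmorph0 -z_root E; rewrite !(rmorphD, rmorphB, rmorphM, rmorphXn) rmorphN rmorphM.
Qed.

Lemma z_neq0 : z != 0.
Proof. by apply/eqP => E; apply: (@z_notin_base 0); rewrite rmorph0. Qed.

Lemma fr_z_inj i j : (i < 3)%N -> (j < 3)%N -> fr i z = fr j z -> i = j.
Proof.
have n1 : fr 1 z <> z by move=> /fr1_fixed[k /z_notin_base].
have n2 : fr 2 z <> z by move=> /fr2_fixed[k /z_notin_base].
have n12 : fr 1 z <> fr 2 z.
  move=> E; apply: n1; apply/eqP; rewrite -subr_eq0; apply/eqP/(@fr_eq0 1).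
  by rewrite frD frN -(frS1 1%N) -E subrr.
have e0 : fr 0 z = z by rewrite /fr expr1.
case: i => [|[|[|//]]] _; case: j => [|[|[|//]]] _ //; rewrite ?e0 => E;
  by exfalso; first [exact: n1|exact: n1 (esym E)|exact: n2|exact: n2 (esym E)
                    |exact: n12|exact: n12 (esym E)].
Qed.

Lemma fr_z_root i : fr i z ^+ 3 + iota ga * fr i z ^+ 2 - iota be * fr i z + iota al = 0.
Proof.
have := congr1 (fr i) z_root; rewrite !frD frN.
rewrite (frM _ (iota ga)) (frM _ (iota be)) !frX !frI => ->.
by rewrite -(rmorph0 iota) frI.
Qed.

(** A cubic has at most three roots, and the three conjugates of z are distinct. *)
Lemma root_conj (e : K) :
  e ^+ 3 + iota ga * e ^+ 2 - iota be * e + iota al = 0 ->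
  exists i : 'I_3, e = fr i z.
Proof.
move=> e_root; pose p : {poly K} :=
  'X^3 + iota ga *: 'X^2 - iota be *: 'X + (iota al)%:P.
have pE x : root p x = (x ^+ 3 + iota ga * x ^+ 2 - iota be * x + iota al == 0).
  by rewrite rootE !(hornerD, hornerN, hornerZ, hornerXn, hornerX, hornerC).
have sp : size p = 4%N.
  rewrite /p -!addrA size_polyDl ?size_polyXn // (leq_ltn_trans (size_polyD _ _)) //.
  rewrite gtn_max (leq_ltn_trans (size_scale_leq _ _)) ?size_polyXn //=.
  rewrite (leq_ltn_trans (size_polyD _ _)) // gtn_max size_polyN.
  rewrite (leq_ltn_trans (size_scale_leq _ _)) ?size_polyX //=.
  by rewrite size_polyC; case: (_ != 0).
have [/existsP[i /eqP Ei]|] := boolP [exists i : 'I_3, e == fr i z].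
  by exists i.
rewrite negb_exists => /forallP ne.
have p0 : p != 0 by rewrite -size_poly_eq0 sp.
have := max_poly_roots (rs := [:: e; fr 0 z; fr 1 z; fr 2 z]) p0.
rewrite sp /= !pE e_root !fr_z_root eqxx => /(_ isT); rewrite ltnn => H.
suff: false by []; apply: H.
have dz i j : (i < 3)%N -> (j < 3)%N -> i != j -> fr i z != fr j z.
  by move=> i3 j3; apply: contra_neq => /fr_z_inj->.
have := ne 0; have := ne 1; have := ne 2; rewrite !inE !negb_or /= => -> -> ->.
by rewrite !dz.
Qed.

(* The row (a, b, c) of a matrix is read as an element of K in the basis 1,
   w = z^2 + ga z, - z. With respect to 1, z, z^2 the coefficients of 1 (up to the
   factor al) and z^2 in a product are then the two bilinear forms spanning
   line17, so that a matrix stabilizes the line when the products of its rows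
   satisfy some relations modulo F z. *)
Definition basis_comb (a b c : F) : K := comb a (b * ga - c) b.

Lemma basis_comb_inj a b c a' b' c' :
  basis_comb a b c = basis_comb a' b' c' -> [/\ a = a', b = b' & c = c'].
Proof. move=> /comb_inj[-> E Eb]; rewrite Eb in E; split=> //.
by apply: (lin_eq (esym E)); ring. Qed.

Lemma basis_combE a b c :
  basis_comb a b c = iota a + iota b * (z ^+ 2 + iota ga * z) - iota c * z.
Proof. by rewrite /basis_comb /comb rmorphB rmorphM; ring. Qed.

Definition form1 (a b c a' b' c' : F) :=
  al^-1 * (a * a') - ga * (b * b') + (b * c' + c * b').
Definition form2 (a b c a' b' c' : F) :=
  a * b' + b * a' + be * (b * b') + c * c'.

Lemma al_neq0 : al != 0.
Proof. by have := irr 0; rewrite !expr0n !mulr0 subr0 !add0r. Qed.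

Lemma basis_comb_mul a b c a' b' c' : exists k,
  basis_comb a b c * basis_comb a' b' c' =
  comb (al * form1 a b c a' b' c') k (form2 a b c a' b' c').
Proof.
have ial0 : iota al != 0 by rewrite fmorph_eq0 al_neq0.
pose p1 := b * ga - c; pose p1' := b' * ga - c'.
(* The coefficient of z^3 in the product; the witness below is the coefficient of z after reducing
   z^3 and z^4 by the cubic. *)
pose e3 := p1 * b' + b * p1'.
exists (a * p1' + p1 * a' + be * e3 - (be * ga + al) * (b * b')).
rewrite /basis_comb /comb /form1 /form2 /e3 /p1 /p1'.
rewrite !(rmorphD, rmorphB, rmorphM) fmorphV.
apply/eqP; rewrite -subr_eq0; apply/eqP.
pose g := z ^+ 3 + iota ga * z ^+ 2 - iota be * z + iota al.
transitivity (g * (iota b * iota b' * (z - iota ga) +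
   ((iota b * iota ga - iota c) * iota b' + iota b * (iota b' * iota ga - iota c')))).
  by rewrite /g; field.
by rewrite /g z_root mul0r.
Qed.

Lemma comb_line x y m k : comb x m y = iota k * z -> x = 0 /\ y = 0.
Proof.
have -> : iota k * z = comb 0 k 0 by rewrite /comb rmorph0; ring.
by case/comb_inj.
Qed.

Lemma comb_lin x k y x' k' y' (r : F) :
  comb x k y + iota r * comb x' k' y' = comb (x + r * x') (k + r * k') (y + r * y').
Proof. by rewrite /comb !rmorphD !rmorphM; ring. Qed.

Definition line17 (x y : F) :=
  mx3 (al^-1 * x) y 0 y (be * y - ga * x) x 0 x y.

Lemma line17_lin x y : line17 x y = x *: line17 1 0 + y *: line17 0 1.
Proof. by rewrite /line17 !scalemx3 addmx3; congr mx3; ring. Qed.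

Definition on_line17 (m11 m12 m13 m22 m23 m33 : F) :=
  [/\ m13 = 0, m33 = m12, m23 = al * m11 & m22 = be * m33 - ga * m23].

Lemma on_line17P m11 m12 m13 m22 m23 m33 :
  (exists x y, mx3 m11 m12 m13 m12 m22 m23 m13 m23 m33 = line17 x y) <->
  on_line17 m11 m12 m13 m22 m23 m33.
Proof.
split=> [[x [y]]|[-> -> -> ->]].
  move=> /mx3_inj[[-> -> ->] [[_ -> ->] [_ _ ->]]]; split=> //.
  by field; apply: al_neq0.
exists (al * m11), m12; rewrite /line17; congr mx3.
by field; apply: al_neq0.
Qed.

(** The four equations of [on_line17] for both forms at once, with the entry m_ij replaced by the
    product z_i z_j modulo F z. *)
Definition stable_triple (z1 z2 z3 : K) := exists k1 k2 k3 k4 : F,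
  [/\ z1 * z3 = iota k1 * z, z3 ^+ 2 - z1 * z2 = iota k2 * z,
      z2 * z3 - iota al * z1 ^+ 2 = iota k3 * z &
      z2 ^+ 2 - iota be * z3 ^+ 2 + iota ga * (z2 * z3) = iota k4 * z].

Lemma stable_tripleP a1 b1 c1 a2 b2 c2 a3 b3 c3 :
  let A := mx3 a1 b1 c1 a2 b2 c2 a3 b3 c3 in
  (maps_into line17 (line17 1 0) A /\ maps_into line17 (line17 0 1) A) <->
  stable_triple (basis_comb a1 b1 c1) (basis_comb a2 b2 c2) (basis_comb a3 b3 c3).
Proof.
move=> A; have al0 := al_neq0.
have -> : maps_into line17 (line17 1 0) A <->
  on_line17 (form1 a1 b1 c1 a1 b1 c1) (form1 a1 b1 c1 a2 b2 c2)
    (form1 a1 b1 c1 a3 b3 c3) (form1 a2 b2 c2 a2 b2 c2)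
    (form1 a2 b2 c2 a3 b3 c3) (form1 a3 b3 c3 a3 b3 c3).
  rewrite -on_line17P /maps_into /A congr_mx3.
  rewrite (_ : mx3 _ _ _ _ _ _ _ _ _ = mx3 (form1 a1 b1 c1 a1 b1 c1)
    (form1 a1 b1 c1 a2 b2 c2) (form1 a1 b1 c1 a3 b3 c3) (form1 a1 b1 c1 a2 b2 c2)
    (form1 a2 b2 c2 a2 b2 c2) (form1 a2 b2 c2 a3 b3 c3) (form1 a1 b1 c1 a3 b3 c3)
    (form1 a2 b2 c2 a3 b3 c3) (form1 a3 b3 c3 a3 b3 c3)) //.
  by rewrite /form1; congr mx3; ring.
have -> : maps_into line17 (line17 0 1) A <->
  on_line17 (form2 a1 b1 c1 a1 b1 c1) (form2 a1 b1 c1 a2 b2 c2)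
    (form2 a1 b1 c1 a3 b3 c3) (form2 a2 b2 c2 a2 b2 c2)
    (form2 a2 b2 c2 a3 b3 c3) (form2 a3 b3 c3 a3 b3 c3).
  rewrite -on_line17P /maps_into /A congr_mx3.
  rewrite (_ : mx3 _ _ _ _ _ _ _ _ _ = mx3 (form2 a1 b1 c1 a1 b1 c1)
    (form2 a1 b1 c1 a2 b2 c2) (form2 a1 b1 c1 a3 b3 c3) (form2 a1 b1 c1 a2 b2 c2)
    (form2 a2 b2 c2 a2 b2 c2) (form2 a2 b2 c2 a3 b3 c3) (form2 a1 b1 c1 a3 b3 c3)
    (form2 a2 b2 c2 a3 b3 c3) (form2 a3 b3 c3 a3 b3 c3)) //.
  by rewrite /form2; congr mx3; ring.
have [k11 E11] := basis_comb_mul a1 b1 c1 a1 b1 c1.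
have [k12 E12] := basis_comb_mul a1 b1 c1 a2 b2 c2.
have [k13 E13] := basis_comb_mul a1 b1 c1 a3 b3 c3.
have [k22 E22] := basis_comb_mul a2 b2 c2 a2 b2 c2.
have [k23 E23] := basis_comb_mul a2 b2 c2 a3 b3 c3.
have [k33 E33] := basis_comb_mul a3 b3 c3 a3 b3 c3.
move: E11 E12 E13 E22 E23 E33.
set z1 := basis_comb a1 b1 c1; set z2 := basis_comb a2 b2 c2.
set z3 := basis_comb a3 b3 c3.
move: (form1 a1 b1 c1 a1 b1 c1) (form1 a1 b1 c1 a2 b2 c2)
    (form1 a1 b1 c1 a3 b3 c3) (form1 a2 b2 c2 a2 b2 c2)
    (form1 a2 b2 c2 a3 b3 c3) (form1 a3 b3 c3 a3 b3 c3) => f11 f12 f13 f22 f23 f33.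
move: (form2 a1 b1 c1 a1 b1 c1) (form2 a1 b1 c1 a2 b2 c2)
    (form2 a1 b1 c1 a3 b3 c3) (form2 a2 b2 c2 a2 b2 c2)
    (form2 a2 b2 c2 a3 b3 c3) (form2 a3 b3 c3 a3 b3 c3) => g11 g12 g13 g22 g23 g33.
move=> E11 E12 E13 E22 E23 E33.
have L2 : z3 ^+ 2 - z1 * z2 =
    comb (al * f33 + - 1 * (al * f12)) (k33 + -1 * k12) (g33 + -1 * g12).
  by rewrite -comb_lin -E33 -E12 rmorphN1; ring.
have L3 : z2 * z3 - iota al * z1 ^+ 2 =
    comb (al * f23 + - al * (al * f11)) (k23 + - al * k11) (g23 + - al * g11).
  by rewrite -comb_lin -E23 -E11 rmorphN; ring.
have L4 : z2 ^+ 2 - iota be * z3 ^+ 2 + iota ga * (z2 * z3) =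
    comb (al * f22 + - be * (al * f33) + ga * (al * f23))
         (k22 + - be * k33 + ga * k23) (g22 + - be * g33 + ga * g23).
  by rewrite -!comb_lin -E22 -E33 -E23 rmorphN; ring.
have line0 x : comb 0 x 0 = iota x * z by rewrite /comb rmorph0; ring.
split=> [[[f1 f2 f3 f4] [g1 g2 g3 g4]]|[m1 [m2 [m3 [m4 [e1 e2 e3 e4]]]]]].
  exists k13, (k33 + -1 * k12), (k23 + - al * k11), (k22 + - be * k33 + ga * k23).
  rewrite L2 L3 L4 E13 -!line0 f4 f3 f2 f1 g4 g3 g2 g1; split; congr comb; ring.
rewrite E13 in e1; rewrite L2 in e2; rewrite L3 in e3; rewrite L4 in e4.
have [f1 g1] := comb_line e1; have [f2 g2] := comb_line e2.
have [f3 g3] := comb_line e3; have [f4 g4] := comb_line e4.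
split; split=> //.
- by apply: (mulfI al0); rewrite mulr0.
- by apply: (mulfI al0); apply: (lin_eq f2); ring.
- by apply: (mulfI al0); apply: (lin_eq f3); ring.
- by apply: (mulfI al0); apply: (lin_eq f4); ring.
- by apply: (lin_eq g2); ring.
- by apply: (lin_eq g3); ring.
by apply: (lin_eq g4); ring.
Qed.

Definition conj_scale i := z^-1 ^+ ((Q ^ i).-1./2).

Lemma conj_scale_neq0 i : conj_scale i != 0.
Proof. by rewrite expf_neq0 ?invr_eq0 ?z_neq0. Qed.

(* q^i is odd, so z / z^(q^i) is a square in K. *)
Lemma conj_scale_sqr i : conj_scale i ^+ 2 * fr i z = z.
Proof.
have odd_qi : odd (Q ^ i) by rewrite oddX q_odd orbT.
rewrite /conj_scale -exprM muln2 halfK.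
have -> : odd (Q ^ i).-1 = false by case: (Q ^ i)%N odd_qi => //= n /negPf.
rewrite subn0 /fr -{2}(prednK (odd_gt0 odd_qi)) exprSr mulrA -exprMn mulVf ?z_neq0 //.
by rewrite expr1n mul1r.
Qed.

Definition w2 := z ^+ 2 + iota ga * z.

(* The rows of the stabilizing matrices: up to a scalar in F, a conjugate of the
   basis 1, w, - z multiplied by a square root of z / z^(q^i). *)
Definition conj_triple i (k : F) : K * K * K :=
  let s := iota k * conj_scale i in
  (s, s * fr i w2, s * fr i (- z)).

Lemma stable_conj_triple i k :
  stable_triple (conj_triple i k).1.1 (conj_triple i k).1.2 (conj_triple i k).2.
Proof.
have root := fr_z_root i; have S := conj_scale_sqr i.
rewrite /conj_triple /= frN /w2 frD frX frM frI.
move: (conj_scale i) (fr i z) root S => s e root S.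
exists (- k ^+ 2), (- ga * k ^+ 2), (- be * k ^+ 2), (- al * k ^+ 2).
rewrite -S !rmorphM !rmorphN !rmorphXn; split.
- by ring.
- by ring.
- apply/eqP; rewrite -subr_eq0; apply/eqP.
  transitivity (- (iota k ^+ 2 * s ^+ 2) *
    (e ^+ 3 + iota ga * e ^+ 2 - iota be * e + iota al)); first by ring.
  by rewrite root mulr0.
apply/eqP; rewrite -subr_eq0; apply/eqP.
transitivity ((iota k ^+ 2 * s ^+ 2) * e *
  (e ^+ 3 + iota ga * e ^+ 2 - iota be * e + iota al)); first by ring.
by rewrite root mulr0.
Qed.

(** The quotient e = - z3/z1 lies outside F. The second relation expresses z2 through e, the third
    is a cubic equation for e, and the fourth identifies its coefficients with those of the cubic of
    z. So e is a conjugate of z, and the first relation determines z1 up to a factor in F. *)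
Lemma stable_triple_conj z1 z2 z3 : z1 != 0 ->
  (forall k, z3 <> iota k * z1) -> stable_triple z1 z2 z3 ->
  exists (i : 'I_3) k, k != 0 /\ (z1, z2, z3) = conj_triple i k.
Proof.
move=> z10 z3F [k1 [k2 [k3 [k4 [e1 e2 e3 e4]]]]].
have iota0 k : k != 0 -> iota k != 0 by rewrite fmorph_eq0.
have z30 : z3 != 0.
  by apply/eqP => z30; apply: (z3F 0); rewrite z30 rmorph0 mul0r.
have k10 : k1 != 0.
  by apply: contra_neq (mulf_neq0 z10 z30) => k0; rewrite e1 k0 rmorph0 mul0r.
have ik10 := iota0 _ k10.
pose e := - (z3 / z1).
have Ez3 : z3 = - (e * z1) by rewrite /e; field.
have eF k : e <> iota k.
  by move=> E; apply: (z3F (- k)); rewrite Ez3 E rmorphN mulNr.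
have Ez : z = - (e * z1 ^+ 2) / iota k1.
  by apply: (mulfI ik10); rewrite -e1 Ez3; field.
have e0 : e != 0 by apply/eqP => E; apply: (eF 0); rewrite rmorph0.
pose g' := k2 / k1; pose b' := k3 / k1.
have Ez2 : z2 = z1 * (e ^+ 2 + iota g' * e).
  apply: (mulfI z10); apply: (lin_eq (esym e2)).
  by rewrite Ez3 Ez /g' rmorphM fmorphV; field.
have z1n := expf_neq0 2 z10.
have c1 : e ^+ 3 + iota g' * e ^+ 2 - iota b' * e + iota al = 0.
  apply: (mulfI z1n); apply: (lin_eq (esym e3)).
  by rewrite Ez2 Ez3 Ez /b' rmorphM fmorphV; field.
(* Subtracting a multiple of the cubic equation of e from the fourth relation leaves a quadratic
   relation over F, whose coefficients vanish. *)
have [bE _ gE] : [/\ b' - be = 0,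
    - al + g' * b' - ga * b' + k4 / k1 = 0 & al * (ga - g') = 0].
  apply: (quadratic_indep eF); apply: (mulfI z1n); rewrite mulr0.
  transitivity ((z2 ^+ 2 - iota be * z3 ^+ 2 + iota ga * (z2 * z3) - iota k4 * z)
    - z1 ^+ 2 * (e + iota g' - iota ga) *
      (e ^+ 3 + iota g' * e ^+ 2 - iota b' * e + iota al)); last first.
    by rewrite e4 c1; ring.
  rewrite Ez2 Ez3 Ez !(rmorphD, rmorphB, rmorphM, rmorphN) fmorphV.
  by field.
have {}gE : g' = ga.
  by apply: (mulfI al_neq0); apply: (lin_eq (esym gE)); ring.
have {}bE : b' = be by apply: (lin_eq bE); ring.
rewrite gE bE in c1; rewrite gE in Ez2.
have [i Ei] := root_conj c1.
have s0 := conj_scale_neq0 i; have S := conj_scale_sqr i; rewrite -Ei in S.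
(* Both z1^2 e = - k1 z and [conj_scale i] squared times e = z hold, so the quotient has its square
   in F. *)
have [k Ek] : exists k, z1 / conj_scale i = iota k.
  apply: (@sqr_in_base _ (- k1)).
  apply: (mulIf e0); apply: (mulIf (expf_neq0 2 s0)).
  transitivity (z1 ^+ 2 * e); first by field.
  transitivity (- iota k1 * (conj_scale i ^+ 2 * e)); last by rewrite rmorphN; ring.
  by rewrite S Ez; field.
have Ez1 : z1 = iota k * conj_scale i by rewrite -Ek mulfVK.
exists i, k; split.
  by apply: contra_neq z10 => k0; rewrite Ez1 k0 rmorph0 mul0r.
rewrite /conj_triple frN /w2 frD frX frM frI -Ei -Ez1 Ez2 Ez3.
by congr (_, _, _); ring.
Qed.

Lemma card_stabilizer17 : #|stabilizer line17|%:R = 3 * (Q%:R - 1) :> rat.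
Proof.
have [co coE] : exists co : K -> F * F * F, forall x,
    x = basis_comb (co x).1.1 (co x).1.2 (co x).2.
  have [g gK Kg] := comb_bij.
  exists (fun x => ((g x).1.1, (g x).2, (g x).2 * ga - (g x).1.2)) => x.
  by rewrite -{1}(Kg x) /basis_comb /=; congr comb; ring.
have coK a b c : co (basis_comb a b c) = (a, b, c).
  have := coE (basis_comb a b c) => /basis_comb_inj.
  by case: (co _) => [[? ?] ?] /= [-> -> ->].
pose f (t : 'I_3 * F) : 'M[F]_3 :=
  mxv (co (conj_triple t.1 t.2).1.1) (co (conj_triple t.1 t.2).1.2)
      (co (conj_triple t.1 t.2).2).
rewrite (card_stabilizer (D := setX [set: 'I_3] nz) (f := f)).
- by rewrite cardsX cardsT card_ord natrM card_nz.
- exact: line17_lin.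
- move=> [i k] [j l]; rewrite !inE /= => k0 l0.
  move=> /mx3_inj[[e11 e12 e13] [_ [e31 e32 e33]]].
  have E1 : iota k * conj_scale i = iota l * conj_scale j.
    by rewrite [LHS]coE [RHS]coE e11 e12 e13.
  have E3 : iota k * conj_scale i * fr i (- z) = iota l * conj_scale j * fr j (- z).
    by rewrite [LHS]coE [RHS]coE e31 e32 e33.
  have s0 : iota l * conj_scale j != 0.
    by rewrite mulf_neq0 ?fmorph_eq0 ?conj_scale_neq0.
  move: E3; rewrite E1 !frN => /(mulfI s0) /oppr_inj.
  move=> /(fr_z_inj (ltn_ord i) (ltn_ord j)) /val_inj Eij; subst j.
  by move/(mulIf (conj_scale_neq0 i)): E1 => /fmorph_inj->.
- move=> [i k] /[!inE] /= k0.
  have stab : maps_into line17 (line17 1 0) (f (i, k)) /\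
              maps_into line17 (line17 0 1) (f (i, k)).
    by apply/stable_tripleP; rewrite -!coE; apply: stable_conj_triple.
  case: stab => st1 st2; split=> //; apply/negP => /det0P[v v0 vA].
  case/negP: v0; apply/eqP/rowP => j; rewrite mxE.
  have vE l : v 0 0 * f (i, k) 0 l + v 0 1 * f (i, k) 1 l + v 0 2 * f (i, k) 2 l = 0.
    by have := congr1 (fun u : 'rV_3 => u 0 l) vA; rewrite [LHS]mxE [RHS]mxE sum3.
  have lin (a b c a1 b1 c1 a2 b2 c2 a3 b3 c3 : F) :
      iota a * basis_comb a1 b1 c1 + iota b * basis_comb a2 b2 c2 +
      iota c * basis_comb a3 b3 c3 =
      basis_comb (a * a1 + b * a2 + c * a3) (a * b1 + b * b2 + c * b3)
                 (a * c1 + b * c2 + c * c3).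
    by rewrite !basis_combE !rmorphD !rmorphM; ring.
  have Z : iota (v 0 0) * (conj_triple i k).1.1 + iota (v 0 1) * (conj_triple i k).1.2
      + iota (v 0 2) * (conj_triple i k).2 = 0.
    rewrite [(conj_triple i k).1.1]coE [(conj_triple i k).1.2]coE [(conj_triple i k).2]coE.
    rewrite lin; move: (vE 0) (vE 1) (vE 2); rewrite !mxE /= => -> -> ->.
    by rewrite basis_combE !rmorph0; ring.
  have s0 : iota k * conj_scale i != 0.
    by rewrite mulf_neq0 ?fmorph_eq0 ?conj_scale_neq0.
  (* The relation Z is a nonzero multiple of the Frobenius image of this element, so a dependency
     between the rows is trivial. *)
  have : basis_comb (v 0 0) (v 0 1) (v 0 2) = basis_comb 0 0 0.
    transitivity (0 : K); last by rewrite basis_combE !rmorph0; ring.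
    apply: (@fr_eq0 i); apply: (mulfI s0); rewrite mulr0 -[RHS]Z /conj_triple /=.
    by rewrite basis_combE /w2 !(frD, frN, frM, frI); ring.
  by move/basis_comb_inj => [v00 v01 v02]; move: j; apply: ord3P.
apply: mx3_forall => a1 b1 c1 a2 b2 c2 a3 b3 c3 dA s1 s2.
have := (stable_tripleP _ _ _ _ _ _ _ _ _).1 (conj s1 s2).
have zero : basis_comb 0 0 0 = 0 by rewrite basis_combE !rmorph0; ring.
(* Invertibility of A supplies the side conditions: the first row is nonzero and the third is not a
   multiple of it. *)
case/stable_triple_conj => [||i [k [k0 E]]].
- apply: contra_neq dA; rewrite -zero => /basis_comb_inj[-> -> ->].
  by rewrite det_mx3; ring.
- move=> k E; case/eqP: dA.
  have : basis_comb a3 b3 c3 = basis_comb (k * a1) (k * b1) (k * c1).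
    by rewrite E !basis_combE !rmorphM; ring.
  by move/basis_comb_inj => [-> -> ->]; rewrite det_mx3; ring.
exists (i, k); first by rewrite !inE.
have := congr1 (fun t => mxv (co t.1.1) (co t.1.2) (co t.2)) E; rewrite /= !coK.
exact.
Qed.

End CubicField.

(** * Distribution of the points of a line among the types *)

Section Distribution.
Variables (F : finFieldType) (d : F).
Hypotheses (q_odd : odd #|F|) (nd : ~~ square d).
Local Notation q := (#|F|%:R : rat).
Implicit Types (M : F -> F -> 'M[F]_3).

(* The line M has r1, r2r, r2i, r3 points of the types H1, H2r, H2i, H3; the
   numbers are recorded through an arbitrary weight X of the types. *)
Definition distribution M (r1 r2r r2i r3 : rat) := exists tau_inf tau,
  [/\ has_type d tau_inf (M 0 1), forall t, has_type d (tau t) (M 1 t) &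
   forall X : hyperplane_orbit -> rat, X tau_inf + \sum_(t : F) X (tau t) =
     r1 * X H1 + r2r * X H2r + r2i * X H2i + r3 * X H3].

Lemma q_neq0 : q != 0.
Proof. by rewrite Num.Theory.pnatr_eq0 -lt0n; apply/card_gt0P; exists 0. Qed.

Lemma qB1_neq0 : q - 1 != 0.
Proof.
rewrite -card_nz Num.Theory.pnatr_eq0 -lt0n card_gt0.
by apply/set0Pn; exists 1; rewrite inE oner_eq0.
Qed.

Lemma qD1_neq0 : q + 1 != 0.
Proof. by rewrite -(natrD _ _ 1) addn1 Num.Theory.pnatr_eq0. Qed.

(** The last hypothesis is the pencil count multiplied out, an identity in q alone that is left to
    [field]. *)
Lemma count_of_distribution o M r1 r2r r2i r3 (s : rat) :
  (forall x y, M x y = x *: M 1 0 + y *: M 0 1) ->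
  (forall x y, (M x y)^T = M x y) ->
  distribution M r1 r2r r2i r3 -> #|stabilizer M|%:R = s -> s != 0 ->
  (forall h, line_count o h q * s * q =
     r1 * incidence_number h H1 q + r2r * incidence_number h H2r q +
     r2i * incidence_number h H2i q + r3 * incidence_number h H3 q - gl3_order q) ->
  forall h p, in_hyperplane_orbit h p ->
  #|[set L in K_orbit (line_of M) | L \subset hyperplane p]|%:R = line_count o h q.
Proof.
move=> Mlin Msym [tau_inf [tau [t_inf t_tau sumX]]] Es s0 arith h p hp.
apply: (mulIf s0); apply: (mulIf q_neq0); rewrite arith.
rewrite -(sumX (fun k => incidence_number h k q)) -Es.
apply: (card_orbit_in_hyperplane q_odd nd Mlin Msym) t_inf t_tau.
  by move=> N; apply: mem_hyperplane.
exact: gram_type.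
Qed.

Lemma sum_const (x : rat) : \sum_(t : F) x = q * x.
Proof. by rewrite sumr_const mulr_natl. Qed.

Lemma sum_if0 (A B : rat) : \sum_(t : F) (if t == 0 then A else B) = A + (q - 1) * B.
Proof.
rewrite (bigD1 0) //= eqxx; congr (_ + _).
rewrite (eq_bigr (fun=> B)) => [|t /negPf->] //.
by rewrite sumr_const -card_nz -cardsE mulr_natl.
Qed.

Lemma type_block12 h (a b c : F) :
  has_type d h (mx3 a b 0 b c 0 0 0 0) -> has_type d h (mx3 0 0 0 0 a b 0 b c).
Proof.
move=> T; apply: (@has_type_conj _ _ _ _ (mx3 0 1 0 0 0 1 1 0 0)).
  by apply: mx3_unit; rewrite (_ : _ + _ = 1) ?oner_eq0 //; ring.
by rewrite trmx3 !mulmx3; move: T; congr (has_type _ _ _); congr mx3; ring.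
Qed.

Lemma type_block02 h (a b c : F) :
  has_type d h (mx3 a b 0 b c 0 0 0 0) -> has_type d h (mx3 a 0 b 0 0 0 b 0 c).
Proof.
move=> T; apply: (@has_type_conj _ _ _ _ (mx3 1 0 0 0 0 1 0 1 0)).
  by apply: mx3_unit; rewrite (_ : _ + _ = - 1) ?oppr_eq0 ?oner_eq0 //; ring.
by rewrite trmx3 !mulmx3; move: T; congr (has_type _ _ _); congr mx3; ring.
Qed.

Lemma type_swap h (a b c : F) :
  has_type d h (mx3 a b 0 b c 0 0 0 0) -> has_type d h (mx3 c b 0 b a 0 0 0 0).
Proof.
move=> T; apply: (@has_type_conj _ _ _ _ (mx3 0 1 0 1 0 0 0 0 1)).
  by apply: mx3_unit; rewrite (_ : _ + _ = - 1) ?oppr_eq0 ?oner_eq0 //; ring.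
by rewrite trmx3 !mulmx3; move: T; congr (has_type _ _ _); congr mx3; ring.
Qed.

Lemma type_det (a b c e f g : F) :
  a * (e * g - f * f) - b * (b * g - f * c) + c * (b * f - e * c) != 0 ->
  has_type d H3 (mx3 a b c b e f c f g).
Proof.
by move=> D; apply: type_nonsingular => //; rewrite ?trmx3 ?det_mx3.
Qed.

Lemma type_hyperbolic : has_type d H2r (mx3 0 1 0 1 0 0 0 0 0).
Proof.
have E : 1 ^+ 2 - 0 * 0 = (1 ^+ 2 : F) by ring.
by apply: type_split; rewrite // E ?sqr_square // expf_neq0 ?oner_eq0.
Qed.

Lemma distribution6 : distribution (@line6 F) 1 q 0 0.
Proof.
exists H2r, (fun t => if t == 0 then H1 else H2r); split=> [|t|X].
- exact: type_hyperbolic.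
- rewrite /line6; case: eqVneq => [->|t0].
    by apply: type_rank1; rewrite ?oner_eq0 //; ring.
  have E : t ^+ 2 - 1 * 0 = t ^+ 2 by ring.
  by apply: type_split; rewrite // E ?sqr_square // expf_neq0.
rewrite (eq_bigr (fun t => if t == 0 then X H1 else X H2r)); last by move=> t _; case: ifP.
by rewrite sum_if0; ring.
Qed.

Lemma type_diag12 (k : F) : k != 0 ->
  has_type d (if square k then H2r else H2i) (mx3 0 0 0 0 1 0 0 0 (- k)).
Proof.
move=> k0; apply: type_block12; have E : 0 ^+ 2 - 1 * - k = k by ring.
by case: ifPn => sk; [apply: type_split|apply: type_nonsplit]; rewrite ?E.
Qed.

Lemma distribution8 k : k != 0 ->
  distribution (line8 k) 1 (square k)%:R (~~ square k)%:R (q - 1).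
Proof.
move=> k0; exists (if square k then H2r else H2i), (fun t => if t == 0 then H1 else H3).
split=> [|t|X].
- by rewrite /line8 mulr1; apply: type_diag12.
- rewrite /line8; case: eqVneq => [->|t0].
    by rewrite mulr0 oppr0; apply: type_rank1; rewrite ?oner_eq0 //; ring.
  apply: type_det; rewrite (_ : _ + _ = - (k * t ^+ 2)); last by ring.
  by rewrite oppr_eq0 mulf_neq0 // expf_neq0.
rewrite (eq_bigr (fun t => if t == 0 then X H1 else X H3)); last by move=> t _; case: ifP.
by rewrite sum_if0; case: square => /=; ring.
Qed.

Lemma distribution9 : distribution (@line9 F) 1 0 0 q.
Proof.
exists H3, (fun t => if t == 0 then H1 else H3); split=> [|t|X].
- by apply: type_det; rewrite (_ : _ + _ = - 1) ?oppr_eq0 ?oner_eq0 //; ring.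
- rewrite /line9; case: eqVneq => [->|t0].
    by apply: type_rank1; rewrite ?oner_eq0 //; ring.
  apply: type_det; rewrite (_ : _ + _ = - t ^+ 3) ?oppr_eq0 ?expf_neq0 //; ring.
rewrite (eq_bigr (fun t => if t == 0 then X H1 else X H3)); last by move=> t _; case: ifP.
by rewrite sum_if0; ring.
Qed.

Lemma distribution12 : distribution (@line12 F) 0 (q + 1) 0 0.
Proof.
exists H2r, (fun=> H2r); split=> [|t|X].
- by apply: type_block12; apply: type_hyperbolic.
- apply: (@has_type_conj _ _ _ _ (mx3 1 0 0 0 1 0 (- t) 0 1)).
    by apply: mx3_unit; rewrite (_ : _ + _ = 1) ?oner_eq0 //; ring.
  rewrite /line12 trmx3 !mulmx3; move: type_hyperbolic.
  by congr (has_type _ _ _); congr mx3; ring.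
by rewrite sum_const; ring.
Qed.

Lemma distribution13 k : k != 0 ->
  distribution (line13 k) 0 (1 + (square k)%:R) (~~ square k)%:R (q - 1).
Proof.
move=> k0; exists (if square k then H2r else H2i), (fun t => if t == 0 then H2r else H3).
split=> [|t|X].
- by rewrite /line13 mulr1; apply: type_diag12.
- rewrite /line13; case: eqVneq => [->|t0].
    by rewrite mulr0 oppr0; apply: type_hyperbolic.
  apply: type_det; rewrite (_ : _ + _ = k * t) ?mulf_neq0 //; ring.
rewrite (eq_bigr (fun t => if t == 0 then X H2r else X H3)); last by move=> t _; case: ifP.
by rewrite sum_if0; case: square => /=; ring.
Qed.

(** The determinant is - k x y (x + y). The singular points (0, 1) and (1, 0) have discriminant k,
    while (1, -1) is always a pair of real lines. *)
Lemma distribution14 k : k != 0 ->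
  distribution (line14 k) 0 (1 + 2 * (square k)%:R) (2 * (~~ square k)%:R) (q - 2).
Proof.
move=> k0; pose h := if square k then H2r else H2i.
have n1 : - 1 != 0 :> F by rewrite oppr_eq0 oner_eq0.
exists h, (fun t => if t == 0 then h else if t == - 1 then H2r else H3).
split=> [|t|X].
- rewrite /line14 add0r mulr1; apply: type_block12.
  have E : 0 ^+ 2 - - k * 1 = k by ring.
  by rewrite /h; case: ifPn => sk; [apply: type_split|apply: type_nonsplit]; rewrite ?E.
- rewrite /line14; case: eqVneq => [->|t0].
    have E : 0 ^+ 2 - 1 * - (k * (1 + 0)) = k by ring.
    by rewrite /h; case: ifPn => sk; [apply: type_split|apply: type_nonsplit]; rewrite ?E.
  case: eqVneq => [->|t1].
    rewrite subrr mulr0 oppr0; apply: type_block02.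
    have E : 0 ^+ 2 - 1 * - 1 = 1 ^+ 2 :> F by ring.
    by apply: type_split; rewrite // E ?sqr_square // expf_neq0 ?oner_eq0.
  apply: type_det; rewrite (_ : _ + _ = - (k * (1 + t) * t)); last by ring.
  by rewrite oppr_eq0 !mulf_neq0 // addrC addr_eq0.
rewrite (bigD1 0) //= eqxx (bigD1 (- 1)) //= (negPf n1) eqxx.
rewrite (eq_bigr (fun=> X H3)); last by move=> t /andP[/negPf-> /negPf->].
rewrite sumr_const.
have -> : #|[pred t : F | (t != 0) && (t != - 1)]| = (#|F| - 2)%N.
  rewrite -(cardC (pred2 (0 : F) (-1))) card2 eq_sym n1 addnC addnK.
  by apply: eq_card => t; rewrite !inE negb_or.
rewrite -[X H3 *+ _]mulr_natl natrB ?finNzRing_gt1 //.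
by rewrite /h; case: square => /=; ring.
Qed.

(** At (1, t) the determinant is v t^2 + u v t - 1, which has no root; the only singular point (0,
    1) has discriminant - v. *)
Lemma distribution15 u v : quadratic_condition u v ->
  distribution (line15 u v) 0 (square (- v))%:R (~~ square (- v))%:R q.
Proof.
move=> [v0 irr]; exists (if square (- v) then H2r else H2i), (fun=> H3).
split=> [|t|X].
- have E : 0 ^+ 2 - v * 1 = - v by ring.
  rewrite /line15 mulr1 mulr0 add0r.
  by case: ifPn => sk; [apply: type_split|apply: type_nonsplit]; rewrite ?E ?oppr_eq0.
- rewrite /line15; apply: type_det.
  by rewrite (_ : _ + _ = v * t ^+ 2 + u * v * t - 1) ?irr //; ring.
by rewrite sum_const; case: square => /=; ring.
Qed.

Lemma distribution16 : distribution (@line16 F) 0 1 0 q.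
Proof.
exists H2r, (fun=> H3); split=> [|t|X].
- by apply: type_block12; apply: type_hyperbolic.
- rewrite /line16; apply: type_det.
  by rewrite (_ : _ + _ = - 1) ?oppr_eq0 ?oner_eq0 //; ring.
by rewrite sum_const; ring.
Qed.

Lemma distribution17 al be ga : cubic_condition al be ga ->
  distribution (line17 al be ga) 0 0 0 (q + 1).
Proof.
move=> irr; have al0 := al_neq0 irr.
exists H3, (fun=> H3); split=> [|t|X].
- rewrite /line17; apply: type_det.
  by rewrite (_ : _ + _ = - 1) ?oppr_eq0 ?oner_eq0 //; field.
- rewrite /line17; apply: type_det.
  have [->|t0] := eqVneq t 0.
    by rewrite (_ : _ + _ = - al^-1) ?oppr_eq0 ?invr_eq0 //; ring.
  (* Up to a nonzero factor, the determinant is the rootless cubic evaluated at 1/t. *)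
  rewrite (_ : _ + _ = - (al^-1 * t ^+ 3 *
     (t^-1 ^+ 3 + ga * t^-1 ^+ 2 - be * t^-1 + al))).
    by rewrite oppr_eq0 !mulf_neq0 ?invr_eq0 ?expf_neq0 // irr.
  by field; rewrite al0 t0.
by rewrite sum_const; ring.
Qed.

End Distribution.

(** * Reduction of the lines o10 to the case u = 0 *)

Lemma K_orbit_act (F : finFieldType) (B : 'M[F]_3) L : B \in unitmx ->
  K_orbit (K_act B L) = K_orbit L.
Proof.
move=> uB; apply/setP => L'; apply/imsetP/imsetP => -[A uA ->].
  by exists (A *m B); rewrite ?K_actM // unitmx_mul uA uB.
exists (A *m invmx B); first by rewrite unitmx_mul unitmx_inv uA uB.
by rewrite K_actM -(K_actM _ B) mulVmx // K_act1.
Qed.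

(** Completing the square with s = u v / 2. The new parameter v + s^2 is a quarter of the
    discriminant v (u^2 v + 4), hence a nonsquare. *)
Lemma K_orbit_line10 (F : finFieldType) (q_odd : odd #|F|) (u v : F) :
  quadratic_condition u v ->
  exists2 d, ~~ square d &
    K_orbit (line_of (fun x y => mx3 (v * x) y 0 y (x + u * y) 0 0 0 0)) =
    K_orbit (line_of (line10 d)).
Proof.
move=> uv; have two0 := two_neq0 q_odd; have nD := quadratic_discriminant q_odd uv.
pose s := u * v / 2; exists (v + s ^+ 2).
  rewrite -(square_mulr _ two0) (_ : _ * _ = v * (u ^+ 2 * v + 4)) //.
  by rewrite /s; field.
pose B := mx3 1 s 0 0 1 0 0 0 1.
have uB : B \in unitmx.
  by apply: mx3_unit; rewrite (_ : _ + _ = 1) ?oner_eq0 //; ring.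
rewrite -(K_orbit_act _ uB); congr (K_orbit _).
have BE x y : B *m mx3 (v * x) y 0 y (x + u * y) 0 0 0 0 *m B^T =
    line10 (v + s ^+ 2) (x + u * y) (y + s * (x + u * y)).
  by rewrite /line10 trmx3 !mulmx3; congr mx3; rewrite /s; field.
apply/setP => N; apply/imsetP/imsetP => [[_ /imsetP[[x y] _ ->] ->]|[[x y] _ ->]] /=.
  by rewrite BE; exists (x + u * y, y + s * (x + u * y)).
(* The inverse of the change of parameters (x, y) -> (x + u y, y + s (x + u y)). *)
exists (mx3 (v * (x - u * (y - s * x))) (y - s * x) 0
  (y - s * x) (x - u * (y - s * x) + u * (y - s * x)) 0 0 0 0).
  by apply: (imset_f _ (x := (x - u * (y - s * x), y - s * x))).
by rewrite BE; congr line10; ring.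
Qed.

(** * Counts of squares, and the distributions that need them *)

Section SquareSums.
Variable F : finFieldType.
Hypothesis q_odd : odd #|F|.
Local Notation q := (#|F|%:R : rat).

Lemma sum_squares (A B : rat) :
  \sum_(t : F | t != 0) (if square t then A else B) = (q - 1) / 2 * (A + B).
Proof.
have E : #|nzsquares F|%:R = (q - 1) / 2 :> rat.
  by rewrite -card_nz card_neq0 -(card_nzsquares q_odd) natrM mulfK.
rewrite (bigID (fun t => square t)) /=.
rewrite (eq_bigr (fun=> A)) => [|t /andP[_ ->]] //.
rewrite [X in _ + X](eq_bigr (fun=> B)) => [|t /andP[_ /negPf->]] //.
rewrite !sumr_const.
have -> : #|[pred t : F | (t != 0) && square t]| = #|nzsquares F|.
  by apply: eq_card => t; rewrite !inE.
have -> : #|[pred t : F | (t != 0) && ~~ square t]| = #|nzsquares F|.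
  rewrite -(card_nonsquares q_odd); apply: eq_card => t; rewrite !inE.
  by apply: andb_idl => /nonsquare_neq0.
by rewrite -[A *+ _]mulr_natl -[B *+ _]mulr_natl E; ring.
Qed.

(* s^2 = t^2 - d factors as (t + s)(t - s) = d. *)
Lemma card_square_shift d : ~~ square d ->
  #|[set t : F | square (t ^+ 2 - d)]|%:R = (q - 1) / 2 :> rat.
Proof.
have two0 := two_neq0 q_odd.
move=> nd; have d0 := nonsquare_neq0 nd.
rewrite -card_nz; apply: (canRL (mulfK _)) => //; rewrite -(natrM _ _ 2); congr (_%:R).
pose g (x : F) := ((x + d / x) / 2, (x - d / x) / 2).
have g_inj : {in nz F &, injective g}.
  move=> x y x0 y0.
  move=> E; have E2 : (g x).1 + (g x).2 = (g y).1 + (g y).2 by rewrite E.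
  rewrite /g /= in E2.
  by apply: (lin_eq E2); field; rewrite two0; move: x0 y0; rewrite !inE => -> ->.
rewrite -(card_in_imset g_inj).
have -> : g @: nz F = [set t | t.2 ^+ 2 == t.1 ^+ 2 - d].
  apply/setP => -[t s]; rewrite inE /=; apply/imsetP/eqP => [[x /[!inE] x0 [-> ->]]|E].
    by field; rewrite two0.
  have xd : (t + s) * (t - s) = d by apply: (lin_eq (esym E)); ring.
  have x0 : t + s != 0 by apply: contraNneq d0 => x0; rewrite -xd x0 mul0r.
  exists (t + s); rewrite ?inE // /g -xd.
  by congr (_, _); field; rewrite two0.
(* Every admissible t comes with exactly two values of s, because t^2 - d is nonzero. *)
rewrite -sum_nat_const.
rewrite -[RHS]sum1_card (partition_big (fun t => t.1) (mem [set t | square (t ^+ 2 - d)])) /=.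
  apply: eq_bigr => t; rewrite inE => sq.
  have n0 : t ^+ 2 - d != 0 by apply: contraNneq nd => /subr0_eq <-; apply: sqr_square.
  rewrite sum1dep_card -[LHS](card_sqrt q_odd n0 sq).
  rewrite -(card_imset _ (f := pair t)) => [|x y [] //].
  apply: eq_card => -[t' s]; rewrite !inE /=; apply/imsetP/idP.
    by move=> [s' /[!inE] E [-> ->]]; rewrite E eqxx.
  by move=> /andP[E /eqP Et]; exists s; rewrite ?inE -?Et.
by move=> [t s] /[!inE] /= /eqP <-; apply: sqr_square.
Qed.

(** The change of variables (x + y, x - y) turns x^2 - y^2 into a product. *)
Lemma card_nonisotropic1 : #|nonisotropic (1 : F)|%:R = (q - 1) ^+ 2 :> rat.
Proof.
have two0 := two_neq0 q_odd.
rewrite expr2 -card_nz -natrM -cardsX; congr (_%:R).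
pose g (t : F * F) := (t.1 + t.2, t.1 - t.2).
have g_inj : injective g.
  move=> [x y] [x' y'] [e1 e2].
  have e : x = x'.
    by apply: (mulfI two0); apply: (lin_eq (congr2 +%R e1 e2)); ring.
  by congr (_, _) => //; move: e1; rewrite e => /addrI.
rewrite -(card_imset _ g_inj); apply: eq_card => -[x y]; rewrite !inE /=.
apply/imsetP/andP => [[[a b] /[!inE] /= ab [-> ->]]|[x0 y0]].
  by apply/andP; rewrite -negb_or -mulf_eq0; move: ab; congr (_ != 0); ring.
exists ((x + y) / 2, (x - y) / 2); last by rewrite /g /=; congr (_, _); field.
rewrite inE /= (_ : _ - _ = x * y) ?mulf_neq0 //; by field.
Qed.

Lemma card_nonisotropic_nonsquare (k : F) : ~~ square k ->
  #|nonisotropic k|%:R = q ^+ 2 - 1 :> rat.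
Proof.
move=> nk; rewrite -card_nonzero_pairs; congr (_%:R).
by apply: eq_card => -[x y]; rewrite !inE /= norm_eq0.
Qed.

Variable d : F.
Hypothesis nd : ~~ square d.

Lemma distribution5 : distribution d (@line5 F) 2 ((q - 1) / 2) ((q - 1) / 2) 0.
Proof.
exists H1, (fun t => if t == 0 then H1 else if square (- t) then H2r else H2i).
split=> [|t|X].
- by apply: type_swap; apply: type_rank1; rewrite ?oner_eq0 //; ring.
- rewrite /line5; case: eqVneq => [->|t0].
    by apply: type_rank1; rewrite ?oner_eq0 //; ring.
  have E : 0 ^+ 2 - 1 * t = - t by ring.
  by case: ifPn => sk; [apply: type_split|apply: type_nonsplit]; rewrite ?E ?oppr_eq0.
rewrite (bigD1 0) //= eqxx.
rewrite (eq_bigr (fun t => if square (- t) then X H2r else X H2i)); last first.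
  by move=> t /negPf->; case: ifP.
rewrite (reindex_inj (@oppr_inj F)) /=.
under eq_bigl => t do rewrite oppr_eq0.
by under eq_bigr => t _ do rewrite opprK; rewrite sum_squares; ring.
Qed.

Lemma distribution10 k : ~~ square k ->
  distribution d (line10 k) 0 ((q + 1) / 2) ((q + 1) / 2) 0.
Proof.
move=> nk; exists H2r, (fun t => if square (t ^+ 2 - k) then H2r else H2i).
split=> [|t|X].
- by rewrite /line10 mulr0; apply: type_hyperbolic.
- rewrite /line10.
  have E : t ^+ 2 - k * 1 * 1 = t ^+ 2 - k by ring.
  have n0 : t ^+ 2 - k != 0 by apply: contraNneq nk => /subr0_eq <-; apply: sqr_square.
  by case: ifPn => sk; [apply: type_split|apply: type_nonsplit]; rewrite ?E.
rewrite (bigID (fun t => square (t ^+ 2 - k))) /=.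
rewrite (eq_bigr (fun=> X H2r)) => [|t ->] //.
rewrite [Y in _ + (_ + Y)](eq_bigr (fun=> X H2i)) => [|t /negPf->] //.
rewrite !sumr_const.
have S := card_square_shift nk.
have C : #|[pred t : F | ~~ square (t ^+ 2 - k)]|%:R = q - (q - 1) / 2 :> rat.
  rewrite -S -[#|F|](cardC [pred t : F | square (t ^+ 2 - k)]) natrD cardsE.
  by rewrite addrAC subrr add0r; congr (_%:R); apply: eq_card.
rewrite cardsE in S.
by rewrite -[X H2r *+ _]mulr_natl -[X H2i *+ _]mulr_natl S C; field.
Qed.

End SquareSums.

(** * Verification of the table, orbit by orbit *)

Ltac linear_matrix def :=
  by move=> x y; rewrite /def !scalemx3 addmx3; congr mx3; ring.

Ltac symmetric_matrix def := by move=> x y; rewrite /def trmx3.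

Section Counts.
Variables (F : finFieldType) (d : F).
Hypotheses (q_odd : odd #|F|) (nd : ~~ square d).
Local Notation q := (#|F|%:R : rat).

Definition counts o M := forall h (p : {mpoly F[3]}), in_hyperplane_orbit h p ->
  #|[set L in K_orbit (line_of M) | L \subset hyperplane p]|%:R = line_count o h q.

Let q0 : q != 0 := q_neq0 F.
Let qB1 : q - 1 != 0 := qB1_neq0 F.
Let qD1 : q + 1 != 0 := qD1_neq0 F.

(** Factors the stabilizer orders into q, q - 1 and q + 1, whose nonvanishing is known. *)
Let neq0E : (q ^+ 2 - 1 = (q - 1) * (q + 1)) * (q ^+ 2 - q = q * (q - 1)) *
  (q ^+ 3 - q ^+ 2 = q ^+ 2 * (q - 1)).
Proof. by split; [split|]; ring. Qed.

Ltac nonzero := by rewrite ?neq0E !(mulf_neq0, expf_neq0).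
Ltac arith := by case; rewrite /line_count /incidence_number /gl3_order /=;
  field; rewrite ?q0 ?qB1 ?qD1.


Ltac count_with D S M :=
  apply: (count_of_distribution q_odd nd _ _ D S);
  [linear_matrix M | symmetric_matrix M | nonzero | arith].

Lemma counts5 : counts o5 (@line5 F).
Proof. count_with (distribution5 q_odd nd) (card_stabilizer5 F) @line5. Qed.

Lemma counts6 : counts o6 (@line6 F).
Proof. count_with (distribution6 d q_odd) (card_stabilizer6 F) @line6. Qed.

Lemma square1 : square (1 : F).
Proof. by rewrite -(expr1n F 2) sqr_square. Qed.

Lemma counts8_1 : counts o8_1 (line8 (1 : F)).
Proof.
have o0 := oner_neq0 F; have D := distribution8 q_odd nd o0.
have S := card_stabilizer8 q_odd o0.
rewrite square1 /= in D; rewrite card_nonisotropic1 // in S.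
count_with D S @line8.
Qed.

Lemma counts8_2 k : ~~ square k -> counts o8_2 (line8 k).
Proof.
move=> nk; have k0 := nonsquare_neq0 nk; have D := distribution8 q_odd nd k0.
have S := card_stabilizer8 q_odd k0.
rewrite (negPf nk) /= in D; rewrite card_nonisotropic_nonsquare // in S.
count_with D S @line8.
Qed.

Lemma counts9 : counts o9 (@line9 F).
Proof. count_with (distribution9 d q_odd) (card_stabilizer9 F) @line9. Qed.

Lemma counts10 k : ~~ square k -> counts o10 (line10 k).
Proof.
move=> nk.
count_with (distribution10 q_odd nd nk) (card_stabilizer10 q_odd nk) @line10.
Qed.

Lemma counts12 : counts o12_1 (@line12 F).
Proof. count_with (distribution12 d q_odd) (card_stabilizer12 q_odd) @line12. Qed.

Lemma counts13_1 : counts o13_1 (line13 (1 : F)).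
Proof.
have o0 := oner_neq0 F; have D := distribution13 q_odd nd o0.
rewrite square1 /= in D.
count_with D (card_stabilizer13 q_odd o0) @line13.
Qed.

Lemma counts13_2 k : ~~ square k -> counts o13_2 (line13 k).
Proof.
move=> nk; have k0 := nonsquare_neq0 nk; have D := distribution13 q_odd nd k0.
rewrite (negPf nk) /= in D.
count_with D (card_stabilizer13 q_odd k0) @line13.
Qed.

Lemma counts14_1 : counts o14_1 (line14 (1 : F)).
Proof.
have D := distribution14 q_odd nd (oner_neq0 F); rewrite square1 /= in D.
have S : #|stabilizer (line14 (1 : F))|%:R = 3 * 8 * (q - 1) :> rat.
  have JP j : j \in [set: 'I_3] <-> ((1 : F) = 1 \/ j = 1).
    by rewrite inE; split=> // _; left.
  by have := card_stabilizer14 q_odd (or_introl erefl) JP; rewrite cardsT card_ord.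
count_with D S @line14.
Qed.

Lemma counts14_2 k : ~~ square k -> counts o14_2 (line14 k).
Proof.
move=> nk; have D := distribution14 q_odd nd (nonsquare_neq0 nk).
rewrite (negPf nk) /= in D.
have S : #|stabilizer (line14 k)|%:R = 1 * 8 * (q - 1) :> rat.
  have JP j : j \in [set (1 : 'I_3)] <-> (k = 1 \/ j = 1).
    rewrite inE; split=> [/eqP->|[k1|->//]]; first by right.
    by move: nk; rewrite k1 square1.
  by have := card_stabilizer14 q_odd (or_intror nk) JP; rewrite cards1.
count_with D S @line14.
Qed.

Lemma counts15_1 u v : quadratic_condition u v -> square (- v) ->
  counts o15_1 (line15 u v).
Proof.
move=> uv sv; have D := distribution15 q_odd nd uv; rewrite sv /= in D.
count_with D (card_stabilizer15_square q_odd uv sv) @line15.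
Qed.

Lemma counts15_2 u v : quadratic_condition u v -> ~~ square (- v) ->
  counts o15_2 (line15 u v).
Proof.
move=> uv nv; have D := distribution15 q_odd nd uv; rewrite (negPf nv) /= in D.
count_with D (card_stabilizer15_nonsquare q_odd uv nv) @line15.
Qed.

Lemma counts16 : counts o16_1 (@line16 F).
Proof. count_with (distribution16 d q_odd) (card_stabilizer16 q_odd) @line16. Qed.

Lemma counts17 al be ga : cubic_condition al be ga -> counts o17 (line17 al be ga).
Proof.
move=> irr; have [K [iota [z [z_root comb_bij]]]] := cubic_extension irr.
count_with (distribution17 d q_odd irr)
  (card_stabilizer17 q_odd irr z_root comb_bij) @line17.
Qed.

End Counts.

Theorem theorem4p28 (F : finFieldType) (q_odd : odd #|F|)
    (o : line_orbit) (M : F -> F -> 'M[F]_3) (repM : representative o M)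
    (h : hyperplane_orbit) (p : {mpoly F[3]})
    (hp : in_hyperplane_orbit h p) :
  (#|[set L in K_orbit (line_of M) | L \subset hyperplane p]|)%:R
    = line_count o h (#|F|)%:R.
Proof.
(* Only a reference for the normal form of pairs of imaginary lines; the resulting count does not
   depend on it. *)
have [d nd] := exists_nonsquare q_odd.
(* Needed where a family is specialised to k = 1, which agrees with the representative only after
   removing a factor 1. *)
have eq_line (N N' : F -> F -> 'M[F]_3) : N =2 N' -> line_of N = line_of N'.
  by move=> E; apply: eq_imset => -[x y]; apply: E.
case: repM hp => [|||k nk||u v uv|||k nk||k nk|u v uv sv|u v uv nv||al be ga irr].
- exact: counts5 nd h p.
- exact: counts6 nd h p.
- rewrite (eq_line _ (line8 1)); first exact: counts8_1 nd h p.
  by move=> x y; rewrite /line8 mul1r.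
- exact: counts8_2 nd _ nk h p.
- exact: counts9 nd h p.
- have [k nk Ek] := K_orbit_line10 q_odd uv.
  by rewrite [K_orbit _]Ek; apply: counts10 nd _ nk h p.
- exact: counts12 nd h p.
- rewrite (eq_line _ (line13 1)); first exact: counts13_1 nd h p.
  by move=> x y; rewrite /line13 mul1r.
- exact: counts13_2 nd _ nk h p.
- rewrite (eq_line _ (line14 1)); first exact: counts14_1 nd h p.
  by move=> x y; rewrite /line14 mul1r.
- exact: counts14_2 nd _ nk h p.
- exact: counts15_1 nd _ _ uv sv h p.
- exact: counts15_2 nd _ _ uv nv h p.
- exact: counts16 nd h p.
exact: counts17 nd _ _ _ irr h p.
Qed.
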